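(* Let $0<p,q<\infty$. Let $a=\{a(m)\}_{m\in\mathbb N}$, $b=\{b(m)\}_{m\in\mathbb N}$ and $u=\{u(m)\}_{m\in\mathbb N}$ be given sequences of non-negative real numbers with $b(1)>0$. Consider the inequality $$\bigg(\sum_{m=1}^{\infty}\bigg(\sup_{m\le i<\infty}u(i)\sum_{k=1}^{i}x(k)\bigg)^q a(m)\bigg)^{\frac1q}\le C\bigg(\sum_{m=1}^\infty x(m)^p b(m)\bigg)^{\frac1p}.\qquad( * )$$ Then $( * )$ holds, with some finite constant $C$ independent of $x$, for all non-negative, non-increasing sequences $x=\{x(m)\}_{m\in\mathbb N}$ if and only if the condition corresponding to the applicable case below is satisfied. (i) Case $1<p\le q$: $\max\{C_0,C_1,C_2,C_3\}<\infty$, where $$C_1:=\sup_{1\le n<\infty}z(n)A(n)^{\frac1q}\Bigg(\sum_{m=1}^{n}\frac{B(m)^{\frac1{1-p}}b(m+1)}{m^{\frac p{1-p}}B(m+1)}\Bigg)^{\frac{p-1}p},$$ $$C_2:=\sup_{1\le n<\infty}\Bigg(\sum_{i=n}^{\infty}z(i)^q a(i)\Bigg)^{\frac1q}\Bigg(\sum_{m=1}^{n}\frac{B(m)^{\frac1{1-p}}b(m+1)}{m^{\frac p{1-p}}B(m+1)}\Bigg)^{\frac{p-1}p},$$ $$C_3:=\sup_{1\le n<\infty}\Bigg(\sum_{i=1}^{n}a(i)\sup_{i\le j\le n}u(j)^q j^q\Bigg)^{\frac1q}B(n)^{-\frac1p}.$$ (ii) Case $1<p$, $q<p$: $\max\{C_0,C_4,C_5,C_6,C_7\}<\infty$,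 where $$C_4:=\Bigg(\sum_{n=1}^\infty\Bigg(\sum_{i=n}^\infty z(i)^q a(i)\Bigg)^{\frac q{p-q}}z(n)^q a(n)\Bigg(\sum_{m=1}^{n}\frac{B(m)^{\frac1{1-p}}b(m+1)}{m^{\frac p{1-p}}B(m+1)}\Bigg)^{\frac{(p-1)q}{p-q}}\Bigg)^{\frac{p-q}{pq}},$$ $$C_5:=\Bigg(\sum_{n=1}^\infty A(n)^{\frac q{p-q}}a(n)\sup_{n\le k<\infty}z(k)^{\frac{pq}{p-q}}\Bigg(\sum_{m=1}^{k}\frac{B(m)^{\frac1{1-p}}b(m+1)}{m^{\frac p{1-p}}B(m+1)}\Bigg)^{\frac{(p-1)q}{p-q}}\Bigg)^{\frac{p-q}{pq}},$$ $$C_6:=\Bigg(\sum_{n=1}^\infty A(n)^{\frac q{p-q}}a(n)\sup_{n\le k<\infty}u(k)^{\frac{pq}{p-q}}k^{\frac{pq}{p-q}}B(k)^{-\frac q{p-q}}\Bigg)^{\frac{p-q}{pq}},$$ $$C_7:=\Bigg(\sum_{n=1}^\infty\Bigg(\sum_{i=1}^n a(i)\sup_{i\le j\le n}u(j)^q j^q\Bigg)^{\frac q{p-q}}a(n)\sup_{n\le k<\infty}u(k)^q k^q B(k)^{-\frac q{p-q}}\Bigg)^{\frac{p-q}{pq}}.$$ (iii) Case $0<p\le1$, $p\le q$: $\max\{C_8,C_9,C_{10}\}<\infty$, where $$C_8:=\sup_{1\le n<\infty}z(n)A(n)^{\frac1q}\sup_{1\le m\le n}m\,B(m)^{-\frac1p},$$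 $$C_9:=\sup_{1\le n<\infty}\Bigg(\sum_{k=n}^\infty z(k)^q a(k)\Bigg)^{\frac1q}\sup_{1\le m\le n}m\,B(m)^{-\frac1p},$$ $$C_{10}:=\sup_{1\le n<\infty}\Bigg(\sum_{i=1}^n a(i)\sup_{i\le j\le n}u(j)^q j^q\Bigg)^{\frac1q}B(n)^{-\frac1p}.$$ (iv) Case $0<q<p\le1$: $\max\{C_{11},C_{12},C_{13}\}<\infty$, where $$C_{11}:=\Bigg(\sum_{n=1}^\infty\Bigg(\sum_{i=n}^\infty z(i)^q a(i)\Bigg)^{\frac q{p-q}}z(n)^q a(n)\sup_{1\le k\le n}k^{\frac{pq}{p-q}}B(k)^{-\frac q{p-q}}\Bigg)^{\frac{p-q}{pq}},$$ $$C_{12}:=\Bigg(\sum_{n=1}^\infty A(n)^{\frac q{p-q}}a(n)\sup_{n\le k<\infty}z(k)^{\frac{pq}{p-q}}k^{\frac{pq}{p-q}}B(k)^{-\frac q{p-q}}\Bigg)^{\frac{p-q}{pq}},$$ $$C_{13}:=\Bigg(\sum_{n=1}^\infty\Bigg(\sum_{i=1}^n a(i)\sup_{i\le j\le n}u(j)^q j^q\Bigg)^{\frac q{p-q}}a(n)\sup_{n\le k<\infty}u(k)^q k^q B(k)^{-\frac q{p-q}}\Bigg)^{\frac{p-q}{pq}}.$$ Moreover, if $C$ denotes the best constant in $( * )$, then $C\approx C_0+C_1+C_2+C_3$ in case (i), $C\approx C_0+C_4+C_5+C_6+C_7$ in case (ii), $C\approx C_8+C_9+C_{10}$ in case (iii),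 and $C\approx C_{11}+C_{12}+C_{13}$ in case (iv), where the multiplicative constants in all these equivalences depend only on $p$ and $q$.
   Context: $\mathbb N=\{1,2,3,\dots\}$. All given sequences have finite non-negative real entries; sums and suprema are taken in $[0,\infty]$. Notation: $A(m)=\sum_{k=1}^m a(k)$, $B(m)=\sum_{k=1}^m b(k)$ for $m\in\mathbb N$, $B(\infty)=\lim_{m\to\infty}B(m)\in(0,\infty]$, and $z(m):=\sup_{m\le k<\infty}u(k)$. Further, $$C_0:=\bigg(\sum_{m=1}^\infty\Big(\sup_{m\le i<\infty}u(i)\,i\Big)^q a(m)\bigg)^{\frac1q}B(\infty)^{-\frac1p},$$ and by convention $C_0=0$ when $B(\infty)=\infty$. Conventions: $0\cdot\infty=0$, $0/0=0$, $\infty/\infty=0$, $1/0=\infty$, $1/\infty=0$; $\infty^\alpha=\infty$ for $\alpha>0$ and $\infty^\alpha=0$ for $\alpha<0$. The best constant in $( * )$ is the infimum of all finite $C$ for which $( * )$ holds for all non-negative, non-increasing sequences $x$, and it equals $\infty$ if there is no such $C$. For $X,Y\in[0,\infty]$, $X\approx Y$ means $c^{-1}Y\le X\le cY$ for some positive finite constant $c$ (here depending only on $p$ and $q$). *)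

(* Defs.v *)
From mathcomp Require Import all_boot all_order all_algebra.
From mathcomp Require Import all_classical all_reals all_analysis.

Set Implicit Arguments.
Unset Strict Implicit.
Unset Printing Implicit Defensive.

Import Order.TTheory GRing.Theory Num.Theory.
Import numFieldNormedType.Exports.

Local Open Scope classical_set_scope.
Local Open Scope ring_scope.
Local Open Scope ereal_scope.

(* A sequence indexed by {1, 2, 3, ...} is a function nat -> R (or
   nat -> \bar R) whose value at 0 is irrelevant: no sum, supremum, limit or
   hypothesis below looks at index 0 of the given sequences.

   [esups F m] is the supremum of F k over all k >= m.

   In the formulas below [poweR] (the extended real x `^ r) is only used with
   x in [0, +oo] and r > 0, except for B(oo) `^ (- p^-1), which is only used
   when 0 < B(oo) < +oo; the negative real powers only have positive bases. So
   the library's values of 0 `^ r and +oo `^ r for r < 0 play no role. Moreover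
   0 * +oo = 0 in \bar R. *)

Definition nonneg_seq (R : realType) (x : nat -> R) : Prop :=
  forall m : nat, (0 < m)%N -> (0 <= x m)%R.

Definition nonincr_seq (R : realType) (x : nat -> R) : Prop :=
  forall m n : nat, (0 < m)%N -> (m <= n)%N -> (x n <= x m)%R.

Definition psum (R : realType) (x : nat -> R) (m : nat) : R :=
  (\sum_(1 <= k < m.+1) x k)%R.

Definition psum_oo (R : realType) (x : nat -> R) : \bar R :=
  limn (fun m => (psum x m)%:E).

Definition tail_sup (R : realType) (u : nat -> R) (m : nat) : \bar R :=
  esups (fun k => (u k)%:E) m.

Definition range_sup (R : realType) (F : nat -> \bar R) (i n : nat) : \bar R :=
  ereal_sup [set F j | j in [set j | (i <= j <= n)%N]].

Definition ineq_lhs (R : realType) (q : R) (a u x : nat -> R) : \bar R :=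
  (\sum_(1 <= m <oo)
     (esups (fun i => (u i * psum x i)%:E) m) `^ q * (a m)%:E) `^ q^-1.

Definition ineq_rhs (R : realType) (p : R) (b x : nat -> R) : \bar R :=
  (\sum_(1 <= m <oo) (x m `^ p * b m)%:E) `^ p^-1.

Definition admissible_constants (R : realType) (p q : R) (a b u : nat -> R) :
    set R :=
  [set C : R | (0 <= C)%R /\
     forall x : nat -> R, nonneg_seq x -> nonincr_seq x ->
       ineq_lhs q a u x <= C%:E * ineq_rhs p b x].

Definition inequality_holds (R : realType) (p q : R) (a b u : nat -> R) : Prop :=
  exists C : R, admissible_constants p q a b u C.

Definition best_constant (R : realType) (p q : R) (a b u : nat -> R) : \bar R :=
  ereal_inf [set C%:E | C in admissible_constants p q a b u].

Definition equiv_upto (R : realType) (c : R) (X Y : \bar R) : Prop :=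
  (c^-1)%:E * Y <= X /\ X <= c%:E * Y.

Definition Vsum (R : realType) (p : R) (b : nat -> R) (n : nat) : R :=
  (\sum_(1 <= m < n.+1)
     (psum b m `^ (1 / (1 - p)) * b m.+1) /
     (m%:R `^ (p / (1 - p)) * psum b m.+1))%R.

Definition Ztail (R : realType) (q : R) (a u : nat -> R) (n : nat) : \bar R :=
  \sum_(n <= i <oo) (tail_sup u i) `^ q * (a i)%:E.

Definition Wsum (R : realType) (q : R) (a u : nat -> R) (n : nat) : \bar R :=
  \sum_(1 <= i < n.+1)
    (a i)%:E * range_sup (fun j => (u j `^ q * j%:R `^ q)%:E) i n.

Definition C_0 (R : realType) (p q : R) (a b u : nat -> R) : \bar R :=
  if psum_oo b == +oo then 0 else
  (\sum_(1 <= m <oo) (esups (fun i => (u i * i%:R)%:E) m) `^ q * (a m)%:E)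
     `^ q^-1 * (psum_oo b) `^ (- p^-1).

Definition C_1 (R : realType) (p q : R) (a b u : nat -> R) : \bar R :=
  esups (fun n => tail_sup u n * (psum a n `^ q^-1)%:E *
                  (Vsum p b n `^ ((p - 1) / p))%:E) 1%N.

Definition C_2 (R : realType) (p q : R) (a b u : nat -> R) : \bar R :=
  esups (fun n => (Ztail q a u n) `^ q^-1 *
                  (Vsum p b n `^ ((p - 1) / p))%:E) 1%N.

Definition C_3 (R : realType) (p q : R) (a b u : nat -> R) : \bar R :=
  esups (fun n => (Wsum q a u n) `^ q^-1 * (psum b n `^ (- p^-1))%:E) 1%N.

Definition C_4 (R : realType) (p q : R) (a b u : nat -> R) : \bar R :=
  (\sum_(1 <= n <oo)
     (Ztail q a u n) `^ (q / (p - q)) * (tail_sup u n) `^ q * (a n)%:E *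
     (Vsum p b n `^ ((p - 1) * q / (p - q)))%:E) `^ ((p - q) / (p * q)).

Definition C_5 (R : realType) (p q : R) (a b u : nat -> R) : \bar R :=
  (\sum_(1 <= n <oo)
     (psum a n `^ (q / (p - q)) * a n)%:E *
     esups (fun k => (tail_sup u k) `^ (p * q / (p - q)) *
                     (Vsum p b k `^ ((p - 1) * q / (p - q)))%:E) n)
    `^ ((p - q) / (p * q)).

Definition C_6 (R : realType) (p q : R) (a b u : nat -> R) : \bar R :=
  (\sum_(1 <= n <oo)
     (psum a n `^ (q / (p - q)) * a n)%:E *
     esups (fun k => (u k `^ (p * q / (p - q)) * k%:R `^ (p * q / (p - q)) *
                      psum b k `^ (- (q / (p - q))))%:E) n)
    `^ ((p - q) / (p * q)).

Definition C_7 (R : realType) (p q : R) (a b u : nat -> R) : \bar R :=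
  (\sum_(1 <= n <oo)
     (Wsum q a u n) `^ (q / (p - q)) * (a n)%:E *
     esups (fun k => (u k `^ q * k%:R `^ q *
                      psum b k `^ (- (q / (p - q))))%:E) n)
    `^ ((p - q) / (p * q)).

Definition C_8 (R : realType) (p q : R) (a b u : nat -> R) : \bar R :=
  esups (fun n => tail_sup u n * (psum a n `^ q^-1)%:E *
                  range_sup (fun m => (m%:R * psum b m `^ (- p^-1))%:E) 1%N n) 1%N.

Definition C_9 (R : realType) (p q : R) (a b u : nat -> R) : \bar R :=
  esups (fun n => (Ztail q a u n) `^ q^-1 *
                  range_sup (fun m => (m%:R * psum b m `^ (- p^-1))%:E) 1%N n) 1%N.

Definition C_10 (R : realType) (p q : R) (a b u : nat -> R) : \bar R :=
  esups (fun n => (Wsum q a u n) `^ q^-1 * (psum b n `^ (- p^-1))%:E) 1%N.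

Definition C_11 (R : realType) (p q : R) (a b u : nat -> R) : \bar R :=
  (\sum_(1 <= n <oo)
     (Ztail q a u n) `^ (q / (p - q)) * (tail_sup u n) `^ q * (a n)%:E *
     range_sup (fun k => (k%:R `^ (p * q / (p - q)) *
                          psum b k `^ (- (q / (p - q))))%:E) 1%N n)
    `^ ((p - q) / (p * q)).

Definition C_12 (R : realType) (p q : R) (a b u : nat -> R) : \bar R :=
  (\sum_(1 <= n <oo)
     (psum a n `^ (q / (p - q)) * a n)%:E *
     esups (fun k => (tail_sup u k) `^ (p * q / (p - q)) *
                     (k%:R `^ (p * q / (p - q)) *
                      psum b k `^ (- (q / (p - q))))%:E) n)
    `^ ((p - q) / (p * q)).

Definition C_13 (R : realType) (p q : R) (a b u : nat -> R) : \bar R :=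
  (\sum_(1 <= n <oo)
     (Wsum q a u n) `^ (q / (p - q)) * (a n)%:E *
     esups (fun k => (u k `^ q * k%:R `^ q *
                      psum b k `^ (- (q / (p - q))))%:E) n)
    `^ ((p - q) / (p * q)).

(* Main.v *)
Require Import Defs.
From mathcomp Require Import all_boot all_order all_algebra.
From mathcomp Require Import all_classical all_reals all_analysis.
From mathcomp Require Import ring lra zify.
Set Implicit Arguments.
Unset Strict Implicit.
Unset Printing Implicit Defensive.
Import Order.TTheory GRing.Theory Num.Theory.
Import numFieldNormedType.Exports.
Local Open Scope ring_scope.

(* All sums and suprema are first truncated at an index N, with constants not
   depending on N; letting N tend to infinity gives the general statement.

   Sufficiency. On [m, N] the supremum of u(i) X(i), with X = psum x, is attained
   at a point sigma(m), and sigma is constant on [m, sigma(m)]. The partial sums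
   satisfy
     X(n)^p <= c (sum_(m <= n) G(m) Phi(m) + n^p f(n)),
   where f is non-increasing, the sums of G and of f b are bounded by the sum of
   x^p b, and Phi(n) is max_(m <= n) m^p / B(m) for p <= 1 and Vsum(n)^(p-1) for
   p > 1. The inequality thus splits into a Hardy inequality for the operator
   sum_(m <= n) and one for the dual operator, with weights a(m) u(sigma(m))^q
   and a(m) (u(sigma(m)) sigma(m))^q.

   Necessity. The inequality is tested on max_k d(k)^(1/p) x_k with arbitrary
   d >= 0, where x_k is a normalized indicator of [1, k] or, for p > 1, a
   multiple of i |-> sum_(i <= m <= k) v(m) / m, where v(m) are the terms of
   Vsum. For q < p it is enough to choose d supported near the indices at which
   A has doubled, since A^(q/(p-q)) summed over these indices is geometric. *)

(** * Real powers, partial sums and maxima *)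

(** Raised to the power q, the inequality has the exponent Q = q / p on the right, and everything
    depends on whether Q is below 1. For Q >= 1 convexity reduces an operator to pointwise
    conditions. For Q < 1 the conditions are sums with the exponents th = q / (p - q) = Q / (1 - Q)
    and 1 + th = 1 / (1 - Q). The Hardy inequality is then obtained by dividing by an auxiliary
    weight and optimizing a scaling parameter. In the converse direction one shows D <= c D^Q for
    the truncated sum D itself and cancels D^Q, which is legitimate because truncation makes D
    finite. Maxima of test sequences are used rather than sums: for every p > 0 the p-th power of a
    maximum is at most the sum of the p-th powers, so the right side is controlled by the sum of d.
    The delicate condition multiplies a power of W(n), which itself contains maxima over [i, n], by
    a maximum over k >= n. To reach it, the inequality is first turned into one for a new weight,
    concentrated at chosen maximizers in the doubling blocks of A, for which the ordinary test
    applies. *)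

Section Powers.
Context {R : realType}.
Implicit Types (e s t x y : R).

Lemma le_powR e s t : 0 <= e -> 0 <= s -> s <= t -> s `^ e <= t `^ e.
Proof.
move=> e0 s0 st; apply: (ge0_ler_powR e0) => //; rewrite nnegrE //.
exact: le_trans st.
Qed.

Lemma powRK e s : e != 0 -> 0 <= s -> (s `^ e) `^ e^-1 = s.
Proof. by move=> e0 s0; rewrite -powRrM mulfV // powRr1. Qed.

Lemma powRVK e s : e != 0 -> 0 <= s -> (s `^ e^-1) `^ e = s.
Proof. by move=> e0 s0; rewrite -powRrM mulVf // powRr1. Qed.

Lemma powR_leK e s t : 0 < e -> 0 <= s -> 0 <= t -> s `^ e <= t `^ e -> s <= t.
Proof.
move=> e0 s0 t0 h; have en0 : e != 0 by rewrite gt_eqF.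
have ei : 0 <= e^-1 by rewrite invr_ge0 ltW.
by have := le_powR ei (powR_ge0 s e) h; rewrite !powRK.
Qed.

Lemma powR_nonincr e s t : e <= 0 -> 0 < s -> s <= t -> t `^ e <= s `^ e.
Proof.
move=> e0 s0 st; rewrite -(opprK e) !(powRN _ (- e)) lef_pV2 ?posrE ?powR_gt0//.
  by apply: le_powR; rewrite ?oppr_ge0// ltW.
exact: lt_le_trans st.
Qed.

Lemma powRDpos e1 e2 s : 0 < s -> s `^ (e1 + e2) = s `^ e1 * s `^ e2.
Proof. by move=> s0; rewrite powRD// (gt_eqF s0) implybT. Qed.

Lemma powRDge0 e1 e2 s : 0 < e1 + e2 -> s `^ (e1 + e2) = s `^ e1 * s `^ e2.
Proof. by move=> h; rewrite powRD// gt_eqF. Qed.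

(** Tangent line of a concave power at 1, read off from Young's inequality for the pair x^e, 1 with
    exponents 1/e and 1/(1 - e). *)
Lemma bernoulli_le e x : 0 < e <= 1 -> 0 <= x -> x `^ e <= 1 + e * (x - 1).
Proof.
move=> /andP[e0 e1] x0; have [->|ne1] := eqVneq e 1.
  by rewrite powRr1//; lra.
have e1' : e < 1 by rewrite lt_neqAle ne1.
have := @conjugate_powR R (x `^ e) 1 e^-1 (1 - e)^-1 (powR_ge0 _ _) ler01.
rewrite !invrK powR1 !invr_gt0 e0 subr_gt0 e1' powRK ?gt_eqF// mulr1 mul1r => h.
have : x `^ e <= x * e + (1 - e) by apply: h => //; ring.
by move/le_trans; apply; lra.
Qed.

(** The concave inequality for the exponent 1/e, taken at the point x^e. *)
Lemma bernoulli_ge e x : 1 <= e -> 0 <= x -> 1 + e * (x - 1) <= x `^ e.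
Proof.
move=> e1 x0; have e0 : 0 < e by lra.
have := @bernoulli_le e^-1 (x `^ e).
rewrite invr_gt0 e0 invf_le1// e1 powR_ge0 powRK ?gt_eqF// => /(_ isT isT) h.
have : e * x <= e * (1 + e^-1 * (x `^ e - 1)) by rewrite ler_pM2l.
rewrite mulrDr mulrA divff ?gt_eqF//; lra.
Qed.

(** On [0, 1] the graph of x^e lies between its chord and its tangent at 1. Which of the two is
    above depends on whether e is below 1, hence [Num.min] and [Num.max]. *)
Lemma onem_powR e x : 0 < e -> 0 <= x <= 1 ->
  Num.min 1 e * (1 - x) <= 1 - x `^ e <= Num.max 1 e * (1 - x).
Proof.
move=> e0 /andP[x0 x1].
have [->|xn0] := eqVneq x 0.
  rewrite powR0 ?gt_eqF// subr0 !mulr1; apply/andP; split.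
    by rewrite ge_min lexx.
  by rewrite le_max lexx.
have xp : 0 < x <= 1 by rewrite lt_neqAle eq_sym xn0 x0 x1.
have [e1|e1] := leP e 1.
  have := @bernoulli_le e x; rewrite e0 e1 => /(_ isT x0) h.
  have := ger1_powR xp e1 => h2.
  by apply/andP; split; lra.
have := @bernoulli_ge e x (ltW e1) x0 => h.
have := ge1r_powR xp (ltW e1) => h2.
by apply/andP; split; lra.
Qed.

(* With s = 0 both sides vanish because t = 0, whatever the value of 0 `^ (e - 1). *)
Lemma powR_diff e s t : 0 < e -> 0 <= t <= s ->
  Num.min 1 e * ((s - t) * s `^ (e - 1)) <= s `^ e - t `^ e <=
  Num.max 1 e * ((s - t) * s `^ (e - 1)).
Proof.
move=> e0 /andP[t0 ts]; have [s0|sn0] := eqVneq s 0.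
  have -> : t = 0 by apply/eqP; rewrite eq_le t0 -s0 ts.
  by rewrite s0 !subrr !mul0r !mulr0 lexx.
have sp : 0 < s by rewrite lt_neqAle eq_sym sn0 (le_trans t0).
have lam : 0 <= t / s <= 1 by rewrite ler_pdivrMr// mul1r ts divr_ge0// ltW.
have tE : t `^ e = s `^ e * (t / s) `^ e.
  by rewrite -powRM ?divr_ge0 ?(ltW sp)// mulrCA divff ?mulr1.
have dE : (s - t) * s `^ (e - 1) = s `^ e * (1 - t / s).
  have -> : s `^ e = s `^ (e - 1) * s.
    by rewrite -{3}(powRr1 (ltW sp)) -powRDpos// subrK.
  by field.
have dF : s `^ e - t `^ e = s `^ e * (1 - (t / s) `^ e) by rewrite tE mulrBr mulr1.
rewrite dF dE !(mulrCA _ (s `^ e)).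
by rewrite !ler_pM2l ?powR_gt0//; exact: onem_powR.
Qed.

Lemma min1_gt0 e : 0 < e -> 0 < Num.min 1 e.
Proof. by move=> e0; rewrite lt_min ltr01. Qed.

Lemma max1_gt0 e : 0 < Num.max 1 e.
Proof. by rewrite lt_max ltr01. Qed.

Lemma max1_ge1 e : 1 <= Num.max 1 e.
Proof. by rewrite le_max lexx. Qed.

Lemma powRD_le e x y : 0 <= e -> 0 <= x -> 0 <= y ->
  (x + y) `^ e <= 2 `^ e * (x `^ e + y `^ e).
Proof.
move=> e0 x0 y0; wlog xy : x y x0 y0 / x <= y.
  move=> h; have [/h->//|/ltW/h] := leP x y.
  by rewrite addrC (addrC (y `^ e)); apply.
apply: (@le_trans _ _ ((2 * y) `^ e)); first by apply: le_powR; lra.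
rewrite powRM// ler_pM2l ?powR_gt0//; have := powR_ge0 x e; lra.
Qed.

End Powers.

(** * Partial sums and discrete integration of powers *)

Section Sums.
Context {R : realType}.
Implicit Types (a w x y : nat -> R) (e : R) (n m N k : nat).

Lemma psum0 a : psum a 0 = 0.
Proof. by rewrite /psum big_geq. Qed.

Lemma psumS a n : psum a n.+1 = psum a n + a n.+1.
Proof. by rewrite /psum big_nat_recr. Qed.

Lemma ler_psum a x n : (forall k, (0 < k <= n)%N -> a k <= x k) ->
  psum a n <= psum x n.
Proof. by move=> h; apply: ler_sum_nat => k /andP[k0 kn]; apply: h; rewrite k0. Qed.

Lemma eq_psum a x n : (forall k, (0 < k <= n)%N -> a k = x k) ->
  psum a n = psum x n.
Proof. by move=> h; apply: eq_big_nat => k /andP[k0 kn]; apply: h; rewrite k0. Qed.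

Lemma psum_ge0 a n : (forall k, (0 < k <= n)%N -> 0 <= a k) -> 0 <= psum a n.
Proof.
move=> h; rewrite /psum big_nat; apply: sumr_ge0 => k /andP[k0 kn].
by apply: h; rewrite k0.
Qed.

Lemma nonneg_psum a n : nonneg_seq a -> 0 <= psum a n.
Proof. by move=> h; apply: psum_ge0 => k /andP[k0 _]; exact: h. Qed.

Lemma psum_nondecr a n m : nonneg_seq a -> (n <= m)%N -> psum a n <= psum a m.
Proof.
move=> a0 /subnK <-; elim: (m - n)%N => [|k IH]//.
by rewrite addSn psumS (le_trans IH)// lerDl a0.
Qed.

Lemma psumM (c : R) a n : psum (fun k => c * a k) n = c * psum a n.
Proof. by rewrite /psum mulr_sumr. Qed.

Lemma psumD a x n : psum (fun k => a k + x k) n = psum a n + psum x n.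
Proof. by rewrite /psum big_split. Qed.

Lemma le_psum_term a n k : nonneg_seq a -> (0 < k <= n)%N -> a k <= psum a n.
Proof.
move=> a0 /andP[k0 kn]; apply: (@le_trans _ _ (psum a k)); last exact: psum_nondecr.
by case: k k0 {kn} => // k _; rewrite psumS lerDr nonneg_psum.
Qed.

Lemma psum_gt0 a n : nonneg_seq a -> 0 < a 1%N -> (0 < n)%N -> 0 < psum a n.
Proof. by move=> a0 a1 n0; apply: lt_le_trans a1 _; apply: le_psum_term. Qed.

(** Discrete form of integrating A^(e - 1) dA: sampling at the right endpoint [psum a k] costs only
    the constant [Num.min 1 e] here, and [Num.max 1 e] in the reverse bound. *)
Lemma psum_pow_ge a e n : nonneg_seq a -> 0 < e ->
  Num.min 1 e * psum (fun k => a k * psum a k `^ (e - 1)) n <= psum a n `^ e.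
Proof.
move=> a0 e0; elim: n => [|n IH]; first by rewrite !psum0 mulr0 powR_ge0.
rewrite psumS mulrDr.
have := @powR_diff R e (psum a n.+1) (psum a n) e0.
rewrite nonneg_psum//= psum_nondecr// => /(_ isT) /andP[h _].
have E : psum a n.+1 - psum a n = a n.+1 by rewrite psumS; ring.
rewrite E in h; lra.
Qed.

Lemma psum_pow_le a e n : nonneg_seq a -> 0 < e ->
  psum a n `^ e <= Num.max 1 e * psum (fun k => a k * psum a k `^ (e - 1)) n.
Proof.
move=> a0 e0; elim: n => [|n IH]; first by rewrite !psum0 mulr0 powR0 ?gt_eqF.
rewrite [X in _ <= _ * X]psumS mulrDr.
have := @powR_diff R e (psum a n.+1) (psum a n) e0.
rewrite nonneg_psum//= psum_nondecr// => /(_ isT) /andP[_ h].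
have E : psum a n.+1 - psum a n = a n.+1 by rewrite psumS; ring.
rewrite E in h; lra.
Qed.

Lemma psum_exchange (F : nat -> nat -> R) N :
  psum (fun n => \sum_(n <= m < N.+1) F n m) N =
  psum (fun m => psum (fun n => F n m) m) N.
Proof.
elim: N => [|N IH]; first by rewrite !psum0.
rewrite psumS [RHS]psumS -IH big_nat1.
rewrite [psum (fun n => F n N.+1) _]psumS addrA; congr (_ + _).
rewrite -psumD; apply: eq_psum => k /andP[k0 kN].
by rewrite big_nat_recr//= ltnW.
Qed.

End Sums.

Section Rmax.
Context {R : realType}.
Implicit Types (F G : nat -> R).

(** The seed 0 makes an empty maximum 0 and every [rmax] non-negative; for non-negative sequences on
    a non-empty range it is the true maximum. *)
Definition rmax F n N : R := \big[Num.max/0]_(n <= k < N.+1) F k.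

Lemma rmax_ge0 F n N : 0 <= rmax F n N.
Proof. exact: bigmax_ge_id. Qed.

Lemma le_rmax F n N k : (n <= k <= N)%N -> F k <= rmax F n N.
Proof. by move=> h; rewrite /rmax; apply: le_bigmax_seq => //; rewrite mem_index_iota ltnS. Qed.

Lemma rmax_le F n N (y : R) : 0 <= y ->
  (forall k, (n <= k <= N)%N -> F k <= y) -> rmax F n N <= y.
Proof.
move=> y0 h; rewrite /rmax big_nat_cond; elim/big_ind: _ => //.
  by move=> a b ay bY; rewrite ge_max ay.
by move=> i; rewrite ltnS andbT; apply: h.
Qed.

Lemma rmax_attained F n N : (n <= N)%N -> (forall k, (n <= k <= N)%N -> 0 <= F k) ->
  exists2 k, (n <= k <= N)%N & rmax F n N = F k.
Proof.
rewrite /rmax; move d : (N - n)%N => m.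
elim: m n d => [|m IH] n d nN F0; rewrite big_ltn ?ltnS//.
  by exists n; [lia|rewrite big_geq; [rewrite max_l// F0//; lia|lia]].
have [|||k kn ->] := IH n.+1; [lia|lia|by move=> k kn; apply: F0; lia|].
have [h|h] := leP (F n) (F k); first by exists k; [lia|].
by exists n; [lia|].
Qed.

Lemma rmax_antitone F n m N : (n <= m)%N -> rmax F m N <= rmax F n N.
Proof.
move=> nm; apply: rmax_le; first exact: rmax_ge0.
by move=> k km; apply: le_rmax; lia.
Qed.

Lemma le_rmax2 F G n N : (forall k, (n <= k <= N)%N -> F k <= G k) ->
  rmax F n N <= rmax G n N.
Proof.
move=> h; apply: rmax_le; first exact: rmax_ge0.
by move=> k kn; apply: le_trans (h _ kn) _; exact: le_rmax.
Qed.

Lemma rmax_powR F n N (e : R) : 0 < e -> (forall k, (n <= k <= N)%N -> 0 <= F k) ->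
  rmax F n N `^ e = rmax (fun k => F k `^ e) n N.
Proof.
move=> e0 F0; have [nN|nN] := leqP n N; last first.
  by rewrite /rmax !big_geq ?powR0 ?gt_eqF//; lia.
apply/eqP; rewrite eq_le; apply/andP; split.
  have [k kn ->] := rmax_attained nN F0.
  exact: (@le_rmax (fun k => F k `^ e)).
apply: rmax_le; first exact: powR_ge0.
by move=> k kn; apply: le_powR; [exact: ltW|exact: F0|exact: le_rmax].
Qed.

Lemma rmaxM F n N (c : R) : 0 <= c -> rmax (fun k => c * F k) n N = c * rmax F n N.
Proof.
move=> c0; rewrite /rmax (big_morph (fun x => c * x) (id1 := 0) (op1 := Num.max)) ?mulr0//.
by move=> x y; rewrite maxr_pMr.
Qed.

End Rmax.

(** * Convexity and optimization of a scaling parameter *)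

Section Inequalities.
Context {R : realType}.
Implicit Types (w y : nat -> R) (Q th D G X : R).

(** Jensen's inequality multiplied out by the total weight, so that a total weight 0 is included. *)
Lemma psum_power_mean w y (p : R) n : 1 <= p -> nonneg_seq w -> nonneg_seq y ->
  psum (fun k => w k * y k) n `^ p <=
  psum w n `^ (p - 1) * psum (fun k => w k * y k `^ p) n.
Proof.
move=> p1 w0 y0; have p0 : 0 < p by lra.
set S := psum _ n; set W := psum w n; set T := psum _ n.
have W0 : 0 <= W by exact: nonneg_psum.
have [WE|Wn0] := eqVneq W 0.
  suff -> : S = 0 by rewrite powR0 ?gt_eqF// mulr_ge0 ?powR_ge0// psum_ge0// => k /andP[k0 _];
    rewrite mulr_ge0 ?powR_ge0 ?w0.
  rewrite /S /psum big_nat big1// => k kn.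
  have -> : w k = 0; last by rewrite mul0r.
  apply/eqP; rewrite eq_le w0; last by case/andP: kn.
  by rewrite andbT -WE; exact: le_psum_term.
have Wp : 0 < W by rewrite lt_neqAle eq_sym Wn0.
have S0 : 0 <= S by apply: nonneg_psum => k k0; rewrite mulr_ge0 ?w0 ?y0.
have [SE|Sn0] := eqVneq S 0.
  rewrite SE powR0 ?gt_eqF// mulr_ge0 ?powR_ge0//; apply: nonneg_psum => k k0.
  by rewrite mulr_ge0 ?powR_ge0 ?w0.
have Sp : 0 < S by rewrite lt_neqAle eq_sym Sn0.
set mu := S / W; have mup : 0 < mu by rewrite divr_gt0.
(* Tangent line of t `^ p at the mean mu. *)
have tl k : (0 < k)%N -> mu `^ p * (1 + p * (y k / mu - 1)) <= y k `^ p.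
  move=> k0; have -> : y k `^ p = mu `^ p * (y k / mu) `^ p.
    rewrite -powRM ?divr_ge0 ?y0 ?(ltW mup)// mulrCA divff ?mulr1//.
    by rewrite gt_eqF.
  by rewrite ler_pM2l ?powR_gt0//; apply: bernoulli_ge => //; rewrite divr_ge0 ?y0 ?ltW.
have hT : mu `^ p * W <= T.
  have <- : psum (fun k => w k * (mu `^ p * (1 + p * (y k / mu - 1)))) n = mu `^ p * W.
    have -> : psum (fun k => w k * (mu `^ p * (1 + p * (y k / mu - 1)))) n =
       psum (fun k => mu `^ p * (1 - p) * w k + (mu `^ p * p / mu) * (w k * y k)) n.
      by apply: eq_psum => k _; ring.
    rewrite psumD !psumM -/W -/S /mu; field; rewrite ?Wn0 ?Sn0//.
  by apply: ler_psum => k /andP[k0 _]; rewrite ler_wpM2l ?w0 ?tl.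
apply: le_trans (ler_wpM2l (powR_ge0 W (p - 1)) hT).
have -> : S = mu * W by rewrite /mu; field.
rewrite powRM ?(ltW mup)// mulrCA.
by rewrite -[X in W `^ _ * X](powRr1 W0) -powRDpos// subrK.
Qed.

(** Both factors are at most the corresponding power of x + y, and the exponents add up to 1. *)
Lemma young_powR Q (x y : R) : 0 < Q < 1 -> 0 <= x -> 0 <= y -> x `^ Q * y `^ (1 - Q) <= x + y.
Proof.
move=> /andP[Q0 Q1] x0 y0.
have h : x `^ Q * y `^ (1 - Q) <= (x + y) `^ Q * (x + y) `^ (1 - Q).
  by apply: ler_pM; rewrite ?powR_ge0//; apply: le_powR => //; lra.
apply: (le_trans h); rewrite -powRDge0; last by lra.
by rewrite (addrC Q) subrK powRr1 ?addr_ge0.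
Qed.

(** The two terms balance for lam = (D / G)^(1 - Q); each then equals G^Q D^(1 - Q). *)
Lemma powR_scaling_opt Q th X G D : 0 < Q < 1 -> th = Q / (1 - Q) ->
  0 <= G -> 0 <= D ->
  (forall lam : R, 0 < lam -> X <= lam * G + lam `^ (- th) * D) ->
  X <= 2 * (G `^ Q * D `^ (1 - Q)).
Proof.
move=> /andP[Q0 Q1] thE G0 D0 h; have th0 : 0 < th by rewrite thE divr_gt0//; lra.
have rhs0 : 0 <= 2 * (G `^ Q * D `^ (1 - Q)) by rewrite mulr_ge0// mulr_ge0 ?powR_ge0.
have [X0|Xp] := leP X 0; first exact: le_trans rhs0.
have [DE|Dn0] := eqVneq D 0.
  (* With D = 0 this lam is so small that lam * G < X, contradicting the hypothesis. *)
  have lp : 0 < X / (2 * (G + 1)) by rewrite divr_gt0//; lra.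
  have := h _ lp; rewrite DE mulr0 addr0.
  have E : X / (2 * (G + 1)) * (2 * (G + 1)) = X by rewrite divfK// gt_eqF//; lra.
  nra.
have Dp : 0 < D by rewrite lt_neqAle eq_sym Dn0.
have [GE|Gn0] := eqVneq G 0.
  (* With G = 0, lam is the power of this number for which lam^(- th) * D = X / 2. *)
  have l0 : 0 < X / (2 * D) by rewrite divr_gt0//; lra.
  have := h _ (powR_gt0 (- th^-1) l0); rewrite GE mulr0 add0r -powRrM mulrNN mulVf ?gt_eqF//
    (powRr1 (ltW l0)).
  have -> : X / (2 * D) * D = X / 2 by field.
  lra.
have Gp : 0 < G by rewrite lt_neqAle eq_sym Gn0.
have lp : 0 < D / G by rewrite divr_gt0.
have := h _ (powR_gt0 (1 - Q) lp).
rewrite -powRrM !powRM ?invr_ge0 ?(ltW Dp) ?(ltW Gp)//.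
have inv e : G^-1 `^ e = G `^ (- e) by rewrite -powR_inv1 ?ltW// -powRrM mulN1r.
have tQ : (1 - Q) * - th = - Q by rewrite thE; field; lra.
rewrite !inv tQ opprK -!mulrA [G `^ _ * G](_ : _ = G `^ Q); last first.
  by rewrite -[X in _ * X](powRr1 (ltW Gp)) -powRDpos//; congr (_ `^ _); ring.
have -> : D `^ (- Q) * (G `^ Q * D) = D `^ (1 - Q) * G `^ Q.
  rewrite mulrCA mulrC -{2}(powRr1 (ltW Dp)) -powRDpos//; congr (_ `^ _ * _); ring.
by move/le_trans; apply; lra.
Qed.

End Inequalities.

(** * Weighted Hardy inequalities *)

Section Hardy.
Context {R : realType}.
Implicit Types (w G Phi : nat -> R).

Lemma psumSB w n : psum w n.+1 - psum w n = w n.+1.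
Proof. by rewrite psumS addrC addKr. Qed.

Lemma psum_pow_diff w (e : R) n : nonneg_seq w -> 0 < e ->
  Num.min 1 e * ((psum w n.+1 - psum w n) * psum w n.+1 `^ (e - 1)) <=
  psum w n.+1 `^ e - psum w n `^ e <=
  Num.max 1 e * ((psum w n.+1 - psum w n) * psum w n.+1 `^ (e - 1)).
Proof. by move=> w0 e0; apply: powR_diff => //; rewrite nonneg_psum//= psum_nondecr. Qed.

Lemma sum_tail G n N : (0 < n)%N ->
  \sum_(n <= m < N.+1) G m = psum (fun m => if (n <= m)%N then G m else 0) N.
Proof. by move=> n0; rewrite /psum (big_nat_widenl _ 1)// [LHS]big_mkcond. Qed.

(** The power mean inequality with weights G makes the tail operator linear in G; after exchanging
    the sums, the coefficient of G m is what the pointwise hypothesis bounds. *)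
Lemma hardy_ge1 w G Phi (Q D : R) N : 1 <= Q ->
  nonneg_seq w -> nonneg_seq G -> nonneg_seq Phi ->
  (forall n, (0 < n <= N)%N -> psum w n * Phi n `^ Q <= D) ->
  psum (fun n => w n * (\sum_(n <= m < N.+1) G m * Phi m) `^ Q) N <=
  D * psum G N `^ Q.
Proof.
move=> Q1 w0 G0 P0 hD; have Q0 : 0 < Q by lra.
have GN0 : 0 <= psum G N by exact: nonneg_psum.
have tail n : (0 < n <= N)%N -> (\sum_(n <= m < N.+1) G m * Phi m) `^ Q <=
    psum G N `^ (Q - 1) * \sum_(n <= m < N.+1) G m * Phi m `^ Q.
  move=> /andP[n0 nN]; rewrite !sum_tail//.
  set w' := fun m => if (n <= m)%N then G m else 0.
  have w'0 : nonneg_seq w' by move=> m m0; rewrite /w'; case: ifP => // _; exact: G0.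
  have := psum_power_mean N Q1 w'0 P0.
  rewrite (@eq_psum _ (fun k => w' k * Phi k) (fun m => if (n <= m)%N then G m * Phi m else 0));
    last first.
    by move=> k _; rewrite /w'; case: ifP => //; rewrite mul0r.
  rewrite (@eq_psum _ (fun k => w' k * Phi k `^ Q) (fun m => if (n <=
    m)%N then G m * Phi m `^ Q else 0)); last first.
    by move=> k _; rewrite /w'; case: ifP => //; rewrite mul0r.
  move/le_trans; apply; apply: ler_wpM2r.
    by apply: nonneg_psum => k k0; case: ifP => // _; rewrite mulr_ge0 ?powR_ge0 ?G0.
  apply: le_powR; [lra|exact: nonneg_psum|].
  by apply: ler_psum => k /andP[k0 _]; rewrite /w'; case: ifP => // _; exact: G0.
apply: (@le_trans _ _ (psum G N `^ (Q - 1) *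
    psum (fun n => \sum_(n <= m < N.+1) w n * (G m * Phi m `^ Q)) N)).
  rewrite -psumM; apply: ler_psum => n nN.
  rewrite -mulr_sumr mulrCA; apply: ler_wpM2l; last exact: tail.
  by apply: w0; case/andP: nN.
rewrite psum_exchange.
have -> : D * psum G N `^ Q = psum G N `^ (Q - 1) * (D * psum G N).
  rewrite mulrCA; congr (_ * _).
  by rewrite -{3}(powRr1 GN0) -powRDge0 ?subrK.
rewrite ler_wpM2l ?powR_ge0// -psumM; apply: ler_psum => m mN.
rewrite /psum -mulr_suml -/(psum w m) mulrCA (mulrC D) ler_wpM2l ?hD//.
by apply: G0; case/andP: mN.
Qed.

Section HardyLt1.
Variables (w Phi : nat -> R) (e : R) (N : nat).
Hypotheses (e0 : 0 < e) (w0 : nonneg_seq w) (P0 : nonneg_seq Phi).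
Hypothesis Pni : nonincr_seq Phi.

Let ee0 : 0 < e + e. Proof. by rewrite addr_gt0. Qed.

Let U n := \sum_(n <= m < N.+1) w m * psum w m `^ (e - 1) * Phi m `^ (e + e).
(** A summable substitute for the maximum of W(m)^e Phi(m)^(2 e) over m >= n, where W = [psum w]. *)
Let kap n := psum w n `^ e * Phi n `^ (e + e) + Num.max 1 e * U n.

Let term_ge0 m : (0 < m)%N -> 0 <= w m * psum w m `^ (e - 1) * Phi m `^ (e + e).
Proof. by move=> m0; rewrite !mulr_ge0 ?powR_ge0 ?w0. Qed.

Let U_ge0 n : (0 < n)%N -> 0 <= U n.
Proof.
move=> n0; rewrite /U big_nat; apply: sumr_ge0 => m /andP[nm _]; apply: term_ge0; lia.
Qed.

Let kap_ge0 n : (0 < n)%N -> 0 <= kap n.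
Proof.
move=> n0; rewrite /kap addr_ge0// mulr_ge0 ?powR_ge0 ?U_ge0//.
by rewrite ltW ?max1_gt0.
Qed.

(** As Phi is non-increasing, W^e Phi^(2 e) can grow from m to m + 1 only through the increment of
    W^e, which [Num.max 1 e] times the next term of [U] dominates. *)
Let kap_ge n m : (0 < n)%N -> (n <= m <= N)%N ->
  psum w m `^ e * Phi m `^ (e + e) <= kap n.
Proof.
move=> n0 /andP[nm mN].
suff : psum w m `^ e * Phi m `^ (e + e) <= psum w n `^ e * Phi n `^ (e + e) +
    Num.max 1 e * \sum_(n <= i < m.+1) w i * psum w i `^ (e - 1) * Phi i `^ (e + e).
  move/le_trans; apply; rewrite /kap lerD2l ler_pM2l ?max1_gt0//.
  rewrite /U (@big_cat_nat _ _ _ m.+1 n N.+1) ?ltnS// ?leqW//= lerDl.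
  by rewrite big_nat; apply: sumr_ge0 => i /andP[mi _]; apply: term_ge0; lia.
have := nm; elim: m {nm mN} => [|m IH] nm; first by lia.
have [->|nm'] := eqVneq n m.+1.
  by rewrite lerDl big_nat1 mulr_ge0 ?term_ge0 ?ltW ?max1_gt0.
have nm2 : (n <= m)%N by lia.
rewrite big_nat_recr ?leqW//= mulrDr addrA.
apply: (@le_trans _ _ (psum w m `^ e * Phi m `^ (e + e) +
    Num.max 1 e * (w m.+1 * psum w m.+1 `^ (e - 1) * Phi m.+1 `^ (e + e)))); last first.
  by rewrite lerD2r IH.
apply: (@le_trans _ _ (psum w m `^ e * Phi m.+1 `^ (e + e) +
    Num.max 1 e * (w m.+1 * psum w m.+1 `^ (e - 1) * Phi m.+1 `^ (e + e)))); last first.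
  rewrite lerD2r ler_wpM2l ?powR_ge0//; apply: le_powR;
    [exact: ltW ee0|exact: P0|apply: Pni => //; lia].
rewrite (_ : psum w m `^ e * _ + _ = (psum w m `^ e +
  Num.max 1 e * (w m.+1 * psum w m.+1 `^ (e - 1))) * Phi m.+1 `^ (e + e)); last by ring.
rewrite ler_wpM2r ?powR_ge0//.
by rewrite -lerBlDl -(psumSB w m); have /andP[] := psum_pow_diff m w0 e0.
Qed.

Let psum_w_gt0 n : (0 < n)%N -> 0 < w n -> 0 < psum w n.
Proof. by move=> n0 wn; apply: lt_le_trans wn _; apply: le_psum_term => //; rewrite n0 leqnn. Qed.

(** With th = 2 e, this is the th-th power of an auxiliary weight rho that dominates W(n)^(1/2)
    W(m)^(1/2) Phi(m) for all m in [n, N]. *)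
Let rt n := psum w n `^ e * kap n.

(** Exchanging the sums in the part coming from [U] leaves the sum of w W^e up to m, which is at
    most W(m)^(1 + e). *)
Let sum_rt : psum (fun n => w n * rt n) N <=
  (1 + Num.max 1 e) * psum (fun n => w n * psum w n `^ (e + e) * Phi n `^ (e + e)) N.
Proof.
have -> : psum (fun n => w n * rt n) N =
    psum (fun n => w n * psum w n `^ (e + e) * Phi n `^ (e + e)) N +
    Num.max 1 e * psum (fun n => \sum_(n <= m < N.+1) (w n * psum w n `^ e) *
       (w m * psum w m `^ (e - 1) * Phi m `^ (e + e))) N.
  rewrite -psumM -psumD; apply: eq_psum => n _.
  rewrite /rt /kap -mulr_sumr -/(U n) (@powRDge0 _ e e (psum w n) ee0).
  ring.
rewrite mulrDl mul1r lerD2l ler_pM2l ?max1_gt0// psum_exchange.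
apply: ler_psum => m /andP[m0 mN].
rewrite /psum -mulr_suml -!/(psum _ _).
apply: (@le_trans _ _ ((psum w m * psum w m `^ e) * (w m * psum w m `^ (e - 1) * Phi m `^ (e +
  e)))).
  rewrite ler_wpM2r ?term_ge0// -[X in X * _]/(psum w m) mulrC -psumM;
    apply: ler_psum => k /andP[k0 km].
  rewrite mulrC ler_wpM2r ?w0//; apply: le_powR; [exact: ltW|exact: nonneg_psum|].
  exact: psum_nondecr.
have [wm|wm] := eqVneq (w m) 0; first by rewrite wm !(mul0r, mulr0).
have Wp : 0 < psum w m by apply: psum_w_gt0 => //; rewrite lt_neqAle eq_sym wm w0.
rewrite (@powRDge0 _ e e (psum w m) ee0) -(mulr_powRB1 (ltW Wp) e0).
by rewrite le_eqVlt; apply/orP; left; apply/eqP; ring.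
Qed.

Let rho_ge n m : (0 < n)%N -> (n <= m <= N)%N ->
  psum w n `^ 2^-1 * psum w m `^ 2^-1 * Phi m <= rt n `^ (e + e)^-1.
Proof.
move=> n0 nm; have ee := ee0.
have m0 : (0 < m)%N by lia.
apply: (@powR_leK _ (e + e)) => //; rewrite ?mulr_ge0 ?powR_ge0 ?P0//.
rewrite powRVK ?gt_eqF//; last by rewrite /rt mulr_ge0 ?powR_ge0 ?kap_ge0.
rewrite !powRM ?mulr_ge0 ?powR_ge0 ?P0// -!powRrM.
have -> : 2^-1 * (e + e) = e by field.
by rewrite /rt -mulrA ler_wpM2l ?powR_ge0// kap_ge.
Qed.

(** With f the tail sum, the sum of w f / rho is linear in G and at most twice the sum of G, while w
    rho^th is controlled by [sum_rt]. Writing f^Q = (f / rho)^Q (rho^th)^(1 - Q) and scaling by lam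
    combines the two bounds. *)
Lemma hardy_lt1_aux G (Q : R) : 0 < Q < 1 -> e + e = Q / (1 - Q) -> nonneg_seq G ->
  psum (fun n => w n * (\sum_(n <= m < N.+1) G m * Phi m) `^ Q) N <=
  2 * ((2 * psum G N) `^ Q *
   ((1 + Num.max 1 e) * psum (fun n => w n * psum w n `^ (e + e) * Phi n `^ (e + e)) N) `^ (1 - Q)).
Proof.
move=> Q01 thE G0; have /andP[Q0 Q1] := Q01; have ee := ee0.
set f := fun n => \sum_(n <= m < N.+1) G m * Phi m.
pose rho n := rt n `^ (e + e)^-1.
have f0 n : (0 < n)%N -> 0 <= f n.
  move=> n0; rewrite /f big_nat; apply: sumr_ge0 => m /andP[nm _].
  by rewrite mulr_ge0 ?G0 ?P0//; lia.
have rt0 n : (0 < n)%N -> 0 <= rt n by move=> n0; rewrite /rt mulr_ge0 ?powR_ge0 ?kap_ge0.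
have sum1 : psum (fun n => w n * (f n / rho n)) N <= 2 * psum G N.
  have -> : psum (fun n => w n * (f n / rho n)) N =
      psum (fun n => \sum_(n <= m < N.+1) (G m * (Phi m * (w n / rho n)))) N.
    by apply: eq_psum => n _; rewrite /f mulrC -!mulrA mulr_suml; apply: eq_bigr => m _; ring.
  rewrite psum_exchange -psumM; apply: ler_psum => m /andP[m0 mN].
  rewrite psumM mulrC ler_wpM2r ?G0//.
  (* By the lower bound on rho, Phi(m) / rho(n) is at most (W(n) W(m))^(-1/2), and the sum of w
     W^(-1/2) up to m is at most 2 W(m)^(1/2). *)
  apply: (@le_trans _ _ (psum w m `^ (- 2^-1) * psum (fun n => w n * psum w n `^ (2^-1 - 1)) m)).
    rewrite -psumM; apply: ler_psum => n /andP[n0 nm].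
    have [->|wn] := eqVneq (w n) 0; first by rewrite !mul0r !mulr0.
    have [->|Pm] := eqVneq (Phi m) 0.
      by rewrite mul0r !mulr_ge0 ?powR_ge0 ?w0.
    have Wn : 0 < psum w n by apply: psum_w_gt0 => //; rewrite lt_neqAle eq_sym wn w0.
    have Wm : 0 < psum w m by apply: lt_le_trans Wn _; exact: psum_nondecr.
    have Pp : 0 < Phi m by rewrite lt_neqAle eq_sym Pm P0.
    have h := @rho_ge n m n0; rewrite nm mN in h; have {}h := h isT.
    have rp : 0 < rho n by apply: lt_le_trans h; rewrite !mulr_gt0 ?powR_gt0.
    rewrite (mulrCA (Phi m)) (mulrCA (psum w m `^ _)) ler_wpM2l ?w0// ler_pdivrMr//.
    apply: le_trans (ler_wpM2l _ h); last by rewrite mulr_ge0 ?powR_ge0.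
    rewrite (_ : 2^-1 - 1 = - 2^-1); last by field.
    rewrite !powRN le_eqVlt; apply/orP; left; apply/eqP; field.
    by rewrite !gt_eqF ?powR_gt0.
  have [Wm|Wm] := eqVneq (psum w m) 0.
    by rewrite Wm powR0 ?mul0r//; lra.
  have Wp : 0 < psum w m by rewrite lt_neqAle eq_sym Wm nonneg_psum.
  rewrite powRN mulrC ler_pdivrMr ?powR_gt0//.
  have h2 : 0 < 2^-1 :> R by lra.
  have := psum_pow_ge m w0 h2; rewrite min_r; last by lra.
  by lra.
apply: (powR_scaling_opt Q01 thE).
- by rewrite mulr_ge0 ?nonneg_psum.
- rewrite mulr_ge0//; first by have := max1_ge1 e; lra.
  by apply: nonneg_psum => k k0; rewrite !mulr_ge0 ?powR_ge0 ?w0.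
move=> lam lam0.
apply: (@le_trans _ _ (lam * psum (fun n => w n * (f n / rho n)) N +
   lam `^ (- (e + e)) * psum (fun n => w n * rt n) N)); last first.
  by apply: lerD; rewrite ler_wpM2l ?powR_ge0 ?(ltW lam0).
rewrite -!psumM -psumD; apply: ler_psum => n /andP[n0 nN].
rewrite -/(f n) (mulrCA lam) (mulrCA (lam `^ _)) -mulrDr.
have [->|wn] := eqVneq (w n) 0; first by rewrite !mul0r.
have Wn : 0 < psum w n by apply: psum_w_gt0 => //; rewrite lt_neqAle eq_sym wn w0.
rewrite ler_wpM2l ?w0//.
(* If rho(n) = 0, then Phi vanishes on [n, N], so the tail sum is 0 as well and division by 0 does
   no harm. *)
have [rE|rn] := eqVneq (rt n) 0.
  suff -> : f n = 0 by rewrite powR0 ?gt_eqF// mul0r mulr0 add0r mulr_ge0 ?powR_ge0 ?rt0.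
  rewrite /f big_nat big1// => m mN.
  have nm : (n <= m <= N)%N by rewrite -(ltnS m).
  have m0 : (0 < m)%N by lia.
  have := rho_ge n0 nm; rewrite rE powR0 ?invr_eq0 ?(gt_eqF ee)// => h.
  have Wm : 0 < psum w m by apply: lt_le_trans Wn _; apply: psum_nondecr => //; lia.
  suff -> : Phi m = 0 by rewrite mulr0.
  apply/eqP; rewrite eq_le P0// andbT.
  by rewrite -(pmulr_rle0 _ (mulr_gt0 (powR_gt0 2^-1 Wn) (powR_gt0 2^-1 Wm))).
have rp : 0 < rt n by rewrite lt_neqAle eq_sym rn rt0.
have rhop : 0 < rho n by rewrite powR_gt0.
have y0 : 0 <= lam `^ (- (e + e)) * rt n by rewrite mulr_ge0 ?powR_ge0 ?ltW.
have x0 : 0 <= lam * (f n / rho n) by rewrite mulr_ge0 ?divr_ge0 ?f0 ?ltW.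
apply: le_trans (young_powR Q01 x0 y0).
have thQ : (e + e) * (1 - Q) = Q by rewrite thE; field; lra.
rewrite (@powRM _ (lam `^ (- (e + e))) (rt n)) ?powR_ge0 ?(ltW rp)// -powRrM mulNr thQ.
have -> : rt n `^ (1 - Q) = rho n `^ Q.
  rewrite /rho -powRrM; congr (_ `^ _); by rewrite -{2}thQ mulrA mulVf ?mul1r// gt_eqF.
rewrite (powRM _ (ltW lam0)) ?divr_ge0 ?f0 ?(ltW rhop)// (powRM _ (f0 _ n0)) ?invr_ge0 ?(ltW
  rhop)//.
rewrite -(powR_inv1 (ltW rhop)) -powRrM mulN1r !powRN.
rewrite le_eqVlt; apply/orP; left; apply/eqP; field.
by rewrite !gt_eqF ?powR_gt0.
Qed.
End HardyLt1.
End Hardy.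

(** * Reflection of [1, N] and the dual inequalities *)

Section Reversal.
Context {R : realType}.
Implicit Types (w G Phi F : nat -> R).

(** The reflection exchanges initial and tail sums. It is cut to 0 beyond N, since the truncated
    subtraction would otherwise read F at the irrelevant index 0. *)
Definition rev_seq N F k : R := if (k <= N)%N then F (N.+1 - k)%N else 0.

Lemma rev_seqE N F k : (k <= N)%N -> rev_seq N F k = F (N.+1 - k)%N.
Proof. by rewrite /rev_seq => ->. Qed.

Lemma rev_seq_ge0 N F : nonneg_seq F -> nonneg_seq (rev_seq N F).
Proof. by move=> F0 k k0; rewrite /rev_seq; case: ifP => // kN; apply: F0; lia. Qed.

Lemma psum_rev_seq N F k : (k <= N)%N ->
  psum (rev_seq N F) k = \sum_(N.+1 - k <= i < N.+1) F i.
Proof.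
elim: k => [|k IH] kN; first by rewrite psum0 subn0 big_geq.
rewrite psumS IH 1?ltnW// /rev_seq kN.
by rewrite [RHS]big_ltn ?ltnS; [rewrite addrC subnSK// ltnW|lia].
Qed.

Lemma psum_rev_seqN N F : psum (rev_seq N F) N = psum F N.
Proof. by rewrite psum_rev_seq// subSnn. Qed.

Lemma tail_rev_seq N F n : (0 < n <= N)%N ->
  \sum_(n <= m < N.+1) rev_seq N F m = psum F (N.+1 - n).
Proof.
move=> /andP[n0 nN].
have := psum_rev_seqN N F; rewrite {1}/psum (@big_cat_nat _ _ _ n) ?leqW//=.
rewrite /psum (@big_cat_nat _ _ _ (N.+1 - n).+1 1 N.+1)//=; [|lia].
case: n n0 nN => // n _ nN.
rewrite -[\sum_(1 <= _ < n.+1) _]/(psum (rev_seq N F) n) psum_rev_seq 1?ltnW// addrC.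
rewrite (_ : (N.+1 - n.+1).+1 = N.+1 - n)%N; last by lia.
exact: addIr.
Qed.

Lemma hardy_rev_ge1 w G Phi (Q D : R) N : 1 <= Q ->
  nonneg_seq w -> nonneg_seq G -> nonneg_seq Phi ->
  (forall n, (0 < n <= N)%N -> (\sum_(n <= k < N.+1) w k) * Phi n `^ Q <= D) ->
  psum (fun n => w n * psum (fun m => G m * Phi m) n `^ Q) N <=
  D * psum G N `^ Q.
Proof.
move=> Q1 w0 G0 P0 hD.
have := @hardy_ge1 R (rev_seq N w) (rev_seq N G) (rev_seq N Phi) Q D N Q1
  (rev_seq_ge0 N w0) (rev_seq_ge0 N G0) (rev_seq_ge0 N P0).
rewrite psum_rev_seqN => h; apply: le_trans (h _).
  rewrite -psum_rev_seqN; apply: ler_psum => n nN.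
  have nN' : (n <= N)%N by case/andP: nN.
  rewrite [leLHS]rev_seqE//.
  have <- : \sum_(n <= m < N.+1) rev_seq N (fun m => G m * Phi m) m =
    psum (fun m => G m * Phi m) (N.+1 - n).
    by rewrite tail_rev_seq.
  rewrite (rev_seqE w nN').
  rewrite le_eqVlt; apply/orP; left; apply/eqP; congr (_ * _ `^ _).
  by apply: eq_big_nat => m /andP[_ mN]; rewrite /rev_seq -ltnS mN.
move=> n /andP[n0 nN]; rewrite psum_rev_seq// rev_seqE//; apply: hD; lia.
Qed.

(** Stated as a property of c, so that the constant is fixed before any sequence is given. *)
Definition hardy_bound (Q th c : R) := forall w G Phi N,
  nonneg_seq w -> nonneg_seq G -> nonneg_seq Phi -> nonincr_seq Phi ->
  psum (fun n => w n * (\sum_(n <= m < N.+1) G m * Phi m) `^ Q) N <=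
  c * (psum (fun n => w n * psum w n `^ th * Phi n `^ th) N `^ (1 - Q) *
       psum G N `^ Q).

Definition hardy_rev_bound (Q th c : R) := forall w G Phi N,
  nonneg_seq w -> nonneg_seq G -> nonneg_seq Phi ->
  (forall m n, (0 < m <= n)%N -> Phi m <= Phi n) ->
  psum (fun n => w n * psum (fun m => G m * Phi m) n `^ Q) N <=
  c * (psum (fun n => w n * (\sum_(n <= k < N.+1) w k) `^ th * Phi n `^ th) N
         `^ (1 - Q) * psum G N `^ Q).

Lemma hardy_lt1 (Q th : R) : 0 < Q < 1 -> th = Q / (1 - Q) ->
  exists2 c : R, 0 < c & hardy_bound Q th c.
Proof.
move=> Q01 thE; have /andP[Q0 Q1] := Q01.
have th0 : 0 < th by rewrite thE divr_gt0 ?subr_gt0.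
pose e := th / 2; have e0 : 0 < e by rewrite divr_gt0.
have ee : e + e = th by rewrite /e; field.
exists (2 * (2 `^ Q * (1 + Num.max 1 e) `^ (1 - Q))).
  by rewrite !mulr_gt0 ?powR_gt0// addr_gt0// max1_gt0.
move=> w G Phi N w0 G0 P0 Pni.
have := @hardy_lt1_aux R w Phi e N e0 w0 P0 Pni G Q Q01; rewrite ee => /(_ thE G0).
move/le_trans; apply.
rewrite !powRM ?nonneg_psum//; last first.
- by move=> k k0; rewrite !mulr_ge0 ?powR_ge0 ?w0.
- by rewrite addr_ge0// ltW// max1_gt0.
by rewrite le_eqVlt; apply/orP; left; apply/eqP; ring.
Qed.

Lemma hardy_rev_lt1 (Q th : R) : 0 < Q < 1 -> th = Q / (1 - Q) ->
  exists2 c : R, 0 < c & hardy_rev_bound Q th c.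
Proof.
move=> Q01 thE; have [c c0 h] := hardy_lt1 Q01 thE; exists c => //.
move=> w G Phi N w0 G0 P0 Pnd.
have Pni : nonincr_seq (rev_seq N Phi).
  move=> m n m0 mn; rewrite /rev_seq; case: ifP => nN; case: ifP => mN //; last 2 first.
  - by lia.
  - by apply: P0; lia.
  by apply: Pnd; lia.
have := h (rev_seq N w) (rev_seq N G) (rev_seq N Phi) N
  (rev_seq_ge0 N w0) (rev_seq_ge0 N G0) (rev_seq_ge0 N P0) Pni.
rewrite (psum_rev_seqN N G).
rewrite -(psum_rev_seqN N (fun n => w n * psum (fun m => G m * Phi m) n `^ Q)).
rewrite -(psum_rev_seqN N (fun n => w n * (\sum_(n <= k < N.+1) w k) `^ th * Phi n `^ th)).
congr (_ <= _).
  apply: eq_psum => n nN; have nN' : (n <= N)%N by case/andP: nN.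
  rewrite (rev_seqE w nN') [RHS]rev_seqE//; congr (_ * _ `^ _).
  rewrite -tail_rev_seq//; apply: eq_big_nat => m /andP[_ mN].
  by rewrite /rev_seq -ltnS mN.
congr (_ * (_ `^ _ * _)); apply: eq_psum => n nN.
have nN' : (n <= N)%N by case/andP: nN.
by rewrite !rev_seqE// psum_rev_seq.
Qed.

Lemma rmax_rev_seq F N n : (0 < n <= N)%N ->
  (forall k, (0 < k)%N -> 0 <= F k) ->
  rmax (rev_seq N F) n N = rmax F 1 (N.+1 - n).
Proof.
move=> nN F0; apply/eqP; rewrite eq_le; apply/andP; split; apply: rmax_le; rewrite ?rmax_ge0//.
  move=> k kn; rewrite /rev_seq; have -> : (k <= N)%N by lia.
  by apply: le_rmax; lia.
move=> k kn; have -> : F k = rev_seq N F (N.+1 - k)%N.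
  by rewrite /rev_seq ifT; [congr F|]; lia.
by apply: le_rmax; lia.
Qed.

End Reversal.

(** * Weights for which a supremum satisfies a summation bound *)

Section Leaders.
Context {R : realType}.
Implicit Types (a T tau F : nat -> R).

(* The last index up to n at which psum a more than doubled: the fibres of
   lead a are blocks on which psum a is constant up to a factor 2. *)
Fixpoint lead a n : nat :=
  if n is m.+1 then
    if 2 * psum a (lead a m) < psum a n then n else lead a m
  else 0%N.

Definition is_lead a n := lead a n == n.

Lemma lead_le a n : (lead a n <= n)%N.
Proof. by elim: n => //= n IH; case: ifP => // _; exact: leqW. Qed.

Lemma lead_idem a n : lead a (lead a n) = lead a n.
Proof. by elim: n => //= n IH; case: ifP => //= ->. Qed.

Lemma lead_is_lead a n : is_lead a (lead a n).
Proof. by rewrite /is_lead lead_idem. Qed.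

Lemma lead_mono a n m : (n <= m)%N -> (lead a n <= lead a m)%N.
Proof.
move=> /subnK <-; elim: (m - n)%N => //= k IH; case: ifP => // _.
by rewrite (leq_trans IH)// leqW// lead_le.
Qed.

Lemma psum_le_lead a n : nonneg_seq a -> psum a n <= 2 * psum a (lead a n).
Proof.
move=> a0; case: n => [|n] /=; first by rewrite psum0 mulr0.
case: ltP => // _; have := nonneg_psum n.+1 a0; lra.
Qed.

(** [lead] leaves 0 as soon as [psum a] becomes positive, so indices with leader 0 carry no mass. *)
Lemma lead0_eq0 a n : nonneg_seq a -> (0 < n)%N -> lead a n = 0%N -> a n = 0.
Proof.
move=> a0 n0 ln; apply/eqP; rewrite eq_le a0// andbT.
have := psum_le_lead n a0; rewrite ln psum0 mulr0; apply: le_trans.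
by apply: le_psum_term => //; rewrite n0 leqnn.
Qed.

Lemma psum_increment a T (t : R) i j : nonneg_seq a -> (i <= j)%N ->
  (forall k, (i < k <= j)%N -> t <= T k) ->
  (psum a j - psum a i) * t <= psum (fun k => a k * T k) j - psum (fun k => a k * T k) i.
Proof.
move=> a0; elim: j => [|j IH] ij h.
  by have -> : i = 0%N by [lia]; rewrite !subrr mul0r.
have [->|ij'] := eqVneq i j.+1; first by rewrite !subrr mul0r.
have ij2 : (i <= j)%N by lia.
rewrite !psumS.
have h2 : (psum a j - psum a i) * t <= psum (fun k => a k * T k) j - psum (fun k => a k * T k) i.
  by apply: IH => // k kj; apply: h; lia.
have h3 : a j.+1 * t <= a j.+1 * T j.+1 by rewrite ler_wpM2l ?a0// h//; lia.
by rewrite !mulrDl in h2 *; lra.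
Qed.

(** At a leader s more than half of [psum a s] comes from the indices after the previous leader.
    These ranges are disjoint, and T is at least tau s on the one ending at s. *)
Lemma lead_sum_lb a T tau N : nonneg_seq a -> nonneg_seq T -> nonneg_seq tau ->
  (forall k s, (0 < k <= s)%N -> (s <= N)%N -> is_lead a s -> tau s <= T k) ->
  psum (fun s => if is_lead a s then psum a s * tau s else 0) N <=
  2 * psum (fun k => a k * T k) N.
Proof.
move=> a0 T0 tau0 h.
have aT0 : nonneg_seq (fun k => a k * T k) by move=> k k0; rewrite mulr_ge0 ?a0 ?T0.
suff H n : (n <= N)%N -> psum (fun s => if is_lead a s then psum a s * tau s else 0) n <=
    2 * psum (fun k => a k * T k) (lead a n).
  apply: le_trans (H N (leqnn N)) _; rewrite ler_pM2l//.
  by apply: psum_nondecr => //; exact: lead_le.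
elim: n => [|n IH] nN; first by rewrite /= !psum0 mulr0.
have {}IH := IH (ltnW nN); rewrite psumS {2}/is_lead /=.
case hl : (2 * psum a (lead a n) < psum a n.+1); last first.
  by rewrite ifF ?addr0//; apply/negbTE; have := lead_le a n; lia.
rewrite eqxx.
have ln : (lead a n <= n.+1)%N by rewrite leqW// lead_le.
have isl : is_lead a n.+1 by rewrite /is_lead /= hl.
have h2 : (psum a n.+1 - psum a (lead a n)) * tau n.+1 <=
    psum (fun k => a k * T k) n.+1 - psum (fun k => a k * T k) (lead a n).
  by apply: psum_increment => // k kn; apply: h => //; lia.
have h3 : psum a n.+1 * tau n.+1 <= 2 * ((psum a n.+1 - psum a (lead a n)) * tau n.+1).
  by rewrite mulrA ler_wpM2r ?tau0//; lra.
lra.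
Qed.

Lemma lead_block_sum a s n : nonneg_seq a ->
  psum (fun k => if lead a k == s then a k else 0) n <= 2 * psum a s.
Proof.
move=> a0; elim: n => [|n IH]; first by rewrite psum0 mulr_ge0 ?nonneg_psum.
rewrite psumS; case: eqP => [ls|_]; last by rewrite addr0.
apply: le_trans (_ : psum a n.+1 <= _); last by rewrite -ls psum_le_lead.
rewrite psumS lerD2r; apply: ler_psum => k /andP[k0 _]; case: ifP => // _; exact: a0.
Qed.

Lemma psum_delta (x : R) j N : (0 < j <= N)%N ->
  psum (fun k => if j == k then x else 0) N = x.
Proof.
move=> /andP[j0 jN]; rewrite /psum (bigD1_seq j) ?iota_uniq//=; last first.
  by rewrite mem_index_iota j0 ltnS.
rewrite eqxx big1 ?addr0// => k /negbTE kj.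
by rewrite eq_sym kj.
Qed.

Lemma psum_psum_exchange (F : nat -> nat -> R) M N :
  psum (fun k => psum (fun s => F s k) M) N = psum (fun s => psum (fun k => F s k) N) M.
Proof. by rewrite /psum exchange_big_nat. Qed.

(** Indices are grouped by leader, and by the doubling rule a whole block has at most twice the mass
    accumulated at its leader. *)
Lemma lead_sum_ub a F N : nonneg_seq a -> nonneg_seq F ->
  psum (fun k => a k * F (lead a k)) N <=
  2 * psum (fun s => if is_lead a s then psum a s * F s else 0) N.
Proof.
move=> a0 F0.
have -> : psum (fun k => a k * F (lead a k)) N =
    psum (fun k => psum (fun s => if lead a k == s then a k * F s else 0) N) N.
  apply: eq_psum => k /andP[k0 kN].
  have [l0|l0] := eqVneq (lead a k) 0%N.
    rewrite (lead0_eq0 a0 k0 l0) mul0r /psum big1// => s _.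
    by rewrite mul0r if_same.
  rewrite -[LHS](@psum_delta _ (lead a k) N).
    by apply: eq_psum => s _; case: eqP => // ->.
  have := lead_le a k; lia.
rewrite psum_psum_exchange -psumM; apply: ler_psum => s /andP[s0 sN].
have [isl|nisl] := boolP (is_lead a s); last first.
  rewrite mulr0 /psum big1// => k _; case: eqP => // ls.
  by move: nisl; rewrite -ls lead_is_lead.
rewrite (_ : psum _ N = F s * psum (fun k => if lead a k == s then a k else 0) N).
  by rewrite mulrA mulrC ler_wpM2r ?F0// lead_block_sum.
by rewrite -psumM; apply: eq_psum => k _; case: ifP; rewrite ?mulr0// mulrC.
Qed.

(** Geometric growth of [psum a] along its leaders, as the case T = tau = 1 of [lead_sum_lb]. *)
Lemma lead_geom a t : nonneg_seq a -> is_lead a t ->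
  psum (fun s => if is_lead a s then psum a s else 0) t <= 2 * psum a t.
Proof.
move=> a0 lt; have := @lead_sum_lb a (fun=> 1) (fun=> 1) t a0.
have -> : psum (fun k => a k * 1) t = psum a t by apply: eq_psum => k _; rewrite mulr1.
have -> : psum (fun s => if is_lead a s then psum a s * 1 else 0) t =
  psum (fun s => if is_lead a s then psum a s else 0) t by apply: eq_psum => k _; rewrite mulr1.
by apply.
Qed.

End Leaders.

Section SupTest.
Context {R : realType}.
Implicit Types (a kappa d : nat -> R).

(* Testing the hypothesis on d supported at the maximizers of kappa beyond the
   leaders s of a, with weight psum a s `^ (1 + th) * (sup of kappa) `^ th. *)
Lemma sup_test_lead (Q th C : R) a kappa N : 0 < Q < 1 -> th = Q / (1 - Q) -> 0 <= C ->
  nonneg_seq a -> nonneg_seq kappa ->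
  (forall d, nonneg_seq d ->
    psum (fun n => a n * rmax (fun k => (d k * kappa k) `^ Q) n N) N <=
    C * psum d N `^ Q) ->
  psum (fun s => if is_lead a s then
      psum a s * (psum a s `^ th * rmax (fun k => kappa k `^ th) s N) else 0) N <=
  (2 * C) `^ (1 + th).
Proof.
move=> Q01 thE C0 a0 k0 H; have /andP[Q0 Q1] := Q01.
have th0 : 0 < th by rewrite thE divr_gt0 ?subr_gt0.
pose M n := rmax (fun k => kappa k `^ th) n N.
have M0 n : 0 <= M n by exact: rmax_ge0.
have /choice[kk kkP] : forall n, exists k, (0 < n <= N)%N -> (n <= k <= N)%N /\ M n = kappa k `^ th.
  move=> n; have [nN|nN] := boolP (0 < n <= N)%N; last by exists 0%N.
  have [||k kn kE] := @rmax_attained R (fun k => kappa k `^ th) n N; first by lia.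
    by move=> k _; exact: powR_ge0.
  by exists k.
pose tau s := psum a s `^ th * M s.
have tau0 s : 0 <= tau s by rewrite mulr_ge0 ?powR_ge0.
pose g s := if is_lead a s then psum a s * tau s else 0.
have g0 s : 0 <= g s by rewrite /g; case: ifP => // _; rewrite mulr_ge0 ?nonneg_psum.
pose d k := psum (fun s => if kk s == k then g s else 0) N.
have d0 : nonneg_seq d by move=> k _; apply: psum_ge0 => s _; case: ifP.
have dN : psum d N = psum g N.
  rewrite /d psum_psum_exchange; apply: eq_psum => s sN; apply: psum_delta.
  by have [] := kkP s sN; lia.
set D := psum g N; have D0 : 0 <= D by apply: psum_ge0 => s _.
(* The value of d at [kk s] is at least [g s], and the exponents are such that (g s * kappa (kk
   s))^Q is exactly [tau s]; so the hypothesis bounds D by a power of itself. *)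
have hD : D <= 2 * C * D `^ Q.
  rewrite -mulrA {2}/D -dN; apply: le_trans (ler_wpM2l _ (H d d0)) => //.
  apply: (lead_sum_lb a0) => [k _|k _|k s ks sN isl]; [exact: rmax_ge0|exact: tau0|].
  have s0 : (0 < s)%N by lia.
  have sN' : (0 < s <= N)%N by rewrite s0.
  have [kks kkE] := kkP s sN'.
  apply: le_trans (@le_rmax _ (fun k => (d k * kappa k) `^ Q) _ _ (kk s) _); last by lia.
  have dk : g s <= d (kk s).
    have := @le_psum_term R (fun s' => if kk s' == kk s then g s' else 0) N s.
    by rewrite eqxx; apply => // s' _; case: ifP.
  have kp : 0 <= kappa (kk s) by apply: k0; lia.
  apply: (@le_trans _ _ ((g s * kappa (kk s)) `^ Q)); last first.
    by apply: le_powR; rewrite ?mulr_ge0 ?ler_wpM2r// ltW.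
  rewrite /g isl /tau !powRM ?mulr_ge0 ?powR_ge0 ?nonneg_psum//.
  have E1 : psum a s `^ Q * (psum a s `^ th) `^ Q = psum a s `^ th.
    rewrite -powRrM -powRDge0; last by rewrite addr_gt0// mulr_gt0.
    by congr (_ `^ _); rewrite thE; field; lra.
  have E2 : M s `^ Q * kappa (kk s) `^ Q = M s.
    have -> : kappa (kk s) `^ Q = M s `^ (1 - Q).
      by rewrite kkE -powRrM; congr (_ `^ _); rewrite thE; field; lra.
    by rewrite -powRDge0 (addrC Q) subrK ?powRr1.
  by rewrite mulrA -mulrA E2 E1.
change (D <= (2 * C) `^ (1 + th)).
have [DE|Dn0] := eqVneq D 0; first by rewrite DE powR_ge0.
have Dp : 0 < D by rewrite lt_neqAle eq_sym Dn0.
(* D is finite and positive, so D^Q cancels; the exponent is recovered from 1 / (1 - Q) = 1 + th. *)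
have h : D `^ (1 - Q) <= 2 * C.
  rewrite powRDpos// powRr1// powRN -ler_pdivlMr ?invr_gt0 ?powR_gt0// invrK//.
have -> : D = (D `^ (1 - Q)) `^ (1 + th).
  rewrite -powRrM (_ : (1 - Q) * (1 + th) = 1) ?powRr1//.
  by rewrite thE; field; lra.
by apply: le_powR => //; [lra|exact: powR_ge0].
Qed.

(** Within a block [psum a] exceeds its value at the leader by a factor at most 2, and the maximum
    over k >= n only grows when n is replaced by its leader. *)
Lemma sup_test (Q th C : R) a kappa N : 0 < Q < 1 -> th = Q / (1 - Q) -> 0 <= C ->
  nonneg_seq a -> nonneg_seq kappa ->
  (forall d, nonneg_seq d ->
    psum (fun n => a n * rmax (fun k => (d k * kappa k) `^ Q) n N) N <=
    C * psum d N `^ Q) ->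
  psum (fun n => a n * psum a n `^ th * rmax (fun k => kappa k `^ th) n N) N <=
  2 * 2 `^ th * (2 * C) `^ (1 + th).
Proof.
move=> Q01 thE C0 a0 k0 H; have /andP[Q0 Q1] := Q01.
have th0 : 0 < th by rewrite thE divr_gt0 ?subr_gt0.
apply: le_trans (ler_wpM2l _ (sup_test_lead Q01 thE C0 a0 k0 H)); last first.
  by rewrite mulr_ge0 ?powR_ge0.
pose F s := psum a s `^ th * rmax (fun k => kappa k `^ th) s N.
have F0 : nonneg_seq F by move=> s _; rewrite mulr_ge0 ?powR_ge0 ?rmax_ge0.
rewrite mulrAC; apply: le_trans (ler_wpM2r (powR_ge0 2 th) (lead_sum_ub N a0 F0)).
rewrite mulrC -psumM; apply: ler_psum => k /andP[k0' kN].
rewrite /F [in leRHS]mulrCA -mulrA ler_wpM2l ?a0// mulrA -powRM ?nonneg_psum//.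
apply: ler_pM; rewrite ?powR_ge0 ?rmax_ge0//.
  by apply: le_powR; [exact: ltW|exact: nonneg_psum|exact: psum_le_lead].
by apply: rmax_antitone; exact: lead_le.
Qed.
End SupTest.

(** * Testing the coupled condition: running maxima before n times a maximum after n *)

Section BlockTest.
Context {R : realType}.

Lemma argmax_pred (F : nat -> R) (P : pred nat) s N : (s <= N)%N -> P s ->
  (forall k, (s <= k <= N)%N -> 0 <= F k) ->
  exists k, [/\ (s <= k <= N)%N, P k & forall j, (s <= j <= N)%N -> P j -> F j <= F k].
Proof.
(* Adding 1 lets every index satisfying P beat all others, even where F vanishes. *)
move=> sN Ps F0; pose G k := if P k then F k + 1 else 0.
have G0 k : (s <= k <= N)%N -> 0 <= G k.
  by move=> ks; rewrite /G; case: ifP => // _; rewrite addr_ge0 ?F0.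
have [k ks kE] := rmax_attained sN G0.
have Pk : P k.
  apply/negPn/negP => nPk; have := @le_rmax _ G s N s.
  rewrite kE /G (negbTE nPk) Ps leqnn sN => /(_ isT).
  by have := F0 s; rewrite leqnn sN => /(_ isT); lra.
exists k; split => // j js Pj; have := le_rmax G js.
by rewrite kE /G Pj Pk lerD2r.
Qed.

Variables (Q th C : R) (a Om B : nat -> R) (N : nat).
Hypotheses (Q01 : 0 < Q < 1) (thE : th = Q / (1 - Q)) (C0 : 0 <= C).
Hypotheses (a0 : nonneg_seq a) (Om0 : nonneg_seq Om).
Hypothesis B0 : forall k, (0 < k)%N -> 0 < B k.
Hypothesis Bnd : forall m n, (0 < m <= n)%N -> B m <= B n.
Hypothesis H : forall d, nonneg_seq d ->
  psum (fun n => a n * rmax (fun i => Om i * rmax (fun k => (d k / B k) `^ Q) i N) n N) N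
  <= C * psum d N `^ Q.

Let Q0 : 0 < Q. Proof. by case/andP: Q01. Qed.
Let th0 : 0 < th.
Proof. by rewrite thE divr_gt0// subr_gt0; case/andP: Q01. Qed.
Let thQ : th / Q = 1 + th.
Proof. by rewrite thE; case/andP: Q01 => h1 h2; field; lra. Qed.

Let kh n := rmax (fun k => Om k `^ (1 + th) * B k `^ (- th)) n N.
Let M n := rmax (fun k => Om k * B k `^ (- th)) n N.

(** Only i = k is kept in the hypothesis: for kappa = Om^(1/Q) / B one has (d kappa)^Q = Om (d /
    B)^Q. *)
Let kh_bound :
  psum (fun s => if is_lead a s then psum a s * (psum a s `^ th * kh s) else 0) N <=
  (2 * C) `^ (1 + th).
Proof.
pose kappa k := Om k `^ Q^-1 / B k.
have kE k : (0 < k)%N -> kappa k `^ th = Om k `^ (1 + th) * B k `^ (- th).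
  move=> k0; rewrite /kappa powRM ?powR_ge0 ?invr_ge0 ?ltW ?B0//.
  rewrite -powRrM (mulrC Q^-1) thQ; congr (_ * _).
  by rewrite -powR_inv1 ?ltW ?B0// -powRrM mulN1r.
have kap0 : nonneg_seq kappa by move=> k k0; rewrite mulr_ge0 ?powR_ge0 ?invr_ge0 ?ltW ?B0.
have := @sup_test_lead R Q th C a kappa N Q01 thE C0 a0 kap0 _.
have -> : psum (fun s => if is_lead a s then psum a s * (psum a s `^ th * kh s) else 0) N =
    psum (fun s => if is_lead a s then psum a s * (psum a s `^ th *
       rmax (fun k => kappa k `^ th) s N) else 0) N.
  apply: eq_psum => s /andP[s0 _]; case: ifP => // _; congr (_ * (_ * _)).
  by rewrite /kh /rmax; apply: eq_big_nat => k ks; rewrite kE//; lia.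
apply => d d0; apply: le_trans (H d0); apply: ler_psum => n /andP[n0 nN].
rewrite ler_wpM2l ?a0//; apply: rmax_le; first exact: rmax_ge0.
move=> k kn; have k0 : (0 < k)%N by lia.
apply: le_trans (@le_rmax _ (fun i => Om i * rmax (fun k => (d k / B k) `^ Q) i N) _ _ k kn).
have -> : (d k * kappa k) `^ Q = Om k * (d k / B k) `^ Q.
  have dB0 : 0 <= d k / B k by rewrite divr_ge0 ?d0// ltW ?B0.
  by rewrite /kappa mulrCA (powRM _ (powR_ge0 _ _) dB0) powRVK ?(gt_eqF Q0)// Om0.
rewrite ler_wpM2l ?Om0//; apply: (@le_rmax _ (fun k => (d k / B k) `^ Q)); lia.
Qed.

(** Picks a maximizer of F in each block. The bound s <= f s is kept for every s, leader or not, so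
    that f s is a positive index whenever s is. *)
Let ex_k (F : nat -> R) : nonneg_seq F -> exists f : nat -> nat, forall s,
  (s <= f s)%N /\ ((0 < s <= N)%N -> is_lead a s ->
  [/\ (f s <= N)%N, lead a (f s) = s &
      forall j, (j <= N)%N -> lead a j = s -> F j <= F (f s)]).
Proof.
move=> F0; suff /choice[f fP] : forall s, exists k, (s <= k)%N /\
  ((0 < s <= N)%N -> is_lead a s -> [/\ (k <= N)%N, lead a k = s &
      forall j, (j <= N)%N -> lead a j = s -> F j <= F k]) by exists f.
move=> s; have [/andP[s0 sN]|?] := boolP (0 < s <= N)%N; last by exists s.
have [isl|?] := boolP (is_lead a s); last by exists s.
have [|k [ks /eqP Pk hk]] := @argmax_pred F (fun k => lead a k == s) s N sN isl.
  by move=> k ks; apply: F0; lia.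
exists k; split; [by case/andP: ks|move=> _ _; split => //; first by case/andP: ks].
move=> j jN lj; apply: hk; last exact/eqP.
by rewrite jN -lj lead_le.
Qed.

Let F2 k := Om k * B k `^ (- th).
Let F20 : nonneg_seq F2. Proof. by move=> k k0; rewrite mulr_ge0 ?powR_ge0 ?Om0. Qed.

Let k1 := sval (cid (ex_k Om0)).
Let k1P := svalP (cid (ex_k Om0)).
Let k2 := sval (cid (ex_k F20)).
Let k2P := svalP (cid (ex_k F20)).

Let g (k : nat -> nat) s := if is_lead a s then psum a s * Om (k s) else 0.
Let g0 (k : nat -> nat) : (forall s, (s <= k s)%N) -> nonneg_seq (g k).
Proof.
move=> hk s s0; rewrite /g; case: ifP => // _; rewrite mulr_ge0 ?nonneg_psum ?Om0//.
exact: leq_trans (hk s).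
Qed.
Let g10 : nonneg_seq (g k1). Proof. by apply: g0 => s; case: (k1P s). Qed.
Let g20 : nonneg_seq (g k2). Proof. by apply: g0 => s; case: (k2P s). Qed.

(** Each block of leader s puts the mass [psum a s * Om] at the maximizer [k1 s] of Om, and likewise
    at the maximizer [k2 s] of Om B^(- th). The factor Om thereby moves into the weight. *)
Let w k := psum (fun s => (if k1 s == k then g k1 s else 0) + (if k2 s == k then g k2 s else 0)) N.
Let w0 : nonneg_seq w.
Proof.
move=> k _; apply: psum_ge0 => s /andP[s0 _].
by apply: addr_ge0; case: ifP => // _; [exact: g10|exact: g20].
Qed.

Let sum_w (f : nat -> R) : psum (fun k => w k * f k) N =
  psum (fun s => g k1 s * f (k1 s)) N + psum (fun s => g k2 s * f (k2 s)) N.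
Proof.
have -> : psum (fun k => w k * f k) N = psum (fun k => psum (fun s =>
    (if k1 s == k then g k1 s * f (k1 s) else 0) +
    (if k2 s == k then g k2 s * f (k2 s) else 0)) N) N.
  apply: eq_psum => k _; rewrite /w /psum mulr_suml; apply: eq_bigr => s _.
  by rewrite mulrDl; congr (_ + _); case: eqP => [->//|_]; rewrite mul0r.
rewrite psum_psum_exchange -psumD; apply: eq_psum => s sN; rewrite psumD.
have [isl|nisl] := boolP (is_lead a s); last first.
  rewrite /g (negbTE nisl) !mul0r /psum !big1 ?addr0// => k _; exact: if_same.
have [h1 /(_ sN isl)[h2 _ _]] := k1P s.
have [h3 /(_ sN isl)[h4 _ _]] := k2P s.
by rewrite !psum_delta//; rewrite /k1 /k2; lia.
Qed.

(** Placing the mass of a leader at an index beyond it costs a factor 2 by [lead_sum_lb], and there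
    are two such families. The result is the hypothesis of [sup_test] for the weight w with kappa =
    1 / B. *)
Let w_test d : nonneg_seq d ->
  psum (fun n => w n * rmax (fun k => (d k / B k) `^ Q) n N) N <= 4 * C * psum d N `^ Q.
Proof.
move=> d0; pose f n := rmax (fun k => (d k / B k) `^ Q) n N.
have f0 n : 0 <= f n by exact: rmax_ge0.
pose T n := rmax (fun i => Om i * f i) n N.
suff hk (k : nat -> nat) : (forall s, (s <= k s)%N) ->
    (forall s, (0 < s <= N)%N -> is_lead a s -> (k s <= N)%N) ->
    psum (fun s => g k s * f (k s)) N <= 2 * psum (fun n => a n * T n) N.
  rewrite sum_w; have h1 : psum (fun s => g k1 s * f (k1 s)) N <= 2 * psum (fun n => a n * T n) N.
    apply: hk => [s|s sN isl]; first by case: (k1P s).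
    by case: (k1P s) => _ /(_ sN isl)[].
  have h2 : psum (fun s => g k2 s * f (k2 s)) N <= 2 * psum (fun n => a n * T n) N.
    apply: hk => [s|s sN isl]; first by case: (k2P s).
    by case: (k2P s) => _ /(_ sN isl)[].
  have := H d0; rewrite -/f -/T; lra.
move=> sk kN.
have -> : psum (fun s => g k s * f (k s)) N =
    psum (fun s => if is_lead a s then psum a s * (if (s <=
      N)%N then Om (k s) * f (k s) else 0) else 0) N.
  apply: eq_psum => s /andP[_ sN]; rewrite /g; case: ifP => _; last by rewrite mul0r.
  by rewrite sN mulrA.
apply: lead_sum_lb => //.
- by move=> n _; exact: rmax_ge0.
- move=> s s0; case: ifP => // _; rewrite mulr_ge0 ?Om0//; exact: leq_trans (sk s).
move=> n s ns sN isl; rewrite sN; apply: (@le_rmax _ (fun i => Om i * f i)).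
by have := sk s; have := kN s; rewrite sN isl; lia.
Qed.

Let E := 2 * 2 `^ th * (2 * (4 * C)) `^ (1 + th).
(** Up to a factor 2 this bounds the part of the running quantity [W] whose maxima are attained in
    blocks before that of s. *)
Let P s := psum (fun t => if (t < s)%N then g k1 t else 0) N.
Let P0 s : 0 <= P s.
Proof. by apply: psum_ge0 => t /andP[t0 _]; case: ifP => // _; exact: g10. Qed.
Let P_mono s t : (s <= t)%N -> P s <= P t.
Proof.
move=> st; apply: ler_psum => i /andP[i0 _]; case: ifP => [h|_]; first by rewrite (leq_trans h st).
by case: ifP => // _; exact: g10.
Qed.

(** For t < s the point [k1 t] lies in an earlier block, hence before s <= [k2 s], so its mass is
    counted in [psum w (k2 s)]. *)
Let P_le s : (0 < s <= N)%N -> is_lead a s -> P s <= psum w (k2 s).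
Proof.
move=> sN isl; rewrite /w psum_psum_exchange; apply: ler_psum => t tN.
have t0 : (0 < t)%N by case/andP: tN.
rewrite psumD; case: ifP => ts; last first.
  by rewrite addr_ge0//; apply: psum_ge0 => k _; case: ifP => // _; [exact: g10|exact: g20].
have [islt|nislt] := boolP (is_lead a t); last first.
  by rewrite {1}/g (negbTE nislt) addr_ge0//; apply: psum_ge0 => k _; case: ifP => // _;
    [exact: g10|exact: g20].
have [tk1 /(_ tN islt)[k1N lk1 _]] := k1P t.
have [sk2 _] := k2P s.
have k1s : (k1 t < s)%N.
  rewrite ltnNge; apply/negP => /(lead_mono a); rewrite lk1 (eqP isl); lia.
rewrite psum_delta.
  by rewrite lerDl; apply: psum_ge0 => k _; case: ifP => // _; exact: g20.
by move: tk1 sk2 k1s; rewrite -/k1 -/k2; lia.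
Qed.

(** [sup_test] for w, keeping only k = n in the maximum and only the masses placed at the points
    [k2 s]. *)
Let D3_bound :
  psum (fun s => if is_lead a s then psum a s * (F2 (k2 s) * P s `^ th) else 0) N <= E.
Proof.
have Bi0 : nonneg_seq (fun k => (B k)^-1) by move=> k k0; rewrite invr_ge0 ltW ?B0.
have C40 : 0 <= 4 * C by rewrite mulr_ge0.
have := @sup_test R Q th (4 * C) w _ N Q01 thE C40 w0 Bi0 w_test.
apply: le_trans.
apply: (@le_trans _ _ (psum (fun k => w k * (psum w k `^ th * B k `^ (- th))) N)); last first.
  apply: ler_psum => n /andP[n0 nN]; rewrite mulrA ler_wpM2l ?mulr_ge0 ?powR_ge0 ?w0//.
  have -> : B n `^ (- th) = (B n)^-1 `^ th.
    by rewrite -powR_inv1 ?ltW ?B0// -powRrM mulN1r.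
  by apply: (@le_rmax _ (fun k => (B k)^-1 `^ th)); rewrite leqnn.
rewrite (sum_w (fun k => psum w k `^ th * B k `^ (- th))).
apply: (@le_trans _ _ (psum (fun s => g k2 s * (psum w (k2 s) `^ th * B (k2 s) `^ (- th))) N));
  last first.
  rewrite lerDr; apply: psum_ge0 => s /andP[s0 _].
  by rewrite mulr_ge0 ?g10 ?mulr_ge0 ?powR_ge0.
apply: ler_psum => s sN; rewrite /g; case: ifP => isl; last by rewrite mul0r.
have k20 : (0 < k2 s)%N by have [h _] := k2P s; rewrite /k2; lia.
rewrite -(mulrA (psum a s)) ler_wpM2l ?nonneg_psum// /F2 -mulrA ler_wpM2l ?Om0// mulrC.
by rewrite ler_wpM2r ?powR_ge0//; apply: le_powR; [exact: ltW|exact: P0|exact: P_le].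
Qed.

Let lead_upto_sum t n :
  psum (fun i => if (lead a i <= t)%N then a i else 0) n <= 2 * psum a t.
Proof.
elim: n => [|n IH]; first by rewrite psum0 mulr_ge0 ?nonneg_psum.
rewrite psumS; case: ifP => [ls|_]; last by rewrite addr0.
apply: le_trans (_ : psum a n.+1 <= _); last first.
  by apply: le_trans (psum_le_lead n.+1 a0) _; rewrite ler_pM2l// psum_nondecr.
rewrite psumS lerD2r; apply: ler_psum => k /andP[k0 _]; case: ifP => // _; exact: a0.
Qed.

Let W n := psum (fun i => a i * rmax Om i n) n.

(** With s the leader of n, the maximum of Om over [i, n] is attained in [s, n] or in the block of
    some t < s, where Om is at most its value at [k1 t]. The indices i with leader at most t have
    total mass at most [2 * psum a t]. *)
Let W_le n : (n <= N)%N ->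
  W n <= 2 * (P (lead a n) + psum a (lead a n) * rmax Om (lead a n) n).
Proof.
move=> nN; set s := lead a n; set K := rmax Om s n.
have K0 : 0 <= K by exact: rmax_ge0.
pose S i := psum (fun t => if [&& (t < s)%N, (lead a i <=
  t)%N & is_lead a t] then Om (k1 t) else 0) N.
have k1pos t : (0 < t)%N -> 0 <= Om (k1 t).
  by move=> t0; apply: Om0; have [h _] := k1P t; rewrite /k1; lia.
have S0 i : 0 <= S i by apply: psum_ge0 => t /andP[t0 _]; case: ifP => // _; exact: k1pos.
have step i : (0 < i <= n)%N -> a i * rmax Om i n <= a i * K + a i * S i.
  move=> /andP[i0 iN]; have [l0|l0] := eqVneq (lead a i) 0%N.
    by rewrite (lead0_eq0 a0 i0 l0) !mul0r addr0.
  rewrite -mulrDr ler_wpM2l ?a0//; apply: rmax_le; first by rewrite addr_ge0.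
  move=> j /andP[ij jn]; have [sj|js] := leqP s j.
    by apply: ler_wpDr => //; apply: le_rmax; rewrite sj.
  apply: ler_wpDl => //; set t := lead a j.
  have islt : is_lead a t by exact: lead_is_lead.
  have lit : (lead a i <= t)%N by exact: lead_mono.
  have ts : (t < s)%N by apply: leq_ltn_trans js; exact: lead_le.
  have tN : (0 < t <= N)%N by have := lead_le a j; rewrite -/t; lia.
  have [_ /(_ tN islt)[_ _ /(_ j)]] := k1P t.
  move=> /(_ (leq_trans jn nN) erefl)/le_trans; apply.
  pose F t := if [&& (t < s)%N, (lead a i <= t)%N & is_lead a t] then Om (k1 t) else 0.
  have := @le_psum_term R F N t; rewrite {2}/F ts lit islt; apply => // t' t'0.
  by rewrite /F; case: ifP => // _; exact: k1pos.
apply: (@le_trans _ _ (psum (fun i => K * a i + a i * S i) n)).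
  by apply: ler_psum => i iN; rewrite (mulrC K); exact: step.
rewrite psumD psumM mulrDr addrC; apply: lerD; last first.
  by rewrite mulrA mulrC ler_wpM2r// psum_le_lead.
rewrite /S (_ : psum _ n = psum (fun i => psum (fun t => a i * (if [&& (t < s)%N,
  (lead a i <= t)%N & is_lead a t] then Om (k1 t) else 0)) N) n); last first.
  by apply: eq_psum => i _; rewrite /psum mulr_sumr.
rewrite psum_psum_exchange /P -psumM; apply: ler_psum => t /andP[t0 tN].
case: ifP => ts /=; last by rewrite mulr0 /psum big1// => i _; rewrite mulr0.
rewrite /g; case: ifP => islt /=; last first.
  by rewrite mulr0 /psum big1// => i _; rewrite andbF mulr0.
rewrite mulrA; apply: le_trans (ler_wpM2r (k1pos _ t0) (lead_upto_sum t n)).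
rewrite mulrC -psumM; apply: ler_psum => i _.
by rewrite andbT; case: ifP; rewrite ?mulr0// mulrC.
Qed.

(** Let j in [s, n] and k in [n, N] be the two maximizers, and evaluate [kh] at the one with the
    larger Om. If this is j, then B j <= B k and the negative exponent of B allow replacing k by
    j. *)
Let KM_le n : (0 < lead a n)%N -> (n <= N)%N ->
  rmax Om (lead a n) n `^ th * M n <= kh (lead a n).
Proof.
move=> s0 nN; have sn := lead_le a n; set s := lead a n in s0 sn *.
have [||j js ->] := @rmax_attained R Om s n; [by []|by move=> k ks; apply: Om0; lia|].
rewrite /M; have [||k kn ->] := @rmax_attained R (fun k => Om k * B k `^ (- th)) n N; first by [].
  by move=> k kn; rewrite mulr_ge0 ?powR_ge0 ?Om0//; lia.
have j0 : (0 < j)%N by lia.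
have k0 : (0 < k)%N by lia.
have th1 : 0 < 1 + th by rewrite addr_gt0.
have pE (x : R) : 0 <= x -> x `^ (1 + th) = x * x `^ th.
  by move=> x0; rewrite powRDge0// powRr1.
have [jk|kj] := leP (Om j) (Om k).
  apply: le_trans (@le_rmax _ (fun k => Om k `^ (1 + th) * B k `^ (- th)) s N k _); last by lia.
  rewrite mulrA ler_wpM2r ?powR_ge0// pE ?Om0// mulrC ler_wpM2l ?Om0//.
  by apply: le_powR => //; [exact: ltW|exact: Om0].
apply: le_trans (@le_rmax _ (fun k => Om k `^ (1 + th) * B k `^ (- th)) s N j _); last by lia.
rewrite pE ?Om0// (mulrC (Om j)) -mulrA ler_wpM2l ?powR_ge0//.
apply: ler_pM; rewrite ?Om0 ?powR_ge0 ?(ltW kj)//.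
by apply: powR_nonincr; [rewrite oppr_le0 ltW|exact: B0|apply: Bnd; lia].
Qed.

(** The maximum after s is bounded by the sum of the block maxima over leaders t >= s. After
    exchanging sums, P s <= P t and [lead_geom] reduce everything to [D3_bound]. *)
Let PM_le :
  psum (fun s => if is_lead a s then psum a s * (P s `^ th * M s) else 0) N <= 2 * E.
Proof.
pose m t := F2 (k2 t).
have m0 t : (0 < t)%N -> 0 <= m t.
  by move=> t0; apply: F20; have [h _] := k2P t; rewrite /k2; lia.
have M_le s : (0 < s <= N)%N -> is_lead a s ->
    M s <= psum (fun t => if (s <= t)%N && is_lead a t then m t else 0) N.
  move=> /andP[s0 sN] isl.
  rewrite /M; have [||k ks ->] := @rmax_attained R (fun k => Om k * B k `^ (- th)) s N; first by [].
    by move=> k kn; rewrite mulr_ge0 ?powR_ge0 ?Om0//; lia.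
  have st : (s <= lead a k)%N by rewrite -{1}(eqP isl) lead_mono//; case/andP: ks.
  have tN : (0 < lead a k <= N)%N by have := lead_le a k; lia.
  have kN : (k <= N)%N by case/andP: ks.
  have [_ /(_ tN (lead_is_lead a k))[_ _ /(_ k kN erefl)]] := k2P (lead a k).
  move/le_trans; apply.
  have := @le_psum_term R (fun t => if (s <= t)%N && is_lead a t then m t else 0) N (lead a k).
  by rewrite st lead_is_lead; apply => // t t0; case: ifP => // _; exact: m0.
apply: (@le_trans _ _ (psum (fun s => \sum_(s <= t < N.+1)
   (if is_lead a s && is_lead a t then psum a s * (P s `^ th * m t) else 0)) N)).
  apply: ler_psum => s sN; have s0 : (0 < s)%N by case/andP: sN.
  have [isl|nisl] := boolP (is_lead a s); last by rewrite big1.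
  rewrite /= sum_tail//; apply: (@le_trans _ _ (psum a s * (P s `^ th *
     psum (fun t => if (s <= t)%N && is_lead a t then m t else 0) N))).
    by rewrite ler_wpM2l ?nonneg_psum// ler_wpM2l ?powR_ge0// M_le.
  rewrite -!psumM; apply: ler_psum => t _.
  by case: (s <= t)%N; case: (is_lead a t); rewrite /= ?mulr0.
rewrite psum_exchange; apply: le_trans (ler_wpM2l _ D3_bound) => //.
rewrite -psumM; apply: ler_psum => t /andP[t0 tN].
case: ifP => islt; last by rewrite mulr0 /psum big1// => s _; rewrite andbF.
rewrite mulrA -/(m t); apply: le_trans (ler_wpM2r _ (lead_geom a0 islt)); last first.
  by rewrite mulr_ge0 ?powR_ge0 ?m0.
rewrite mulrC -psumM; apply: ler_psum => s /andP[s0 st].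
rewrite andbT; case: ifP => _; last by rewrite mulr0.
rewrite mulrC (mulrC (m t)) ler_wpM2r ?nonneg_psum// ler_wpM2r ?m0//.
by apply: le_powR; [exact: ltW|exact: P0|exact: P_mono].
Qed.

(** By [W_le] the sum splits into P^th M, controlled through the new weight, and the contribution of
    the current block, controlled by [kh]; both are then summed over leaders. *)
Lemma sup_test_block :
  psum (fun n => psum (fun i => a i * rmax Om i n) n `^ th * a n *
     rmax (fun k => Om k * B k `^ (- th)) n N) N <=
  2 `^ th * 2 `^ th * 2 * (2 * (2 * 2 `^ th * (2 * (4 * C)) `^ (1 + th)) + (2 * C) `^ (1 + th)).
Proof.
apply: (@le_trans _ _ (2 `^ th * 2 `^ th * psum (fun n => a n *
    (P (lead a n) `^ th * M (lead a n) + psum a (lead a n) `^ th * kh (lead a n))) N)).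
  rewrite -psumM; apply: ler_psum => n /andP[n0 nN].
  have [l0|l0] := eqVneq (lead a n) 0%N.
    by rewrite (lead0_eq0 a0 n0 l0) !(mulr0, mul0r).
  set s := lead a n in l0 *; have s0 : (0 < s)%N by lia.
  rewrite -/(W n) -/(M n) [in leRHS]mulrCA (mulrC (_ `^ _) (a n)) -mulrA ler_wpM2l ?a0//.
  have K0 : 0 <= rmax Om s n by exact: rmax_ge0.
  have A0 : 0 <= psum a s by exact: nonneg_psum.
  have M0 : 0 <= M n by exact: rmax_ge0.
  apply: (@le_trans _ _ ((2 * (P s + psum a s * rmax Om s n)) `^ th * M n)).
    rewrite ler_wpM2r//; apply: le_powR; [exact: ltW| |exact: W_le].
    by apply: psum_ge0 => i /andP[i0 _]; rewrite mulr_ge0 ?rmax_ge0 ?a0.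
  rewrite powRM ?addr_ge0 ?mulr_ge0// -!mulrA ler_pM2l ?powR_gt0//.
  apply: (@le_trans _ _ (2 `^ th * (P s `^ th + (psum a s * rmax Om s n) `^ th) * M n)).
    by rewrite ler_wpM2r// powRD_le ?mulr_ge0 ?(ltW th0).
  rewrite -mulrA ler_pM2l ?powR_gt0// mulrDl; apply: lerD.
    by rewrite ler_wpM2l ?powR_ge0// rmax_antitone// lead_le.
  by rewrite powRM// -mulrA ler_wpM2l ?powR_ge0// KM_le.
rewrite -(mulrA (2 `^ th * 2 `^ th) 2) ler_wpM2l ?mulr_ge0 ?powR_ge0//.
pose F s := P s `^ th * M s + psum a s `^ th * kh s.
have F0 : nonneg_seq F by move=> s s0; rewrite addr_ge0// mulr_ge0 ?powR_ge0 ?rmax_ge0.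
apply: le_trans (lead_sum_ub N a0 F0) _; rewrite ler_pM2l//.
have h1 := PM_le; have h2 := kh_bound.
rewrite (_ : psum _ N = psum (fun s => if is_lead a s then psum a s * (P s `^ th * M s) else 0) N +
  psum (fun s => if is_lead a s then psum a s * (psum a s `^ th * kh s) else 0) N); last first.
  by rewrite -psumD; apply: eq_psum => s _; case: ifP => _; rewrite ?addr0// mulrDr.
exact: lerD.
Qed.

End BlockTest.

Ltac nlia := repeat match goal with
  | H : is_true (@Order.le _ _ _ _) |- _ => clear H
  | H : is_true (@Order.lt _ _ _ _) |- _ => clear H
  end; lia.

(** * Linearization of the supremum *)

Section Linearization.
Context {R : realType}.

(** sigma k is the least maximizer of y on [k, N]. For k' in [k, sigma k] it still maximizes on
    [k', N], and a maximizer there also maximizes on [k, N], so the least ones coincide. *)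
Lemma linearize_sup (y : nat -> R) N : nonneg_seq y ->
  exists sigma : nat -> nat, forall k, (0 < k <= N)%N ->
  [/\ (k <= sigma k <= N)%N, (forall i, (k <= i <= N)%N -> y i <= y (sigma k)) &
      forall k', (k <= k' <= sigma k)%N -> sigma k' = sigma k].
Proof.
move=> y0.
pose P k i := (k <= i <= N)%N && all (fun j => y j <= y i) (index_iota k N.+1).
have PP k i : reflect ((k <= i <= N)%N /\ forall j, (k <= j <= N)%N -> y j <= y i) (P k i).
  apply: (iffP andP) => -[ki h]; split=> //; last first.
    by apply/allP => j; rewrite mem_index_iota ltnS; exact: h.
  by move=> j kj; apply: (allP h); rewrite mem_index_iota ltnS.
have /choice[sigma sP] : forall k, exists s, (0 < k <= N)%N ->
    P k s /\ forall i, P k i -> (s <= i)%N.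
  move=> k; have [/andP[k0 kN]|?] := boolP (0 < k <= N)%N; last by exists 0%N.
  have [|i ki iE] := @rmax_attained R y k N kN; first by move=> j kj; apply: y0; nlia.
  have exP : exists i, P k i.
    by exists i; apply/PP; split=> // j kj; rewrite -iE; exact: le_rmax.
  by exists (ex_minn exP) => _; case: ex_minnP.
exists sigma => k kN; have [/PP[ks h] min] := sP k kN; split=> // k' kk'.
have kN' : (0 < k' <= N)%N by nlia.
have [/PP[ks' h'] min'] := sP k' kN'.
apply/eqP; rewrite eqn_leq min' ?min//; apply/PP; split; [nlia| |nlia|].
  by move=> j kj; apply: le_trans (h j kj) _; apply: h'; nlia.
by move=> j kj; apply: h; nlia.
Qed.

Lemma psum_upto (F : nat -> R) n N : (n <= N)%N ->
  psum (fun k => if (k <= n)%N then F k else 0) N = psum F n.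
Proof.
move=> nN; rewrite /psum -big_mkcond/= (big_nat_widen 1 n.+1 N.+1)//.
Qed.

Lemma tail_pow_le (w : nat -> R) (e : R) n N : nonneg_seq w -> 0 < e -> (0 < n <= N)%N ->
  (\sum_(n <= k < N.+1) w k) `^ e <=
  Num.max 1 e * \sum_(n <= k < N.+1) w k * (\sum_(k <= j < N.+1) w j) `^ (e - 1).
Proof.
move=> w0 e0 nN.
have nN' : (N.+1 - n <= N)%N by nlia.
have := psum_pow_le (N.+1 - n) (rev_seq_ge0 N w0) e0.
rewrite psum_rev_seq// (_ : N.+1 - (N.+1 - n) = n)%N; last by nlia.
move/le_trans; apply; rewrite ler_pM2l ?max1_gt0//.
rewrite -[X in X <= _](@eq_psum _ (rev_seq N (fun k => w k * (\sum_(k <=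
  j < N.+1) w j) `^ (e - 1)))).
  by rewrite psum_rev_seq// (_ : N.+1 - (N.+1 - n) = n)%N//; nlia.
move=> k kn; have kN : (k <= N)%N by nlia.
by rewrite !rev_seqE// psum_rev_seq.
Qed.

Lemma psum_pow_sub (a a' : nat -> R) (e : R) N : nonneg_seq a' ->
  (forall k, (0 < k)%N -> a' k <= a k) -> 1 <= e ->
  psum a' N `^ e <= e * psum (fun k => a' k * psum a k `^ (e - 1)) N.
Proof.
move=> a0 aa e1; have e0 : 0 < e by lra.
apply: le_trans (psum_pow_le N a0 e0) _; rewrite max_r// ler_pM2l//.
apply: ler_psum => k /andP[k0 _]; rewrite ler_wpM2l ?a0//.
apply: le_powR; [lra|exact: nonneg_psum|].
by apply: ler_psum => j /andP[j0 _]; exact: aa.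
Qed.

Lemma abel_psum (f b : nat -> R) n :
  psum (fun m => (f m - f m.+1) * psum b m) n = psum (fun m => f m * b m) n - f n.+1 * psum b n.
Proof.
elim: n => [|n IH]; first by rewrite !psum0 mulr0 subr0.
by rewrite psumS IH (psumS (fun m => f m * b m)) (psumS b); ring.
Qed.

Variables (a : nat -> R) (sigma : nat -> nat) (N : nat).
Hypothesis a0 : nonneg_seq a.
Hypothesis sP : forall k, (0 < k <= N)%N -> (k <= sigma k <= N)%N /\
  forall k', (k <= k' <= sigma k)%N -> sigma k' = sigma k.

(** Image of the weight a(k) nu(sigma k) under sigma: sums of functions of sigma k become sums over
    n, to which the Hardy inequalities apply. *)
Let w (nu : nat -> R) n := psum (fun k => if sigma k == n then a k * nu n else 0) N.

Let w0 nu : nonneg_seq nu -> nonneg_seq (w nu).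
Proof.
move=> nu0 n n0; apply: psum_ge0 => k /andP[k0 _].
by case: ifP => // _; rewrite mulr_ge0 ?a0 ?nu0.
Qed.

Let fiber_sum (F f : nat -> R) :
  psum (fun n => psum (fun k => if sigma k == n then F k else 0) N * f n) N =
  psum (fun k => F k * f (sigma k)) N.
Proof.
have -> : psum (fun n => psum (fun k => if sigma k == n then F k else 0) N * f n) N =
  psum (fun n => psum (fun k => if sigma k == n then F k * f (sigma k) else 0) N) N.
  apply: eq_psum => n _; rewrite /psum mulr_suml; apply: eq_bigr => k _.
  by case: eqP => [->//|_]; rewrite mul0r.
rewrite psum_psum_exchange; apply: eq_psum => k kN; apply: psum_delta.
by have [h _] := sP kN; nlia.
Qed.

Let sum_w nu (f : nat -> R) :
  psum (fun n => w nu n * f n) N = psum (fun k => a k * nu (sigma k) * f (sigma k)) N.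
Proof.
rewrite -(fiber_sum (fun k => a k * nu (sigma k)) f); apply: eq_psum => n _.
by congr (_ * _); apply: eq_psum => k _; case: eqP => [->|].
Qed.

Let psum_w nu n : (n <= N)%N -> psum (w nu) n =
  psum (fun k => if (sigma k <= n)%N then a k * nu (sigma k) else 0) N.
Proof.
move=> nN; rewrite -(psum_upto (w nu) nN).
have -> : psum (fun k => if (k <= n)%N then w nu k else 0) N =
   psum (fun k => w nu k * (if (k <= n)%N then 1 else 0)) N.
  by apply: eq_psum => k _; case: ifP; rewrite ?mulr1 ?mulr0.
by rewrite sum_w; apply: eq_psum => k _; case: ifP; rewrite ?mulr1 ?mulr0.
Qed.

Let tail_w nu n : (0 < n)%N -> \sum_(n <= i < N.+1) w nu i =
  psum (fun k => if (n <= sigma k)%N then a k * nu (sigma k) else 0) N.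
Proof.
move=> n0; rewrite sum_tail//.
have -> : psum (fun k => if (n <= k)%N then w nu k else 0) N =
   psum (fun k => w nu k * (if (n <= k)%N then 1 else 0)) N.
  by apply: eq_psum => k _; case: ifP; rewrite ?mulr1 ?mulr0.
by rewrite sum_w; apply: eq_psum => k _; case: ifP; rewrite ?mulr1 ?mulr0.
Qed.

Let Z (nu : nat -> R) n := \sum_(n <= i < N.+1) rmax nu i N * a i.

Let ZE nu n : (0 < n)%N -> Z nu n = psum (fun k => if (n <= k)%N then rmax nu k N * a k else 0) N.
Proof. exact: sum_tail. Qed.

(** The tail of the image weight at n collects the k with sigma k >= n. Those with k <= n are
    bounded by the tail maximum of nu times [psum a n], those with k > n by [Z nu n]. *)
Lemma partI_ge1 (Q D1 D2 : R) nu G Phi : 1 <= Q ->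
  nonneg_seq nu -> nonneg_seq G -> nonneg_seq Phi ->
  (forall n, (0 < n <= N)%N -> rmax nu n N * psum a n * Phi n `^ Q <= D1) ->
  (forall n, (0 < n <= N)%N -> Z nu n * Phi n `^ Q <= D2) ->
  psum (fun k => a k * nu (sigma k) * psum (fun m => G m * Phi m) (sigma k) `^ Q) N <=
  (D1 + D2) * psum G N `^ Q.
Proof.
move=> Q1 nu0 G0 P0 h1 h2.
rewrite -(sum_w nu (fun n => psum (fun m => G m * Phi m) n `^ Q)).
apply: (hardy_rev_ge1 Q1 (w0 nu0) G0 P0) => n nN.
apply: le_trans (lerD (h1 n nN) (h2 n nN)).
rewrite -mulrDl ler_wpM2r ?powR_ge0//.
have /andP[n0 nN'] := nN; rewrite tail_w// ZE// -psumM -(psum_upto _ nN') -psumD.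
apply: ler_psum => k kN; have [sk _] := sP kN; have k0 : (0 < k)%N by nlia.
case: ifP => [nsk|_]; last first.
  by apply: addr_ge0; case: ifP => // _; rewrite mulr_ge0 ?a0 ?rmax_ge0.
have [kn|nk] := leqP k n.
  apply: ler_wpDr; first by case: ifP => // _; rewrite mulr_ge0 ?a0 ?rmax_ge0.
  by rewrite mulrC ler_wpM2r ?a0//; apply: le_rmax; nlia.
by rewrite add0r (ltnW nk) mulrC ler_wpM2r ?a0//; apply: le_rmax.
Qed.

(** A non-increasing sequence is the tail sum of its decrements. Multiplying and dividing these by
    [psum b] gives the tail operator with kernel 1 / [psum b]; cutting f at N removes the boundary
    term. *)
Let decompose (f b : nat -> R) : nonneg_seq f -> nonincr_seq f -> nonneg_seq b -> 0 < b 1%N ->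
  exists G : nat -> R, [/\ nonneg_seq G, psum G N = psum (fun k => f k * b k) N &
    forall n, (0 < n <= N)%N -> \sum_(n <= m < N.+1) G m * (psum b m)^-1 = f n].
Proof.
move=> f0 fni b0 b1; pose f' k := if (k <= N)%N then f k else 0.
have B0 m : (0 < m)%N -> 0 < psum b m := psum_gt0 b0 b1.
exists (fun m => (f' m - f' m.+1) * psum b m); split.
- move=> m m0; rewrite mulr_ge0 ?nonneg_psum// subr_ge0 /f'.
  case: ifP => h1; case: ifP => h2 //; [exact: fni|nlia|exact: f0].
- rewrite abel_psum /f' ltnn mul0r subr0; apply: eq_psum => k /andP[_ kN].
  by rewrite kN.
move=> n nN; transitivity (\sum_(n <= m < N.+1) (f' m - f' m.+1)).
  by apply: eq_big_nat => m mn; rewrite mulfK// gt_eqF// B0//; nlia.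
rewrite -(opprK (\sum_(_ <= _ < _) _)) -sumrN.
rewrite (eq_bigr (fun m => f' m.+1 - f' m)); last by move=> m _; rewrite opprB.
rewrite telescope_sumr; last by nlia.
by rewrite /f' ltnn sub0r opprK ifT//; nlia.
Qed.

(** If sigma k <= n then also k <= n, and Om (sigma k) is at most the maximum of Om over [k, n]. *)
Lemma partII_ge1 (Q D : R) Om f b : 1 <= Q ->
  nonneg_seq Om -> nonneg_seq f -> nonincr_seq f -> nonneg_seq b -> 0 < b 1%N ->
  (forall n, (0 < n <= N)%N -> psum (fun i => a i * rmax Om i n) n * psum b n `^ (- Q) <= D) ->
  psum (fun k => a k * Om (sigma k) * f (sigma k) `^ Q) N <=
  D * psum (fun k => f k * b k) N `^ Q.
Proof.
move=> Q1 Om0 f0 fni b0 b1 h.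
have [G [G0 GN fE]] := decompose f0 fni b0 b1.
rewrite -(sum_w Om (fun n => f n `^ Q)) -GN.
have P0 : nonneg_seq (fun m => (psum b m)^-1) by move=> m _; rewrite invr_ge0 nonneg_psum.
rewrite (@eq_psum _ _ (fun n => w Om n * (\sum_(n <= m < N.+1) G m * (psum b m)^-1) `^ Q));
  last first.
  by move=> n nN; rewrite fE.
apply: (hardy_ge1 Q1 (w0 Om0) G0 P0) => n nN; apply: le_trans (h n nN).
have -> : psum b n `^ (- Q) = (psum b n)^-1 `^ Q.
  by rewrite -powR_inv1 ?nonneg_psum// -powRrM mulN1r.
rewrite ler_wpM2r ?powR_ge0//.
have nN' : (n <= N)%N by case/andP: nN.
rewrite psum_w// -(psum_upto _ nN'); apply: ler_psum => k kN.
have [sk _] := sP kN; have k0 : (0 < k)%N by nlia.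
case: ifP => [skn|_]; last by case: ifP => // _; rewrite mulr_ge0 ?a0 ?rmax_ge0.
rewrite ifT; last by nlia.
by rewrite ler_wpM2l ?a0//; apply: le_rmax; nlia.
Qed.

Let alpha n := psum (fun l => if sigma l == n then a l else 0) N.

Let alpha0 n : 0 <= alpha n.
Proof. by apply: psum_ge0 => l /andP[l0 _]; case: ifP => // _; exact: a0. Qed.

(** Summed over a fibre, a alpha^th is alpha^(1 + th), which is at most 1 + th times the sum of a(k)
    A(k)^th over the same fibre, with A = [psum a]. *)
Let alpha_pow (th : R) (f : nat -> R) : 0 < th -> nonneg_seq f ->
  psum (fun k => a k * alpha (sigma k) `^ th * f (sigma k)) N <=
  (1 + th) * psum (fun k => a k * psum a k `^ th * f (sigma k)) N.
Proof.
move=> th0 f0.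
have E : psum (fun k => a k * (alpha (sigma k) `^ th * f (sigma k))) N =
    psum (fun n => alpha n * (alpha n `^ th * f n)) N.
  by rewrite -(fiber_sum a (fun n => alpha n `^ th * f n)).
rewrite (@eq_psum _ _ (fun k => a k * (alpha (sigma k) `^ th * f (sigma k)))); last first.
  by move=> k _; rewrite mulrA.
rewrite E -(fiber_sum (fun k => a k * psum a k `^ th) f) -psumM.
apply: ler_psum => n /andP[n0 nN]; rewrite !mulrA ler_wpM2r ?f0//.
have th1 : 0 < 1 + th by rewrite addr_gt0.
have -> : alpha n * alpha n `^ th = alpha n `^ (1 + th) by rewrite powRDge0// powRr1.
have e1 : 1 <= 1 + th by rewrite lerDl ltW.
have a'0 : nonneg_seq (fun l => if sigma l == n then a l else 0).
  by move=> k k0; case: ifP => // _; exact: a0.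
have a'a k : (0 < k)%N -> (if sigma k == n then a k else 0) <= a k.
  by move=> k0; case: ifP => // _; exact: a0.
apply: le_trans (psum_pow_sub N a'0 a'a e1) _; rewrite ler_pM2l//.
apply: ler_psum => k _; rewrite (addrC 1) addrK.
by case: ifP; rewrite // mul0r.
Qed.

(** Within a fibre sigma k may lie far beyond k, so [psum (w Om) (sigma k)] is bounded by the
    running quantity at k plus the contribution of the fibre. The former leads to D7, the latter, by
    [alpha_pow], to D6. *)
Lemma partII_lt1 (Q th c1 : R) Om f b D6 D7 :
  0 < Q < 1 -> th = Q / (1 - Q) -> 0 < c1 -> hardy_bound Q th c1 ->
  nonneg_seq Om -> nonneg_seq f -> nonincr_seq f -> nonneg_seq b -> 0 < b 1%N ->
  psum (fun k => a k * psum a k `^ th *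
    rmax (fun i => Om i `^ (1 + th) * psum b i `^ (- th)) k N) N <= D6 ->
  psum (fun k => psum (fun i => a i * rmax Om i k) k `^ th * a k *
    rmax (fun i => Om i * psum b i `^ (- th)) k N) N <= D7 ->
  psum (fun k => a k * Om (sigma k) * f (sigma k) `^ Q) N <=
  c1 * (2 `^ th * (1 + th)) `^ (1 - Q) * ((D6 + D7) `^ (1 - Q) * psum (fun k => f k * b k) N `^ Q).
Proof.
move=> Q01 thE c10 hardy Om0 f0 fni b0 b1 h6 h7.
have /andP[Q0 Q1] := Q01; have th0 : 0 < th by rewrite thE divr_gt0 ?subr_gt0.
have th1 : 0 < 1 + th by rewrite addr_gt0.
have c20 : 0 < 2 `^ th * (1 + th) by rewrite mulr_gt0 ?powR_gt0.
have [G [G0 GN fE]] := decompose f0 fni b0 b1.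
have P0 : nonneg_seq (fun m => (psum b m)^-1) by move=> m _; rewrite invr_ge0 nonneg_psum.
have Bp m : (0 < m)%N -> 0 < psum b m := psum_gt0 b0 b1.
have Pni : nonincr_seq (fun m => (psum b m)^-1).
  by move=> m n m0 mn; rewrite lef_pV2 ?posrE ?Bp ?psum_nondecr//; nlia.
rewrite -(sum_w Om (fun n => f n `^ Q)) -GN.
rewrite (@eq_psum _ _ (fun n => w Om n * (\sum_(n <= m < N.+1) G m * (psum b m)^-1) `^ Q));
  last first.
  by move=> n nN; rewrite fE.
apply: le_trans (hardy (w Om) G _ N (w0 Om0) G0 P0 Pni) _.
rewrite -mulrA ler_pM2l// mulrA ler_wpM2r ?powR_ge0//.
have D60 : 0 <= D6.
  by apply: le_trans h6; apply: psum_ge0 => k /andP[k0 _];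
    rewrite !mulr_ge0 ?powR_ge0 ?rmax_ge0 ?a0.
have D70 : 0 <= D7.
  by apply: le_trans h7; apply: psum_ge0 => k /andP[k0 _];
    rewrite !mulr_ge0 ?powR_ge0 ?rmax_ge0 ?a0.
rewrite -powRM ?addr_ge0 ?(ltW c20)//; apply: le_powR; first by lra.
  by apply: psum_ge0 => k /andP[k0 _]; rewrite !mulr_ge0 ?powR_ge0 ?w0.
rewrite (@eq_psum _ _ (fun n => w Om n * (psum (w Om) n `^ th * psum b n `^ (- th)))); last first.
  move=> n _; rewrite -mulrA; congr (_ * (_ * _)).
  by rewrite -powR_inv1 ?nonneg_psum// -powRrM mulN1r.
rewrite (sum_w Om (fun n => psum (w Om) n `^ th * psum b n `^ (- th))).
pose W k := psum (fun i => a i * rmax Om i k) k.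
have W0 k : 0 <= W k by apply: psum_ge0 => i /andP[i0 _]; rewrite mulr_ge0 ?a0 ?rmax_ge0.
have Wle k : (0 < k <= N)%N -> psum (w Om) (sigma k) <= W k + alpha (sigma k) * Om (sigma k).
  move=> kN; have [sk hsk] := sP kN; have kN' : (k <= N)%N by case/andP: kN.
  rewrite psum_w; last by case/andP: sk.
  rewrite /W /alpha mulrC -psumM -(psum_upto _ kN') -psumD; apply: ler_psum => l lN.
  have [sl hsl] := sP lN; have l0 : (0 < l)%N by case/andP: lN.
  have h1 : 0 <= a l * rmax Om l k by rewrite mulr_ge0 ?a0 ?rmax_ge0.
  have h2 : 0 <= (if (l <= k)%N then a l * rmax Om l k else 0) by case: ifP.
  have h3 : 0 <= Om (sigma k) * (if sigma l == sigma k then a l else 0).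
    by rewrite mulr_ge0 ?Om0//; [nlia|case: ifP => // _; exact: a0].
  case: ifP => [slk|_]; last exact: addr_ge0.
  (* Either l belongs to the fibre of sigma k, or by the constancy of sigma the whole interval
     [l, sigma l] precedes k. *)
  have [e|ne] := eqVneq (sigma l) (sigma k).
    by rewrite e mulrC; apply: ler_wpDl.
  have lk : (l < k)%N.
    rewrite ltnNge; apply/negP => kl; move/eqP: ne; apply; apply: hsk; nlia.
  have slk' : (sigma l < k)%N.
    rewrite ltnNge; apply/negP => kl; move/eqP: ne; apply; symmetry; apply: hsl; nlia.
  rewrite mulr0 addr0 ltnW// ler_wpM2l ?a0//; apply: le_rmax; nlia.
apply: (@le_trans _ _ (2 `^ th * (psum (fun k => W k `^ th * a k *
      rmax (fun i => Om i * psum b i `^ (- th)) k N) N +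
    psum (fun k => a k * alpha (sigma k) `^ th *
      (Om (sigma k) `^ (1 + th) * psum b (sigma k) `^ (- th))) N))).
  rewrite -psumD -psumM; apply: ler_psum => k kN; have k0 : (0 < k)%N by case/andP: kN.
  have [sk hsk] := sP kN; have sk0 : (0 < sigma k)%N by nlia.
  have pW0 : 0 <= psum (w Om) (sigma k) by apply: nonneg_psum; exact: w0.
  have aO : 0 <= alpha (sigma k) * Om (sigma k) by rewrite mulr_ge0 ?Om0.
  apply: (@le_trans _ _ (a k * Om (sigma k) * (2 `^ th * (W k `^ th +
    (alpha (sigma k) * Om (sigma k)) `^ th) * psum b (sigma k) `^ (- th)))).
    rewrite ler_wpM2l ?mulr_ge0 ?a0 ?Om0// ler_wpM2r ?powR_ge0//.
    apply: le_trans (powRD_le (ltW th0) (W0 k) aO).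
    by apply: le_powR; [exact: ltW|exact: pW0|exact: Wle].
  rewrite (powRM _ (alpha0 _) (Om0 _ sk0)) (@powRDge0 _ 1 th (Om (sigma k)) th1) powRr1 ?Om0//.
  rewrite (_ : a k * _ * _ = 2 `^ th * (W k `^ th * a k * (Om (sigma k) *
    psum b (sigma k) `^ (- th)) +
    a k * alpha (sigma k) `^ th * (Om (sigma k) * Om (sigma k) `^ th *
      psum b (sigma k) `^ (- th)))); last by ring.
  rewrite ler_pM2l ?powR_gt0// lerD2r ler_wpM2l ?mulr_ge0 ?powR_ge0 ?a0//.
  exact: (@le_rmax _ (fun i => Om i * psum b i `^ (- th))).
rewrite -mulrA ler_pM2l ?powR_gt0// mulrDr addrC; apply: lerD; last first.
  by apply: (le_trans h7); rewrite ler_peMl// lerDl ltW.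
have g0 : nonneg_seq (fun n => Om n `^ (1 + th) * psum b n `^ (- th)).
  by move=> n n0; rewrite mulr_ge0 ?powR_ge0.
apply: le_trans (alpha_pow th0 g0) _; rewrite ler_pM2l//.
apply: le_trans h6; apply: ler_psum => k kN; have k0 : (0 < k)%N by case/andP: kN.
have [sk _] := sP kN.
rewrite ler_wpM2l ?mulr_ge0 ?powR_ge0 ?a0//.
exact: (@le_rmax _ (fun i => Om i `^ (1 + th) * psum b i `^ (- th))).
Qed.

Lemma psum_between (F : nat -> R) i j : (i <= j <= N)%N ->
  psum (fun k => if (i < k <= j)%N then F k else 0) N = psum F j - psum F i.
Proof.
move=> /andP[ij jN]; have iN := leq_trans ij jN.
rewrite -(psum_upto F jN) -(psum_upto F iN).
apply/eqP; rewrite eq_sym subr_eq -psumD; apply/eqP; apply: eq_psum => k _.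
case: leqP => ki /=; last by rewrite addr0.
by rewrite (leq_trans ki ij) add0r.
Qed.

(** For each k only the increments of Phi^th on (k, sigma k] meet the mass a(k), and they add up to
    Phi(sigma k)^th - Phi(k)^th. This is why mu is required to dominate such differences. *)
Lemma partI_lt1 (Q th c1 : R) nu G Phi mu D4 D5 :
  0 < Q < 1 -> th = Q / (1 - Q) -> 0 < c1 -> hardy_rev_bound Q th c1 ->
  nonneg_seq nu -> nonneg_seq G -> nonneg_seq Phi -> nonneg_seq mu -> Phi 0%N = 0 ->
  (forall m n, (m <= n)%N -> Phi m <= Phi n) ->
  (forall k n, (0 < k < n)%N -> Phi n `^ th - Phi k `^ th <= rmax mu k.+1 n) ->
  psum (fun k => Z nu k `^ th * (rmax nu k N * a k) * Phi k `^ th) N <= D4 ->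
  psum (fun k => a k * psum a k `^ th *
    rmax (fun i => rmax nu i N `^ (1 + th) * mu i) k N) N <= D5 ->
  psum (fun k => a k * nu (sigma k) * psum (fun m => G m * Phi m) (sigma k) `^ Q) N <=
  c1 * (2 `^ (1 + th) * (1 + th)) `^ (1 - Q) * ((D4 + D5) `^ (1 - Q) * psum G N `^ Q).
Proof.
move=> Q01 thE c10 hardy nu0 G0 P0 mu0 P00 Pnd Pmu h4 h5.
have /andP[Q0 Q1] := Q01; have th0 : 0 < th by rewrite thE divr_gt0 ?subr_gt0.
have th1 : 0 < 1 + th by rewrite addr_gt0.
have c20 : 0 < 2 `^ (1 + th) * (1 + th) by rewrite mulr_gt0 ?powR_gt0.
rewrite -(sum_w nu (fun n => psum (fun m => G m * Phi m) n `^ Q)).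
apply: le_trans (hardy (w nu) G _ N (w0 nu0) G0 P0 _) _.
  by move=> m n /andP[_ mn]; exact: Pnd.
rewrite -mulrA ler_pM2l// mulrA ler_wpM2r ?powR_ge0//.
have zn0 k : (0 < k)%N -> 0 <= rmax nu k N * a k by move=> k0; rewrite mulr_ge0 ?rmax_ge0 ?a0.
have Z0 k : (0 < k)%N -> 0 <= Z nu k.
  by move=> k0; rewrite /Z big_nat; apply: sumr_ge0 => i ki; apply: zn0; nlia.
have D40 : 0 <= D4.
  by apply: le_trans h4; apply: psum_ge0 => k /andP[k0 _];
    rewrite !mulr_ge0 ?powR_ge0 ?rmax_ge0 ?a0.
have D50 : 0 <= D5.
  by apply: le_trans h5; apply: psum_ge0 => k /andP[k0 _];
    rewrite !mulr_ge0 ?powR_ge0 ?rmax_ge0 ?a0.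
pose tl n := \sum_(n <= i < N.+1) w nu i.
have tl0 n : (0 < n)%N -> 0 <= tl n.
  by move=> n0; rewrite /tl big_nat; apply: sumr_ge0 => i ni; apply: w0 => //; nlia.
rewrite -powRM ?addr_ge0 ?(ltW c20)//; apply: le_powR; first by lra.
  by apply: psum_ge0 => k /andP[k0 _]; rewrite !mulr_ge0 ?powR_ge0 ?w0.
(* Summation over the increments of Phi^th turns w tl^th Phi^th into psi tl^(1 + th), in which the
   tail [tl] can be split. *)
pose psi m := Phi m `^ th - Phi m.-1 `^ th.
have psi0 m : (0 < m)%N -> 0 <= psi m.
  move=> m0; rewrite subr_ge0; apply: le_powR; [exact: ltW| |by apply: Pnd; nlia].
  by case: m m0 => [|[|m]] //= _; [rewrite P00|exact: P0].
have psiE n : psum psi n = Phi n `^ th.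
  elim: n => [|n IH]; first by rewrite psum0 P00 powR0// gt_eqF.
  by rewrite psumS IH /psi /= addrC subrK.
have pE (x : R) : 0 <= x -> x `^ (1 + th) = x * x `^ th.
  by move=> x0; rewrite powRDge0// powRr1.
apply: (@le_trans _ _ (psum (fun m => psi m * tl m `^ (1 + th)) N)).
  rewrite (@eq_psum _ _ (fun n => psum (fun m => psi m * (w nu n * tl n `^ th)) n)); last first.
    by move=> n _; rewrite /psum -mulr_suml -/(psum psi n) psiE mulrC.
  rewrite -psum_exchange; apply: ler_psum => m /andP[m0 mN].
  rewrite -mulr_sumr ler_wpM2l ?psi0// pE ?tl0// /tl mulr_suml.
  apply: ler_sum_nat => n /andP[mn nN]; rewrite ler_wpM2l ?w0//; first by nlia.
  apply: le_powR; [exact: ltW|by apply: tl0; nlia|].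
  rewrite [leRHS](@big_cat_nat _ _ _ n) ?(ltnW nN)//= lerDr big_nat.
  by apply: sumr_ge0 => i mi; apply: w0 => //; nlia.
(* Mass in the fibre of sigma m before m: every k < m with sigma k >= m satisfies sigma k = sigma
   m. *)
pose q m := psum (fun k => if (k < m)%N && (sigma k == sigma m) then a k else 0) N.
have q0 m : 0 <= q m by apply: psum_ge0 => k /andP[k0 _]; case: ifP => // _; exact: a0.
have tl_le m : (0 < m <= N)%N -> tl m <= nu (sigma m) * q m + Z nu m.
  move=> mN; have m0 : (0 < m)%N by case/andP: mN.
  have [sm hsm] := sP mN.
  rewrite /tl tail_w// ZE// /q -psumM -psumD; apply: ler_psum => k kN.
  have k0 : (0 < k)%N by case/andP: kN.
  have [sk hsk] := sP kN.
  have t1 : 0 <= nu (sigma m) * (if (k < m)%N && (sigma k == sigma m) then a k else 0).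
    by rewrite mulr_ge0 ?nu0//; [nlia|case: ifP => // _; exact: a0].
  have t2 : 0 <= (if (m <= k)%N then rmax nu k N * a k else 0).
    by case: ifP => // _; exact: zn0.
  case: ifP => [msk|_]; last exact: addr_ge0.
  have [mk|km] := leqP m k.
    by rewrite /= mulr0 add0r mulrC ler_wpM2r ?a0//; apply: le_rmax.
  by rewrite (hsk m) ?eqxx /= ?addr0 1?mulrC//; nlia.
apply: (@le_trans _ _ (2 `^ (1 + th) * (psum (fun m => psi m * (nu (sigma m) * q m) `^ (1 + th)) N +
   psum (fun m => psi m * Z nu m `^ (1 + th)) N))).
  rewrite -psumD -psumM; apply: ler_psum => m mN; have m0 : (0 < m)%N by case/andP: mN.
  have [sm _] := sP mN.
  have t1 : 0 <= nu (sigma m) * q m by rewrite mulr_ge0 ?nu0//; nlia.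
  rewrite -mulrDr [leRHS]mulrCA ler_wpM2l ?psi0//.
  apply: le_trans (powRD_le (ltW th1) t1 (Z0 _ m0)).
  by apply: le_powR; [exact: ltW|exact: tl0|exact: tl_le].
rewrite -mulrA ler_pM2l ?powR_gt0// mulrDr addrC; apply: lerD.
  apply: (@le_trans _ _ ((1 + th) * psum (fun m => \sum_(m <=
    k < N.+1) psi m * (rmax nu k N * a k * Z nu k `^ th)) N)).
    rewrite -psumM; apply: ler_psum => m mN; have m0 : (0 < m)%N by case/andP: mN.
    rewrite -mulr_sumr mulrCA ler_wpM2l ?psi0//.
    have := tail_pow_le zn0 th1 mN; rewrite max_r; last by rewrite lerDl ltW.
    by rewrite (addrC 1) addrK.
  rewrite psum_exchange ler_pM2l//; apply: le_trans h4; apply: ler_psum => k _.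
  by rewrite /psum -mulr_suml -/(psum psi k) psiE mulrC (mulrC (Z nu k `^ th)).
have e1 : 1 <= 1 + th by rewrite lerDl ltW.
apply: (@le_trans _ _ ((1 + th) * psum (fun m => psum (fun k =>
   if (k < m)%N && (sigma k == sigma m) then psi m * nu (sigma k) `^ (1 +
     th) * (a k * psum a k `^ th) else 0) N) N)).
  rewrite -psumM; apply: ler_psum => m mN; have m0 : (0 < m)%N by case/andP: mN.
  have [sm _] := sP mN; have sm0 : (0 < sigma m)%N by nlia.
  rewrite (powRM _ (nu0 _ sm0) (q0 m)) mulrA.
  pose a' k := if (k < m)%N && (sigma k == sigma m) then a k else 0.
  have a'0 : nonneg_seq a' by move=> k k0; rewrite /a'; case: ifP => // _; exact: a0.
  have a'a k : (0 < k)%N -> a' k <= a k.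
    by move=> k0; rewrite /a'; case: ifP => // _; exact: a0.
  have := psum_pow_sub N a'0 a'a e1; rewrite -/(q m) (addrC 1) addrK => h.
  have t0 : 0 <= psi m * nu (sigma m) `^ (th + 1) by rewrite mulr_ge0 ?powR_ge0 ?psi0.
  apply: le_trans (ler_wpM2l t0 h) _; rewrite mulrCA ler_pM2l; last by rewrite addrC.
  rewrite -psumM; apply: ler_psum => k _; rewrite /a'.
  by case: ifP => [/andP[_ /eqP ->]|_]; rewrite ?mul0r ?mulr0.
rewrite psum_psum_exchange ler_pM2l//; apply: le_trans h5; apply: ler_psum => k kN.
have k0 : (0 < k)%N by case/andP: kN.
have [sk hsk] := sP kN.
(* From sigma k = sigma m follows m <= sigma k, so psi is summed over (k, sigma k]. *)
apply: (@le_trans _ _ (a k * psum a k `^ th * (nu (sigma k) `^ (1 + th) *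
    psum (fun m => if (k < m <= sigma k)%N then psi m else 0) N))).
  rewrite mulrA -psumM; apply: ler_psum => m mN; have m0 : (0 < m)%N by case/andP: mN.
  have [sm hsm] := sP mN.
  case: ifP => [/andP[km /eqP e]|_]; last first.
    by rewrite !mulr_ge0 ?powR_ge0 ?a0//; case: ifP => // _; exact: psi0.
  by rewrite km e ifT; [rewrite le_eqVlt; apply/orP; left; apply/eqP; ring|nlia].
rewrite ler_wpM2l ?mulr_ge0 ?powR_ge0 ?a0//.
rewrite psum_between// !psiE.
have [e|ne] := eqVneq (sigma k) k; first by rewrite e subrr mulr0 rmax_ge0.
apply: (@le_trans _ _ (nu (sigma k) `^ (1 + th) * rmax mu k.+1 (sigma k))).
  by rewrite ler_wpM2l ?powR_ge0// Pmu//; nlia.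
rewrite -rmaxM ?powR_ge0//; apply: rmax_le; first exact: rmax_ge0.
move=> m km; apply: le_trans (@le_rmax _ (fun i => rmax nu i N `^ (1 + th) * mu i) k N m _);
  last by nlia.
rewrite ler_wpM2r ?mu0//; first by nlia.
by apply: le_powR; [exact: ltW|apply: nu0; nlia|apply: le_rmax; nlia].
Qed.

End Linearization.

(** * Partial sums of non-increasing sequences *)

Section Decomposition.
Context {R : realType}.
Implicit Types (x b G f Phi psi : nat -> R) (p c : R).

(* Pointwise control of the partial sums of x by two nonnegative linear
   operators: a Hardy sum with nondecreasing weight Phi, and n `^ p * f n. *)
Definition sum_split p c b Phi := forall x, nonneg_seq x -> nonincr_seq x ->
  exists G f, [/\ nonneg_seq G, nonneg_seq f & nonincr_seq f] /\
   [/\ forall n, psum x n `^ p <= c * (psum (fun m => G m * Phi m) n + n%:R `^ p * f n),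
    forall N, psum G N <= c * psum (fun m => x m `^ p * b m) N &
    forall N, psum (fun m => f m * b m) N <= c * psum (fun m => x m `^ p * b m) N].

(** With X = [psum x], the increment of X^p at n is at most x(n) X(n)^(p - 1), hence at most n^(p -
    1) x(n)^p because X(n) >= n x(n) and p - 1 <= 0. Summation by parts brings in the differences of
    x^p. *)
Lemma psum_pow_concave x p n : 0 < p <= 1 -> nonneg_seq x -> nonincr_seq x ->
  psum x n `^ p <= p^-1 *
    (psum (fun m => m%:R `^ p * (x m `^ p - x m.+1 `^ p)) n + n%:R `^ p * x n.+1 `^ p).
Proof.
move=> /andP[p0 p1] x0 xni.
elim: n => [|n IH]; first by rewrite !psum0 powR0 ?gt_eqF// mul0r addr0 mulr0.
have xn0 : 0 <= x n.+1 by exact: x0.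
have h1 : psum x n.+1 `^ p - psum x n `^ p <= x n.+1 * psum x n.+1 `^ (p - 1).
  have := psum_pow_diff n x0 p0; rewrite psumSB max_l// mul1r.
  by case/andP.
have h2 : (n.+1)%:R `^ (p - 1) <= p^-1 * ((n.+1)%:R `^ p - n%:R `^ p).
  have := @powR_diff R p (n.+1)%:R n%:R p0.
  rewrite ler0n ler_nat leqnSn => /(_ isT)/andP[+ _].
  rewrite min_r// -natr1 addrC addKr mul1r => h.
  by rewrite -ler_pdivrMl ?invr_gt0// invrK.
have h3 : x n.+1 * psum x n.+1 `^ (p - 1) <= (n.+1)%:R `^ (p - 1) * x n.+1 `^ p.
  have [->|xn] := eqVneq (x n.+1) 0; first by rewrite mul0r mulr_ge0 ?powR_ge0.
  have xp : 0 < x n.+1 by rewrite lt_neqAle eq_sym xn.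
  have nx : n.+1%:R * x n.+1 <= psum x n.+1.
    have <- : psum (fun=> x n.+1) n.+1 = n.+1%:R * x n.+1.
      by rewrite /psum sumr_const_nat subSS subn0 mulr_natl.
    by apply: ler_psum => k /andP[k0 kn]; exact: xni.
  rewrite -(mulr_powRB1 (ltW xp) p0) mulrCA ler_wpM2l//.
  rewrite -powRM ?ler0n//; apply: powR_nonincr; [lra| |exact: nx].
  by rewrite mulr_gt0// ltr0n.
have h4 : (n.+1)%:R `^ (p - 1) * x n.+1 `^ p <= p^-1 * ((n.+1)%:R `^ p - n%:R `^ p) * x n.+1 `^ p.
  by rewrite ler_wpM2r ?powR_ge0.
rewrite (psumS (fun m => _ * _)).
have -> : forall A : R, p^-1 * (A + n.+1%:R `^ p * (x n.+1 `^ p - x n.+2 `^ p) +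
  n.+1%:R `^ p * x n.+2 `^ p) =
  p^-1 * (A + n%:R `^ p * x n.+1 `^ p) + p^-1 * ((n.+1)%:R `^ p - n%:R `^ p) * x n.+1 `^ p.
  by move=> A; ring.
lra.
Qed.

(** Since Phi(m) >= m^p / B(m), the m-th term of G is at most B(m) times the difference of x^p; by
    Abel summation these add up to at most the sum of x^p b. *)
Lemma sum_split_le1 p b : 0 < p <= 1 -> nonneg_seq b -> 0 < b 1%N ->
  sum_split p p^-1 b (fun n => rmax (fun j => j%:R `^ p / psum b j) 1 n).
Proof.
move=> p01 b0 b1 x x0 xni; have /andP[p0 p1] := p01.
pose Phi n := rmax (fun j => j%:R `^ p / psum b j) 1 n.
have Bp m : (0 < m)%N -> 0 < psum b m := psum_gt0 b0 b1.
have pi1 : 1 <= p^-1 by rewrite invf_ge1.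
have Phip m : (0 < m)%N -> m%:R `^ p / psum b m <= Phi m.
  by move=> m0; apply: (@le_rmax _ (fun j => j%:R `^ p / psum b j)); rewrite m0 leqnn.
have Phi0 m : (0 < m)%N -> 0 < Phi m.
  move=> m0; apply: lt_le_trans (Phip m m0).
  by rewrite divr_gt0 ?Bp// powR_gt0// ltr0n.
have dx m : (0 < m)%N -> 0 <= x m `^ p - x m.+1 `^ p.
  by move=> m0; rewrite subr_ge0; apply: le_powR; [exact: ltW|exact: x0|exact: xni].
have xb0 N : 0 <= psum (fun m => x m `^ p * b m) N.
  by apply: nonneg_psum => m m0; rewrite mulr_ge0 ?powR_ge0 ?b0.
exists (fun m => m%:R `^ p * (x m `^ p - x m.+1 `^ p) / Phi m), (fun m => x m `^ p); split; split.
- by move=> m m0; rewrite divr_ge0 ?mulr_ge0 ?powR_ge0 ?dx ?(ltW (Phi0 m m0)).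
- by move=> m _; exact: powR_ge0.
- by move=> m n m0 mn; apply: le_powR; [exact: ltW|apply: x0; lia|exact: xni].
- move=> n; apply: le_trans (psum_pow_concave n p01 x0 xni) _.
  rewrite ler_pM2l ?invr_gt0//; apply: lerD.
    apply: ler_psum => m /andP[m0 _]; rewrite divfK// gt_eqF//; exact: Phi0.
  case: n => [|n]; first by rewrite powR0 ?gt_eqF// !mul0r.
  rewrite ler_wpM2l ?powR_ge0//; apply: le_powR; [exact: ltW|exact: x0|exact: xni].
- move=> N; apply: (@le_trans _ _ (psum (fun m => x m `^ p * b m) N)); last first.
    by rewrite ler_peMl.
  apply: (@le_trans _ _ (psum (fun m => (x m `^ p - x m.+1 `^ p) * psum b m) N)).
    apply: ler_psum => m /andP[m0 _].
    rewrite mulrAC mulrC ler_wpM2l ?dx// ler_pdivrMr ?Phi0// mulrC -ler_pdivrMr ?Bp//.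
    exact: Phip.
  rewrite abel_psum; have : 0 <= x N.+1 `^ p * psum b N by rewrite mulr_ge0 ?powR_ge0 ?nonneg_psum.
  lra.
- by move=> N; rewrite ler_peMl.
Qed.

(* The summation by parts n |-> psi n * psum (G * psi) n turns the factor psi n
   into a second factor psi m under the sum, at the cost of doubling G. *)
Lemma double_weight G psi : nonneg_seq G -> (forall n, 0 <= psi n) ->
  (forall m n, (m <= n)%N -> psi m <= psi n) ->
  exists Gh, [/\ nonneg_seq Gh,
    forall n, psi n * psum (fun m => G m * psi m) n = psum (fun m => Gh m * (psi m * psi m)) n &
    forall n, psum Gh n <= 2 * psum G n].
Proof.
move=> G0 psi0 psind; pose T n := psum (fun m => G m * psi m) n.
have T0 n : 0 <= T n by apply: nonneg_psum => m m0; rewrite mulr_ge0 ?G0.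
have TE n : psi n = 0 -> T n = 0.
  move=> pn; rewrite /T /psum big_nat big1// => m /andP[_ mn].
  have -> : psi m = 0; last by rewrite mulr0.
  by apply/eqP; rewrite eq_le psi0 -pn psind.
exists (fun n => G n + T n.-1 * (psi n - psi n.-1) / (psi n * psi n)); split.
- move=> n n0; rewrite addr_ge0 ?G0// divr_ge0 ?mulr_ge0// subr_ge0.
  by apply: psind; lia.
- elim=> [|n IH]; first by rewrite !psum0 mulr0.
  rewrite (psumS (fun m => (_ + _) * _)) -IH psumS /= -/(T n).
  have [p0|p1] := eqVneq (psi n.+1) 0.
    have pn : psi n = 0 by apply/eqP; rewrite eq_le psi0 -p0 psind.
    by rewrite p0 pn TE// !(mulr0, mul0r, addr0).
  by field.
(* The extra T n / psi n closes the induction: T(n) (psi(n+1) - psi(n)) / psi(n+1)^2 is at most T(n)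
   / psi(n) - T(n) / psi(n+1). *)
suff H n : psum (fun n => G n + T n.-1 * (psi n - psi n.-1) / (psi n * psi n)) n +
  T n / psi n <= 2 * psum G n.
  move=> n; apply: le_trans (H n); rewrite lerDl divr_ge0//.
elim: n => [|n IH]; first by rewrite /T !psum0 mul0r addr0 mulr0.
rewrite psumS (psumS G) /=.
have TS : T n.+1 = T n + G n.+1 * psi n.+1 by rewrite /T psumS.
have [p0|p1] := eqVneq (psi n.+1) 0.
  have pn : psi n = 0 by apply/eqP; rewrite eq_le psi0 -p0 psind.
  have G1 : 0 <= G n.+1 by exact: G0.
  move: IH; rewrite p0 pn !(mulr0, invr0, mul0r, addr0); lra.
have pp : 0 < psi n.+1 by rewrite lt_neqAle eq_sym p1 psi0.
rewrite TS mulrDl mulfK//.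
have [pn0|pn1] := eqVneq (psi n) 0.
  move: IH; rewrite pn0 (TE n pn0) !(mulr0, invr0, mul0r, addr0, add0r); lra.
have pnp : 0 < psi n by rewrite lt_neqAle eq_sym pn1 psi0.
suff : T n * (psi n.+1 - psi n) / (psi n.+1 * psi n.+1) <= T n / psi n - T n / psi n.+1 by lra.
have -> : T n / psi n - T n / psi n.+1 = T n * (psi n.+1 - psi n) / (psi n * psi n.+1).
  by field; rewrite p1 pn1.
rewrite ler_wpM2l ?mulr_ge0 ?subr_ge0 ?psind//.
by rewrite lef_pV2 ?posrE ?mulr_gt0// ler_pM2r// psind.
Qed.

Lemma nonincr_seq_step f : (forall n, (0 < n)%N -> f n.+1 <= f n) -> nonincr_seq f.
Proof.
move=> h m n m0 /subnK <-; elim: (n - m)%N => // k IH.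
by apply: le_trans IH; rewrite addSn; apply: h; rewrite addn_gt0 m0 orbT.
Qed.

Lemma Vsum0 p b : Vsum p b 0 = 0.
Proof. by rewrite /Vsum big_geq. Qed.

Definition Vterm p b (m : nat) : R :=
  psum b m `^ (1 / (1 - p)) * b m.+1 / (m%:R `^ (p / (1 - p)) * psum b m.+1).

Lemma VsumE p b n : Vsum p b n = psum (Vterm p b) n.
Proof. by []. Qed.

Lemma Vterm_ge0 p b : nonneg_seq b -> nonneg_seq (Vterm p b).
Proof.
move=> b0 m m0.
by rewrite /Vterm divr_ge0 ?mulr_ge0 ?powR_ge0 ?nonneg_psum ?b0.
Qed.

Lemma Vsum_ge0 p b n : nonneg_seq b -> 0 <= Vsum p b n.
Proof. by move=> b0; rewrite VsumE; apply: nonneg_psum; exact: Vterm_ge0. Qed.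

Lemma Vsum_nondecr p b m n : nonneg_seq b -> (m <= n)%N -> Vsum p b m <= Vsum p b n.
Proof. by move=> b0 mn; rewrite !VsumE psum_nondecr//; exact: Vterm_ge0. Qed.

(** Mean value bound for the e-th power between 1 / B(m+1) and 1 / B(m), where B = [psum b]. *)
Lemma increment_ratio_le b m (e : R) : 0 < e -> nonneg_seq b -> 0 < b 1%N -> (0 < m)%N ->
  psum b m `^ (- e) * (b m.+1 / psum b m.+1) <=
  (Num.min 1 e)^-1 * (psum b m `^ (- e) - psum b m.+1 `^ (- e)).
Proof.
move=> e0 b0 b1 m0.
have Bp k : (0 < k)%N -> 0 < psum b k := psum_gt0 b0 b1.
have Bm := Bp m m0; have BS : 0 < psum b m.+1 by exact: Bp.
rewrite ler_pdivlMl ?min1_gt0//.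
have inv z (r : R) : 0 < z -> z^-1 `^ r = z `^ (- r).
  by move=> z0; rewrite -(powR_inv1 (ltW z0)) -powRrM mulN1r.
have := @powR_diff R e (psum b m)^-1 (psum b m.+1)^-1 e0.
rewrite invr_ge0 (ltW BS)/= lef_pV2 ?posrE// psum_nondecr// => /(_ isT)/andP[+ _].
rewrite !inv//; apply: le_trans; rewrite ler_pM2l ?min1_gt0//.
have -> : psum b m `^ (- (e - 1)) = psum b m `^ (- e) * psum b m.
  by rewrite -[X in _ = _ * X](powRr1 (ltW Bm)) -powRDpos//; congr (_ `^ _); ring.
rewrite -(psumSB b m) le_eqVlt; apply/orP; left; apply/eqP; field.
by rewrite !gt_eqF.
Qed.

(* The sequence S m / psum b m `^ p is the average of x `^ p against the
   increments of (psum b) `^ p; it dominates x `^ p. *)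
Section Averaging.
Variables (p : R) (b x : nat -> R).
Hypotheses (p1 : 1 < p) (b0 : nonneg_seq b) (b1 : 0 < b 1%N).
Hypotheses (x0 : nonneg_seq x) (xni : nonincr_seq x).

Let B := psum b.
Let dBp m := B m `^ p - B m.-1 `^ p.
Let xd m := x m `^ p * dBp m.
Let S := psum xd.
Let f m := S m / B m `^ p.
Let y m := S m `^ p^-1 / B m.
Let v := Vterm p b.
(** Normalized so that v m * eta m = m y(m) b(m+1) / B(m+1), the bound for the m-th term when y is
    summed by parts. *)
Let eta m := m%:R * y m * (m%:R `^ (p / (1 - p)) / B m `^ (1 / (1 - p))).
Let G m := v m * eta m `^ p.
Let Gam := psum (fun m => x m `^ p * b m).

Let p0 : 0 < p. Proof. exact: lt_trans p1. Qed.
Let pn0 : p != 0. Proof. by rewrite gt_eqF. Qed.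
Let pm1 : 0 < p - 1. Proof. by rewrite subr_gt0. Qed.

Let Bp m : (0 < m)%N -> 0 < B m.
Proof. exact: psum_gt0. Qed.

Let dBp0 m : 0 <= dBp m.
Proof.
rewrite subr_ge0; apply: le_powR; [exact: ltW|exact: nonneg_psum|].
by apply: psum_nondecr => //; exact: leq_pred.
Qed.

Let psum_dBp n : psum dBp n = B n `^ p.
Proof.
elim: n => [|n IH]; first by rewrite psum0 /B psum0 powR0.
by rewrite psumS IH /dBp /= addrC subrK.
Qed.

Let xd0 : nonneg_seq xd.
Proof. by move=> m _; rewrite mulr_ge0 ?powR_ge0. Qed.

Let S0 n : 0 <= S n. Proof. exact: nonneg_psum. Qed.

Let x_le n : (0 < n)%N -> x n `^ p * B n `^ p <= S n.
Proof.
move=> n0; rewrite -psum_dBp -psumM; apply: ler_psum => k /andP[k0 kn].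
by rewrite ler_wpM2r// le_powR ?(ltW p0)// ?x0// xni.
Qed.

Let f0 : nonneg_seq f.
Proof. by move=> n _; rewrite divr_ge0 ?powR_ge0. Qed.

Let yp n : (0 < n)%N -> y n `^ p = f n.
Proof.
move=> n0; rewrite powRM ?powR_ge0 ?invr_ge0 ?(ltW (Bp n0))//.
by rewrite powRVK// -(powR_inv1 (ltW (Bp n0))) -powRrM mulN1r powRN.
Qed.

Let y0 n : (0 < n)%N -> 0 <= y n.
Proof. by move=> n0; rewrite divr_ge0 ?powR_ge0// ltW ?Bp. Qed.

Let x_le_y n : (0 < n)%N -> x n <= y n.
Proof.
move=> n0; apply: (powR_leK p0); [exact: x0|exact: y0|].
by rewrite yp// ler_pdivlMr ?powR_gt0 ?Bp// x_le.
Qed.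

Let fni : nonincr_seq f.
Proof.
apply: nonincr_seq_step => n n0; have Bn := Bp n0; have BS : 0 < B n.+1 by exact: Bp.
rewrite ler_pdivrMr ?powR_gt0// /S psumS -/S.
have h : x n.+1 `^ p <= f n.
  rewrite ler_pdivlMr ?powR_gt0//; apply: le_trans (x_le n0).
  by rewrite ler_wpM2r ?powR_ge0// le_powR ?(ltW p0)// ?x0// xni.
have := ler_wpM2r (dBp0 n.+1) h; rewrite -/(xd n.+1) => h2.
rewrite (_ : f n * B n.+1 `^ p = S n + f n * dBp n.+1) ?lerD2l//.
by rewrite /f /dBp /=; field; rewrite gt_eqF ?powR_gt0.
Qed.

(** y B = S^(1/p) is non-decreasing, so y(n+1) >= y(n) B(n) / B(n+1). This control of the decrements
    by b is the gain of passing from x to y. *)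
Let y_diff n : (0 < n)%N -> y n - y n.+1 <= y n * (b n.+1 / B n.+1).
Proof.
move=> n0; have Bn := Bp n0; have BS : 0 < B n.+1 by exact: Bp.
have h : y n * B n <= y n.+1 * B n.+1.
  rewrite /y !divfK ?gt_eqF//; apply: le_powR; [by rewrite invr_ge0 ltW|exact: S0|].
  by rewrite /S psumS lerDl xd0.
have h2 : y n * B n / B n.+1 <= y n.+1 by rewrite ler_pdivrMr.
have -> : b n.+1 = B n.+1 - B n by rewrite /B psumSB.
rewrite (_ : y n * _ = y n - y n * B n / B n.+1); first by lra.
by field; rewrite gt_eqF.
Qed.

Let v_eta m : (0 < m)%N -> v m * eta m = m%:R * (y m * (b m.+1 / B m.+1)).
Proof.
move=> m0; have Bm := Bp m0; have BS : 0 < B m.+1 by exact: Bp.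
rewrite /v /Vterm /eta -/B -/(B m.+1) -/(B m); field.
by rewrite !gt_eqF ?powR_gt0// ltr0n.
Qed.

Let eta0 m : (0 < m)%N -> 0 <= eta m.
Proof.
move=> m0; rewrite /eta; apply: mulr_ge0; last by rewrite divr_ge0 ?powR_ge0.
by apply: mulr_ge0; [exact: ler0n|exact: y0].
Qed.

Let X_le n : psum x n <= psum (fun m => v m * eta m) n + n%:R * y n.
Proof.
case: n => [|n]; first by rewrite !psum0 mul0r addr0.
have E k : psum y k = psum (fun m => m%:R * (y m - y m.+1)) k + k%:R * y k.+1.
  elim: k => [|k IH]; first by rewrite !psum0 mul0r addr0.
  by rewrite !psumS IH -!natr1; ring.
apply: (@le_trans _ _ (psum y n.+1)).
  by apply: ler_psum => k /andP[k0 _]; exact: x_le_y.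
rewrite psumS E (_ : _ + _ + _ = psum (fun m => m%:R * (y m - y m.+1)) n + n.+1%:R * y n.+1);
  last by rewrite -natr1; ring.
rewrite lerD2r; apply: (@le_trans _ _ (psum (fun m => v m * eta m) n)).
  apply: ler_psum => m /andP[m0 _]; rewrite v_eta// ler_wpM2l//; exact: y_diff.
by rewrite psumS lerDl; apply: mulr_ge0; [exact: Vterm_ge0|exact: eta0].
Qed.

Let G0 : nonneg_seq G.
Proof. by move=> m m0; rewrite mulr_ge0 ?powR_ge0// Vterm_ge0. Qed.

(** All powers of m cancel because p + s p = s for s = p / (1 - p). *)
Let G_E m : (0 < m)%N -> G m = S m * (B m `^ (1 - p) * (b m.+1 / B m.+1)).
Proof.
move=> m0; have Bm := Bp m0; have BS : 0 < B m.+1 by exact: Bp.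
have mp : 0 < m%:R :> R by rewrite ltr0n.
have M0 := ltW mp; have Y0 := y0 m0; have BB0 := ltW Bm.
have p1' : 1 - p != 0 by rewrite subr_eq0 eq_sym gt_eqF.
pose s := p / (1 - p).
have es : 1 / (1 - p) = s + 1 by rewrite /s; field.
have inv (z e : R) : 0 <= z -> (z `^ e)^-1 = z `^ (- e) by move=> _; rewrite powRN.
have etap : eta m `^ p = m%:R `^ (p + s * p) * f m * B m `^ (- ((s + 1) * p)).
  have gen (M Y BB : R) : 0 < M -> 0 <= Y -> 0 < BB ->
      (M * Y * (M `^ s / BB `^ (s + 1))) `^ p = M `^ (p + s * p) * Y `^ p * BB `^ (- ((s + 1) * p)).
    move=> M1 Y1 B1; have M2 := ltW M1.
    rewrite -powRN !powRM ?mulr_ge0 ?powR_ge0// -!powRrM.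
    rewrite (powRDpos p (s * p) M1) mulNr; ring.
  by rewrite /eta es gen// yp.
rewrite /G etap /v /Vterm es -/s invfM inv// -/(B m) -/(B m.+1) /f inv ?powR_ge0//.
have e1 : m%:R `^ (p + s * p) * m%:R `^ (- s) = 1 :> R.
  rewrite -powRDpos// (_ : p + s * p - s = 0) ?powRr0//.
  by rewrite /s; field.
have e2 : B m `^ (s + 1) * (B m `^ (- p) * B m `^ (- ((s + 1) * p))) = B m `^ (1 - p).
  rewrite -!powRDpos//; congr (_ `^ _); rewrite /s; field.
  by [].
rewrite -e2.
transitivity (S m * (B m `^ (s + 1) * (B m `^ (- p) * B m `^ (- ((s +
  1) * p))) * (b m.+1 / B m.+1)) * (m%:R `^ (p + s * p) * m%:R `^ (- s))); first by ring.
by rewrite e1 mulr1.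
Qed.

Let c1 := (Num.min 1 (p - 1))^-1 * p.

(** Up to a constant, B(m)^(1 - p) b(m+1) / B(m+1) is a decrement of B^(1 - p). Summation by parts
    moves the difference to S, whose increments are at most p x^p b B^(p - 1). *)
Let G_le N : psum G N <= c1 * Gam N.
Proof.
have mn0 : 0 < Num.min 1 (p - 1) by exact: min1_gt0.
pose E m := B m `^ (1 - p).
apply: (@le_trans _ _ ((Num.min 1 (p - 1))^-1 * psum (fun m => (E m - E m.+1) * S m) N)).
  rewrite -psumM; apply: ler_psum => m /andP[m0 _].
  rewrite G_E// [leLHS]mulrC [leRHS]mulrA ler_wpM2r ?S0//.
  by have := increment_ratio_le pm1 b0 b1 m0; rewrite opprB.
rewrite /c1 -mulrA ler_pM2l ?invr_gt0// abel_psum -(psumM p).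
apply: (@le_trans _ _ (psum (fun m => E m * xd m) N)).
  by rewrite gerBl mulr_ge0 ?powR_ge0 ?S0.
apply: ler_psum => m /andP[m0 _]; have Bm := Bp m0.
rewrite /E /xd [leLHS]mulrCA [leRHS]mulrCA ler_wpM2l ?powR_ge0//.
case: m m0 Bm => // m _ Bm.
have /andP[_] := psum_pow_diff m b0 p0.
rewrite -/B -/(dBp m.+1) psumSB max_r ?(ltW p1)// => h.
apply: le_trans (ler_wpM2l (powR_ge0 _ _) h) _.
rewrite [leLHS](_ : _ = p * b m.+1 * (B m.+1 `^ (1 - p) * B m.+1 `^ (p - 1))); last by ring.
by rewrite -powRDpos// (_ : 1 - p + (p - 1) = 0) ?powRr0 ?mulr1//; ring.
Qed.

(** In f(n+1) b(n+1) the last increment of S contributes at most x^p b, and the rest, S(n) b(n+1) /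
    B(n+1)^p, is at most G n. The shift of index comes from b(m+1) in G. *)
Let f_le N : psum (fun m => f m * b m) N <= (c1 + 1) * Gam N.
Proof.
have GN0 n : 0 <= Gam n by apply: nonneg_psum => m m0; rewrite mulr_ge0 ?powR_ge0 ?b0.
suff H n : psum (fun m => f m * b m) n.+1 <= psum G n + Gam n.+1.
  rewrite mulrDl mul1r; case: N => [|N].
    by rewrite psum0 /Gam psum0 mulr0 addr0.
  apply: le_trans (H N) _; rewrite lerD2r; apply: le_trans (G_le N.+1).
  exact: psum_nondecr.
move: n; have term n : f n.+1 * b n.+1 <= (if n is 0 then 0 else G n) + x n.+1 `^ p * b n.+1.
  have BS : 0 < B n.+1 by exact: Bp.
  have SE : S n.+1 = S n + xd n.+1 by rewrite /S psumS.
  rewrite /f SE mulrDl mulrDl; apply: lerD; last first.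
    rewrite /xd ler_wpM2r ?b0// ler_pdivrMr ?powR_gt0// ler_wpM2l ?powR_ge0//.
    by rewrite /dBp gerBl powR_ge0.
  case: n BS {SE} => [|n] BS; first by rewrite /S psum0 !mul0r.
  have Bn : 0 < B n.+1 by exact: Bp.
  rewrite G_E// -mulrA ler_wpM2l// mulrC.
  have -> : b n.+2 / B n.+2 `^ p = B n.+2 `^ (1 - p) * (b n.+2 / B n.+2).
    have e : B n.+2 `^ (- p) = B n.+2 `^ (1 - p) * (B n.+2)^-1.
      by rewrite -(powR_inv1 (ltW BS)) -powRDpos//; congr (_ `^ _); ring.
    by rewrite -powRN e mulrCA.
  rewrite ler_wpM2r ?divr_ge0 ?b0 ?(ltW BS)//.
  apply: powR_nonincr => //; first by rewrite subr_le0 ltW.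
  exact: psum_nondecr.
elim=> [|n IH].
  rewrite /Gam !psumS !psum0 !add0r; have := term 0%N; lra.
rewrite psumS (psumS G) /Gam (psumS _ n.+1) -/(Gam n.+1).
have := term n.+1 => /= h; lra.
Qed.

Let V0 n : 0 <= Vsum p b n. Proof. exact: Vsum_ge0. Qed.

(** Power mean with the weights v V^(-1/2), V = [Vsum p b], whose sum is at most 2 V^(1/2). Half of
    the exponent p - 1 remains outside the sum, and [double_weight] later carries it inside. *)
Let H_le n : psum (fun m => v m * eta m) n `^ p <= 2 `^ (p - 1) *
  (Vsum p b n `^ ((p - 1) / 2) * psum (fun m => G m * Vsum p b m `^ ((p - 1) / 2)) n).
Proof.
have v0 : nonneg_seq v by exact: Vterm_ge0.
pose ww m := v m * Vsum p b m `^ (- 2^-1).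
pose yy m := eta m * Vsum p b m `^ 2^-1.
have ww0 : nonneg_seq ww by move=> m m0; rewrite mulr_ge0 ?powR_ge0 ?v0.
have yy0 : nonneg_seq yy by move=> m m0; rewrite mulr_ge0 ?powR_ge0 ?eta0.
have := psum_power_mean n (ltW p1) ww0 yy0.
have vV m : (0 < m)%N -> v m != 0 -> 0 < Vsum p b m.
  move=> m0 vm; apply: lt_le_trans (_ : v m <= _).
    by rewrite lt_neqAle eq_sym vm v0.
  by rewrite VsumE; apply: le_psum_term => //; rewrite m0 leqnn.
rewrite (@eq_psum _ (fun k => ww k * yy k) (fun m => v m * eta m)); last first.
  move=> m /andP[m0 _]; rewrite /ww /yy.
  have [->|vm] := eqVneq (v m) 0; first by rewrite !mul0r.
  have Vm := vV m m0 vm.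
  rewrite powRN; field; rewrite gt_eqF// powR_gt0//.
rewrite (@eq_psum _ (fun k => ww k * yy k `^ p) (fun m => G m * Vsum p b m `^ ((p - 1) / 2)));
  last first.
  move=> m /andP[m0 _]; rewrite /ww /yy /G.
  have [->|vm] := eqVneq (v m) 0; first by rewrite !mul0r.
  have Vm := vV m m0 vm.
  rewrite powRM ?eta0 ?powR_ge0// -powRrM.
  have -> : (p - 1) / 2 = - 2^-1 + 2^-1 * p by field.
  by rewrite powRDpos//; ring.
move/le_trans; apply; rewrite mulrA ler_wpM2r//.
  by apply: nonneg_psum => m m0; rewrite mulr_ge0 ?G0 ?powR_ge0.
have -> : (p - 1) / 2 = 2^-1 * (p - 1) by rewrite mulrC.
rewrite powRrM -powRM ?powR_ge0//; apply: le_powR; [exact: ltW|exact: nonneg_psum|].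
have h2 : 0 < 2^-1 :> R by rewrite invr_gt0.
have := psum_pow_ge n v0 h2; rewrite min_r; last by rewrite invf_le1 ?ler1n.
rewrite -VsumE (_ : 2^-1 - 1 = - 2^-1 :> R); last by field.
rewrite (@eq_psum _ (fun k => v k * psum v k `^ (- 2^-1)) ww)//.
by rewrite ler_pdivrMl.
Qed.

Lemma sum_split_gt1_aux : exists Gh f, [/\ nonneg_seq Gh, nonneg_seq f & nonincr_seq f] /\
  [/\ forall n, psum x n `^ p <= 2 `^ p * 2 `^ p *
         (psum (fun m => Gh m * Vsum p b m `^ (p - 1)) n + n%:R `^ p * f n),
      forall N, psum Gh N <= 2 * (c1 + 1) * Gam N &
      forall N, psum (fun m => f m * b m) N <= 2 * (c1 + 1) * Gam N].
Proof.
have c10 : 0 < c1 by rewrite mulr_gt0// invr_gt0 min1_gt0.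
have GN0 n : 0 <= Gam n by apply: nonneg_psum => m m0; rewrite mulr_ge0 ?powR_ge0 ?b0.
pose psi n := Vsum p b n `^ ((p - 1) / 2).
have psi0 n : 0 <= psi n by exact: powR_ge0.
have psind m n : (m <= n)%N -> psi m <= psi n.
  by move=> mn; apply: le_powR; [rewrite divr_ge0// ltW|exact: V0|exact: Vsum_nondecr].
have [Gh [Gh0 GhE Gh_le]] := double_weight G0 psi0 psind.
have psi2 m : psi m * psi m = Vsum p b m `^ (p - 1).
  have h : (p - 1) / 2 + (p - 1) / 2 = p - 1 by field.
  by rewrite /psi -powRDge0 h.
exists Gh, f; split; split=> //.
- move=> n; have H0 : 0 <= psum (fun m => v m * eta m) n.
    by apply: nonneg_psum => m m0; rewrite mulr_ge0 ?eta0// Vterm_ge0.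
  have Y0 : 0 <= n%:R * y n.
    by case: n {H0} => [|n]; rewrite ?mul0r// mulr_ge0 ?y0.
  apply: le_trans (le_powR (ltW p0) _ (X_le n)) _; first exact: nonneg_psum.
  apply: le_trans (powRD_le (ltW p0) H0 Y0) _.
  rewrite -mulrA ler_pM2l ?powR_gt0// mulrDr; apply: lerD.
    apply: le_trans (H_le n) _; rewrite -/(psi n) GhE.
    rewrite (@eq_psum _ (fun m => Gh m * (psi m * psi m)) (fun m => Gh m *
      Vsum p b m `^ (p - 1))); last by move=> m _; rewrite psi2.
    apply: ler_wpM2r; first by apply: nonneg_psum => m m0; rewrite mulr_ge0 ?powR_ge0 ?Gh0.
    by apply: ler_powR; rewrite ?ler1n// gerBl.
  case: n {H0 Y0} => [|n]; first by rewrite !mul0r powR0// !mul0r mulr0.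
  rewrite powRM ?y0// yp// -[leLHS]mul1r; apply: ler_wpM2r.
    by apply: mulr_ge0; [exact: powR_ge0|exact: f0].
  have h : 2 <= 2 `^ p :> R by rewrite le1r_powR ?ler1n// ltW.
  by apply: le_trans h; rewrite ler1n.
- move=> N; apply: le_trans (Gh_le N) _; rewrite -mulrA ler_pM2l//.
  by apply: le_trans (G_le N) _; rewrite ler_wpM2r// lerDl.
- move=> N; apply: le_trans (f_le N) _; rewrite ler_wpM2r//.
  by rewrite ler_peMl ?ler1n// addr_ge0 ?(ltW c10).
Qed.

End Averaging.

Lemma sum_split_gt1 p : 1 < p -> exists2 c, 0 < c & forall b,
  nonneg_seq b -> 0 < b 1%N -> sum_split p c b (fun n => Vsum p b n `^ (p - 1)).
Proof.
move=> p1; have m0 : 0 < Num.min 1 (p - 1) by rewrite min1_gt0// subr_gt0.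
pose c1 := (Num.min 1 (p - 1))^-1 * p.
have c10 : 0 < c1 by rewrite mulr_gt0 ?invr_gt0// (lt_trans _ p1).
exists (2 `^ p * 2 `^ p + 2 * (c1 + 1)).
  by rewrite addr_gt0 ?mulr_gt0 ?powR_gt0 ?addr_gt0.
move=> b b0 b1 x x0 xni.
have [G [f [[G0 f0 fni] [h1 h2 h3]]]] := sum_split_gt1_aux p1 b0 b1 x0 xni.
have GN0 n : 0 <= psum (fun m => x m `^ p * b m) n.
  by apply: nonneg_psum => m m0'; rewrite mulr_ge0 ?powR_ge0 ?b0.
exists G, f; split; split=> //.
- move=> n; apply: le_trans (h1 n) _; apply: ler_wpM2r.
    rewrite addr_ge0//; first by apply: nonneg_psum => m m0'; rewrite mulr_ge0 ?powR_ge0 ?G0.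
    case: n => [|n]; last by rewrite mulr_ge0 ?powR_ge0 ?f0.
    by rewrite powR0 ?mul0r// gt_eqF// (lt_trans _ p1).
  by rewrite lerDl mulr_ge0 ?addr_ge0 ?(ltW c10).
- move=> N; apply: le_trans (h2 N) _; apply: ler_wpM2r => //.
  by rewrite lerDr mulr_ge0 ?powR_ge0.
- move=> N; apply: le_trans (h3 N) _; apply: ler_wpM2r => //.
  by rewrite lerDr mulr_ge0 ?powR_ge0.
Qed.

End Decomposition.

Section SupTestRev.
Context {R : realType}.

Lemma sup_test_rev (Q th C : R) (w kappa : nat -> R) N : 0 < Q < 1 -> th = Q / (1 - Q) -> 0 <= C ->
  nonneg_seq w -> nonneg_seq kappa ->
  (forall d, nonneg_seq d ->
    psum (fun n => w n * rmax (fun k => (d k * kappa k) `^ Q) 1 n) N <=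
    C * psum d N `^ Q) ->
  psum (fun n => w n * (\sum_(n <= k < N.+1) w k) `^ th * rmax (fun k => kappa k `^ th) 1 n) N <=
  2 * 2 `^ th * (2 * C) `^ (1 + th).
Proof.
move=> Q01 thE C0 w0 k0 H; have /andP[Q0 Q1] := Q01.
have th0 : 0 < th by rewrite thE divr_gt0 ?subr_gt0.
have := @sup_test R Q th C (rev_seq N w) (rev_seq N kappa) N Q01 thE C0
  (rev_seq_ge0 N w0) (rev_seq_ge0 N k0) _.
rewrite -(psum_rev_seqN N (fun n => w n * _ `^ th * _)) => h.
apply: le_trans (h _).
  rewrite le_eqVlt; apply/orP; left; apply/eqP; apply: eq_psum => n nN.
  have nN' : (n <= N)%N by case/andP: nN.
  rewrite !rev_seqE// psum_rev_seq//; congr (_ * _).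
  rewrite -(rmax_rev_seq nN); last by move=> k _; exact: powR_ge0.
  by apply: eq_big_nat => k /andP[_ kN]; rewrite ltnS in kN; rewrite !rev_seqE.
move=> d d0; have := H (rev_seq N d) (rev_seq_ge0 N d0).
rewrite psum_rev_seqN; apply: le_trans.
rewrite -[leRHS]psum_rev_seqN le_eqVlt; apply/orP; left; apply/eqP; apply: eq_psum => n nN.
have nN' : (n <= N)%N by case/andP: nN.
rewrite !rev_seqE//; congr (_ * _).
rewrite -(rmax_rev_seq nN); last by move=> k _; exact: powR_ge0.
apply: eq_big_nat => k /andP[nk kN]; rewrite ltnS in kN.
rewrite !rev_seqE//; last by lia.
by rewrite (_ : N.+1 - (N.+1 - k) = k)%N//; lia.
Qed.

End SupTestRev.

(** * Test sequences *)

Section Tests.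
Context {R : realType}.
Implicit Types (a b u x d : nat -> R) (p q C c : R).

Lemma le_psum_termN (F : nat -> R) N k : (forall j, (0 < j <= N)%N -> 0 <= F j) ->
  (0 < k <= N)%N -> F k <= psum F N.
Proof.
move=> F0 kN; have /andP[_ kN'] := kN; rewrite -(psum_upto F (leqnn N)).
have := @le_psum_term R (fun j => if (j <= N)%N then F j else 0) N k _ kN.
by rewrite /= kN'; apply => j j0; case: ifP => // jN; apply: F0; exact/andP.
Qed.

(** As x is supported in [1, N], the right side is complete and only the left side is truncated. *)
Definition trunc_ineq p q C a b u N := forall x, nonneg_seq x -> nonincr_seq x ->
  (forall m, (N < m)%N -> x m = 0) ->
  psum (fun k => a k * rmax (fun i => u i * psum x i) k N `^ q) N <=
  C `^ q * psum (fun m => x m `^ p * b m) N `^ (q / p).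

(** Normalized test sequences e k, with [lam k i] recording how large their partial sums are. *)
Definition test_family p b N (lam : nat -> nat -> R) :=
  exists e : nat -> nat -> R, forall k, (0 < k <= N)%N ->
  [/\ nonneg_seq (e k) /\ nonincr_seq (e k), (forall m, (N < m)%N -> e k m = 0),
      psum (fun m => e k m `^ p * b m) N <= 1 &
      forall i, (0 < i)%N -> lam k i <= psum (e k) i `^ p].

(** For the maximum x of the sequences d(k)^(1/p) e k, x^p is at most the sum of d(k) (e k)^p, so
    the right side is controlled by the sum of d, while [psum x] dominates the partial sums of each
    member. *)
Lemma test_family_sup p q C a b u N lam : 0 < p -> 0 < q -> nonneg_seq b ->
  trunc_ineq p q C a b u N -> test_family p b N lam ->
  forall d, nonneg_seq d -> exists X : nat -> R,
  [/\ nonneg_seq X, (forall i j, (i <= j)%N -> X i <= X j),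
      (forall k i, (0 < k <= N)%N -> (0 < i)%N -> d k * lam k i <= X i `^ p) &
      psum (fun k => a k * rmax (fun i => u i * X i) k N `^ q) N <=
      C `^ q * psum d N `^ (q / p)].
Proof.
move=> p0 q0 b0 H [e eP] d d0.
pose x m := if (m <= N)%N then rmax (fun k => d k `^ p^-1 * e k m) 1 N else 0.
have x0 : nonneg_seq x by move=> m _; rewrite /x; case: ifP => // _; exact: rmax_ge0.
have xni : nonincr_seq x.
  move=> m n m0 mn; rewrite /x; case: ifP => nN; last by case: ifP => // _; exact: rmax_ge0.
  rewrite (leq_trans mn nN); apply: le_rmax2 => k kN; rewrite ler_wpM2l ?powR_ge0//.
  by have [[_ h] _ _ _] := eP k kN; apply: h.
have xs m : (N < m)%N -> x m = 0 by rewrite /x ltnNge => /negbTE ->.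
have xge k m : (0 < k <= N)%N -> d k `^ p^-1 * e k m <= x m.
  move=> kN; rewrite /x; case: leqP => mN; first exact: (@le_rmax _ (fun k => d k `^ p^-1 * e k m)).
  by have [_ h _ _] := eP k kN; rewrite h// mulr0.
exists (psum x); split.
- by move=> i _; exact: nonneg_psum.
- by move=> i j ij; exact: psum_nondecr.
- move=> k i kN i0; have [[e0 _] _ _ h] := eP k kN.
  have dk0 : 0 <= d k by apply: d0; case/andP: kN.
  apply: le_trans (ler_wpM2l dk0 (h i i0)) _.
  apply: (@le_trans _ _ ((d k `^ p^-1 * psum (e k) i) `^ p)).
    by rewrite powRM ?powR_ge0 ?nonneg_psum// powRVK ?gt_eqF// ler_wpM2l.
  apply: le_powR; [exact: ltW|by rewrite mulr_ge0 ?powR_ge0 ?nonneg_psum|].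
  by rewrite -psumM; apply: ler_psum => m _; exact: xge.
apply: le_trans (H x x0 xni xs) _; rewrite ler_wpM2l ?powR_ge0//.
apply: le_powR; first by rewrite divr_ge0 ?ltW.
  by apply: nonneg_psum => m m0; rewrite mulr_ge0 ?powR_ge0 ?b0.
apply: (@le_trans _ _ (psum (fun m => psum (fun k => d k * (e k m `^ p * b m)) N) N)).
  apply: ler_psum => m /andP[m0 mN]; rewrite /x mN.
  have dp k : (0 < k <= N)%N -> 0 <= d k * (e k m `^ p * b m).
    by move=> /andP[k0 _]; rewrite !mulr_ge0 ?powR_ge0 ?d0 ?b0.
  rewrite rmax_powR//; last first.
    by move=> k kN; have [[h _] _ _ _] := eP k kN; rewrite mulr_ge0 ?powR_ge0 ?h.
  rewrite mulrC -rmaxM ?b0//; apply: rmax_le; first exact: psum_ge0.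
  move=> k kN; have [[h _] _ _ _] := eP k kN.
  have dk0 : 0 <= d k by apply: d0; case/andP: kN.
  rewrite powRM ?powR_ge0 ?h// powRVK ?gt_eqF//.
  rewrite (_ : b m * _ = d k * (e k m `^ p * b m)); last by ring.
  exact: (@le_psum_termN (fun k => d k * (e k m `^ p * b m))).
rewrite psum_psum_exchange; apply: ler_psum => k kN; rewrite psumM.
have [_ _ h _] := eP k kN.
by rewrite -[leRHS]mulr1 ler_wpM2l ?d0//; case/andP: kN.
Qed.

Lemma test_family_ind p b N : 0 < p -> nonneg_seq b -> 0 < b 1%N ->
  test_family p b N (fun k i => (minn i k)%:R `^ p / psum b k).
Proof.
move=> p0 b0 b1.
have Bp m : (0 < m)%N -> 0 < psum b m := psum_gt0 b0 b1.
exists (fun k m => if (m <= k)%N then psum b k `^ (- p^-1) else 0) => k /andP[k0 kN].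
have Bk := Bp k k0.
have Bpow : (psum b k `^ (- p^-1)) `^ p = (psum b k)^-1.
  by rewrite -powRrM mulNr mulVf ?gt_eqF// powR_inv1 ?ltW.
split.
- split; first by move=> m _; case: ifP => // _; exact: powR_ge0.
  move=> m n m0 mn; case: ifP => nk; last by case: ifP => // _; exact: powR_ge0.
  by rewrite (leq_trans mn nk).
- by move=> m Nm; rewrite ifF//; apply/negbTE; rewrite -ltnNge (leq_ltn_trans kN).
- rewrite (@eq_psum _ _ (fun m => if (m <= k)%N then (psum b k)^-1 * b m else 0)).
    by rewrite psum_upto// psumM mulVf ?gt_eqF.
  by move=> m _; case: ifP => _; rewrite ?Bpow// powR0 ?gt_eqF// mul0r.
move=> i i0.
rewrite (_ : psum _ i = (minn i k)%:R * psum b k `^ (- p^-1)).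
  by rewrite powRM ?powR_ge0// Bpow.
have [ik|ki] := leqP i k.
  rewrite (@eq_psum _ _ (fun=> psum b k `^ (- p^-1))).
    by rewrite /psum sumr_const_nat subSS subn0 mulr_natl.
  by move=> m /andP[_ mi]; rewrite (leq_trans mi ik).
by rewrite psum_upto ?(ltnW ki)// /psum sumr_const_nat subSS subn0 mulr_natl.
Qed.

Let bh b m : R := b m.+1 / psum b m.+1.

(* Power mean with the weights bh * B `^ (- 1 / (2 (p - 1))): a dual Hardy inequality. *)
Lemma dual_test_norm p b t k N : 1 < p -> nonneg_seq b -> 0 < b 1%N -> nonneg_seq t -> (k <= N)%N ->
  psum (fun i => (\sum_(i <= m < k.+1) t m * bh b m) `^ p * b i) N <=
  (Num.min 1 (2 * (p - 1))^-1)^-1 `^ (p - 1) * 2 *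
    psum (fun m => t m `^ p * psum b m * bh b m) k.
Proof.
move=> p1 b0 b1 t0 kN.
have p0 : 0 < p by exact: lt_trans p1.
have pm1 : 0 < p - 1 by rewrite subr_gt0.
have Bp m : (0 < m)%N -> 0 < psum b m := psum_gt0 b0 b1.
(* The exponent satisfies g (p - 1) = 1/2: the power mean leaves the factor B^(-1/2), and the sum of
   b B^(-1/2) is at most 2 B^(1/2). *)
pose g : R := (2 * (p - 1))^-1.
have g0 : 0 < g by rewrite invr_gt0 mulr_gt0.
set K := (Num.min 1 g)^-1.
have K0 : 0 < K by rewrite invr_gt0 min1_gt0.
have bh0 m : (0 < m)%N -> 0 <= bh b m.
  by move=> m0; rewrite divr_ge0 ?b0 ?nonneg_psum.
have tailb i : (0 < i)%N -> \sum_(i <= m < k.+1) psum b m `^ (- g) * bh b m <=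
  K * psum b i `^ (- g).
  move=> i0; have [ik|ki] := leqP i k; last first.
    by rewrite big_geq// mulr_ge0 ?powR_ge0// ltW.
  apply: (@le_trans _ _ (\sum_(i <= m < k.+1) K * (psum b m `^ (- g) - psum b m.+1 `^ (- g)))).
    apply: ler_sum_nat => m /andP[im _]; apply: increment_ratio_le => //; lia.
  rewrite -mulr_sumr ler_pM2l//.
  rewrite -(opprK (\sum_(_ <= _ < _) _)) -sumrN.
  rewrite (eq_bigr (fun m => psum b m.+1 `^ (- g) - psum b m `^ (- g))); last by move=> m _;
    rewrite opprB.
  by rewrite telescope_sumr 1?leqW// opprB gerBl powR_ge0.
have gp : g * (p - 1) = 2^-1 by rewrite /g; field; rewrite gt_eqF.
have step i : (0 < i <= N)%N -> (\sum_(i <= m < k.+1) t m * bh b m) `^ p * b i <=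
    K `^ (p - 1) * (b i * psum b i `^ (- 2^-1) * \sum_(i <=
      m < k.+1) t m `^ p * psum b m `^ 2^-1 * bh b m).
  move=> /andP[i0 iN].
  pose ww m := if (i <= m)%N then psum b m `^ (- g) * bh b m else 0.
  pose yy m := t m * psum b m `^ g.
  have ww0 : nonneg_seq ww.
    by move=> m m0; rewrite /ww; case: ifP => // _; apply: mulr_ge0; [exact: powR_ge0|exact: bh0].
  have yy0 : nonneg_seq yy by move=> m m0; rewrite mulr_ge0 ?powR_ge0 ?t0.
  have := psum_power_mean k (ltW p1) ww0 yy0.
  have -> : psum (fun m => ww m * yy m) k = \sum_(i <= m < k.+1) t m * bh b m.
    rewrite sum_tail//; apply: eq_psum => m /andP[m0 _]; rewrite /ww /yy.
    case: ifP => _; last by rewrite mul0r.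
    have Bm := Bp m m0; rewrite powRN; field; rewrite gt_eqF// powR_gt0//.
  have -> : psum (fun m => ww m * yy m `^ p) k = \sum_(i <=
    m < k.+1) t m `^ p * psum b m `^ 2^-1 * bh b m.
    rewrite sum_tail//; apply: eq_psum => m /andP[m0 _]; rewrite /ww /yy.
    case: ifP => _; last by rewrite mul0r.
    have Bm := Bp m m0; rewrite powRM ?t0 ?powR_ge0// -powRrM -gp.
    rewrite (_ : g * (p - 1) = - g + g * p); last by ring.
    by rewrite powRDpos//; ring.
  have -> : psum ww k = \sum_(i <= m < k.+1) psum b m `^ (- g) * bh b m by rewrite sum_tail.
  move=> h; rewrite mulrC.
  apply: le_trans (ler_wpM2l (b0 i i0) h) _.
  rewrite [leLHS]mulrA [leRHS]mulrA; apply: ler_wpM2r.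
    rewrite big_nat; apply: sumr_ge0 => m /andP[im _].
    by apply: mulr_ge0; [rewrite mulr_ge0 ?powR_ge0|apply: bh0; lia].
  rewrite [leRHS]mulrCA ler_wpM2l ?b0//.
  apply: (@le_trans _ _ ((K * psum b i `^ (- g)) `^ (p - 1))).
    apply: le_powR; [exact: ltW| |exact: tailb].
    rewrite big_nat; apply: sumr_ge0 => m /andP[im _].
    by apply: mulr_ge0; [exact: powR_ge0|apply: bh0; lia].
  by rewrite powRM ?powR_ge0 ?(ltW K0)// -powRrM mulNr gp.
apply: (@le_trans _ _ (K `^ (p - 1) * psum (fun i => b i * psum b i `^ (- 2^-1) *
    \sum_(i <= m < k.+1) t m `^ p * psum b m `^ 2^-1 * bh b m) N)).
  by rewrite -psumM; apply: ler_psum => i iN; exact: step.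
rewrite -mulrA ler_pM2l ?powR_gt0//.
have -> : psum (fun i => b i * psum b i `^ (- 2^-1) *
    \sum_(i <= m < k.+1) t m `^ p * psum b m `^ 2^-1 * bh b m) N =
   psum (fun i => \sum_(i <= m < k.+1) b i * psum b i `^ (- 2^-1) *
    (t m `^ p * psum b m `^ 2^-1 * bh b m)) k.
  rewrite -(psum_upto _ kN); apply: eq_psum => i _; case: leqP => ik.
    by rewrite mulr_sumr.
  by rewrite big_geq// mulr0.
rewrite psum_exchange -psumM; apply: ler_psum => m /andP[m0 mk].
rewrite /psum -mulr_suml -!/(psum _ _).
have h2 : 0 < 2^-1 :> R by rewrite invr_gt0.
have := psum_pow_ge m b0 h2; rewrite min_r; last by rewrite invf_le1 ?ler1n.
rewrite (_ : 2^-1 - 1 = - 2^-1 :> R); last by field.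
rewrite ler_pdivrMl// => h3.
have nn : 0 <= t m `^ p * psum b m `^ 2^-1 * bh b m by apply: mulr_ge0;
  [rewrite mulr_ge0 ?powR_ge0|exact: bh0].
apply: le_trans (ler_wpM2r nn h3) _.
have Bm := Bp m m0.
have e2 : psum b m = psum b m `^ 2^-1 * psum b m `^ 2^-1.
  by rewrite -powRDpos// (_ : 2^-1 + 2^-1 = 1) ?powRr1 ?(ltW Bm)//; field.
rewrite [in leRHS]e2 le_eqVlt; apply/orP; left; apply/eqP; ring.
Qed.

(** Summing v(m) / m over i <= m restores v(m), so the partial sums of x k reach V(k), while the
    dual Hardy inequality bounds the sum of its p-th powers against b by c V(k). Normalizing leaves
    V^p / (c V). *)
Lemma test_family_V p : 1 < p -> exists2 c, 0 < c & forall b N,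
  nonneg_seq b -> 0 < b 1%N ->
  test_family p b N (fun k i => if (k <= i)%N then c^-1 * Vsum p b k `^ (p - 1) else 0).
Proof.
move=> p1; have p0 : 0 < p by exact: lt_trans p1.
have pm1 : 0 < p - 1 by rewrite subr_gt0.
pose c : R := (Num.min 1 (2 * (p - 1))^-1)^-1 `^ (p - 1) * 2.
have c0 : 0 < c by rewrite mulr_gt0 ?powR_gt0 ?invr_gt0 ?min1_gt0 ?invr_gt0 ?mulr_gt0.
exists c => // b N b0 b1.
have Bp m : (0 < m)%N -> 0 < psum b m := psum_gt0 b0 b1.
have p1' : 1 - p != 0 by rewrite subr_eq0 eq_sym gt_eqF.
pose s := p / (1 - p).
have es : 1 / (1 - p) = s + 1 by rewrite /s; field.
(* v(m) / m is written as t(m) b(m+1) / B(m+1), the form required by [dual_test_norm]. *)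
pose t m : R := m%:R `^ (- (s + 1)) * psum b m `^ (s + 1).
have t0 : nonneg_seq t by move=> m _; rewrite mulr_ge0 ?powR_ge0.
have bh0 m : (0 < m)%N -> 0 <= bh b m.
  by move=> m0; rewrite divr_ge0 ?b0 ?nonneg_psum.
have vE m : (0 < m)%N -> Vterm p b m = m%:R * (t m * bh b m).
  move=> m0; rewrite /Vterm es -/s /t /bh.
  have mp : 0 < m%:R :> R by rewrite ltr0n.
  have -> : m%:R `^ (- (s + 1)) = m%:R `^ (- s) / m%:R :> R.
    by rewrite opprD powRDpos// powR_inv1// ltW.
  rewrite powRN; field.
  by rewrite !gt_eqF ?powR_gt0 ?Bp.
have vE2 m : (0 < m)%N -> t m `^ p * psum b m * bh b m = Vterm p b m.
  move=> m0; rewrite vE// mulrA; congr (_ * _); rewrite /t.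
  have mp : 0 < m%:R :> R by rewrite ltr0n.
  have Bm := Bp m m0.
  rewrite powRM ?powR_ge0// -!powRrM.
  rewrite (_ : - (s + 1) * p = 1 + - (s + 1)); last by rewrite /s; field.
  rewrite (powRDpos 1) // powRr1 ?(ltW mp)//.
  rewrite (_ : (s + 1) * p = (s + 1) - 1); last by rewrite /s; field.
  rewrite (powRDpos (s + 1) (-1)) // powR_inv1 ?(ltW Bm)//; field.
  by rewrite gt_eqF.
pose x k i := \sum_(i <= m < k.+1) t m * bh b m.
have x0 k : nonneg_seq (x k).
  move=> i i0; rewrite /x big_nat; apply: sumr_ge0 => m /andP[im _].
  by apply: mulr_ge0; [apply: t0; lia|apply: bh0; lia].
have xV k i : (k <= i)%N -> Vsum p b k <= psum (x k) i.
  move=> ki; apply: (@le_trans _ _ (psum (x k) k)); last exact: psum_nondecr.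
  rewrite /x psum_exchange VsumE; apply: ler_psum => m /andP[m0 _].
  by rewrite vE// /psum sumr_const_nat subSS subn0 mulr_natl.
exists (fun k i => (c * Vsum p b k) `^ (- p^-1) * x k i) => k /andP[k0 kN].
have V0 : 0 <= Vsum p b k by exact: Vsum_ge0.
split.
- split; first by move=> i i0; rewrite mulr_ge0 ?powR_ge0 ?x0.
  move=> i j i0 ij; rewrite ler_wpM2l ?powR_ge0// /x.
  have [jk|kj] := leqP j k; last first.
    by rewrite [leLHS]big_geq// -/(x k i) x0.
  rewrite [leRHS](@big_cat_nat _ _ _ j)//=; last by rewrite leqW.
  rewrite lerDr big_nat; apply: sumr_ge0 => m /andP[im _].
  by apply: mulr_ge0; [apply: t0; lia|apply: bh0; lia].
- by move=> m Nm; rewrite /x big_geq ?mulr0// (leq_ltn_trans kN).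
- rewrite (@eq_psum _ _ (fun i => ((c * Vsum p b k) `^ (- p^-1)) `^ p * (x k i `^ p * b i)));
  last first.
    by move=> i /andP[i0 _]; rewrite powRM ?powR_ge0 ?x0// mulrA.
  (* For V = 0 the negative power of 0 is 0, so the test sequence is identically 0. *)
  rewrite psumM; have [V00|Vn] := eqVneq (Vsum p b k) 0.
    by rewrite V00 mulr0 powR0 ?oppr_eq0 ?invr_eq0 ?gt_eqF// powR0 ?gt_eqF// mul0r.
  have Vp : 0 < Vsum p b k by rewrite lt_neqAle eq_sym Vn V0.
  rewrite -powRrM mulNr mulVf ?gt_eqF// powR_inv1; last by rewrite mulr_ge0// ltW.
  have cV : 0 < c * Vsum p b k by exact: mulr_gt0.
  rewrite (ler_pdivrMl _ _ cV) mulr1.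
  have := dual_test_norm p1 b0 b1 t0 kN; rewrite -/c -/(x k) => /le_trans; apply.
  rewrite ler_pM2l// VsumE le_eqVlt; apply/orP; left; apply/eqP.
  by apply: eq_psum => m /andP[m0 _]; exact: vE2.
move=> i i0; case: ifP => ki; last exact: powR_ge0.
rewrite psumM; have [V00|Vn] := eqVneq (Vsum p b k) 0.
  by rewrite V00 (powR0 (x := p - 1)) ?gt_eqF// mulr0 powR_ge0.
have Vp : 0 < Vsum p b k by rewrite lt_neqAle eq_sym Vn V0.
have cV0 : 0 <= c * Vsum p b k by rewrite mulr_ge0 ?(ltW c0).
rewrite powRM ?powR_ge0 ?nonneg_psum//.
rewrite -powRrM mulNr mulVf ?gt_eqF// powR_inv1//.
have -> : (c * Vsum p b k)^-1 = c^-1 * (Vsum p b k)^-1 by rewrite invfM.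
rewrite -[leRHS]mulrA ler_pM2l ?invr_gt0//.
rewrite ler_pdivlMl// mulr_powRB1 ?(ltW Vp)//; apply: le_powR; [exact: ltW|exact: V0|exact: xV].
Qed.

End Tests.

(** * The truncated inequality *)

Section Finite.
Context {R : realType}.
Implicit Types (a b u x d Phi mu : nat -> R) (p q c C K : R).

Definition unu q u i : R := u i `^ q.
Definition uOm q u i : R := u i `^ q * i%:R `^ q.
Definition Zfin q a u N n : R := \sum_(n <= i < N.+1) rmax (unu q u) i N * a i.
Definition Wfin q a u n : R := psum (fun i => a i * rmax (uOm q u) i n) n.

Lemma unu_ge0 q u : nonneg_seq (unu q u).
Proof. by move=> i _; exact: powR_ge0. Qed.

Lemma uOm_ge0 q u : nonneg_seq (uOm q u).
Proof. by move=> i _; rewrite mulr_ge0 ?powR_ge0. Qed.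

Lemma Wfin_ge0 q a u n : nonneg_seq a -> 0 <= Wfin q a u n.
Proof. by move=> a0; apply: psum_ge0 => i /andP[i0 _]; rewrite mulr_ge0 ?rmax_ge0 ?a0. Qed.

Lemma Zfin_ge0 q a u N n : nonneg_seq a -> (0 < n)%N -> 0 <= Zfin q a u N n.
Proof.
move=> a0 n0; rewrite /Zfin big_nat; apply: sumr_ge0 => i /andP[ni _].
by rewrite mulr_ge0 ?rmax_ge0// a0//; nlia.
Qed.

(* After linearizing the supremum, the splitting of the partial sums of x
   reduces the inequality to a Hardy inequality and a dual one. *)
Lemma linearized_bound p q c a b u Phi N x : 0 < p -> 0 < q -> 0 < c ->
  nonneg_seq a -> nonneg_seq b -> nonneg_seq u -> nonneg_seq Phi ->
  sum_split p c b Phi -> nonneg_seq x -> nonincr_seq x ->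
  exists sigma G f,
  [/\ nonneg_seq G, nonneg_seq f & nonincr_seq f] /\
  [/\ (forall k, (0 < k <= N)%N -> (k <= sigma k <= N)%N /\
         forall k', (k <= k' <= sigma k)%N -> sigma k' = sigma k),
      psum G N <= c * psum (fun m => x m `^ p * b m) N,
      psum (fun m => f m * b m) N <= c * psum (fun m => x m `^ p * b m) N &
      psum (fun k => a k * rmax (fun i => u i * psum x i) k N `^ q) N <=
      c `^ (q / p) * 2 `^ (q / p) * (
       psum (fun k => a k * unu q u (sigma k) * psum (fun m => G m *
         Phi m) (sigma k) `^ (q / p)) N +
       psum (fun k => a k * uOm q u (sigma k) * f (sigma k) `^ (q / p)) N)].
Proof.
move=> p0 q0 c0 a0 b0 u0 P0 split x0 xni.
have y0 : nonneg_seq (fun i => u i * psum x i).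
  by move=> i i0; rewrite mulr_ge0 ?u0 ?nonneg_psum.
have [sigma sP] := linearize_sup N y0.
have [G [f [[G0 f0 fni] [h1 h2 h3]]]] := split x x0 xni.
have Qge0 : 0 <= q / p by rewrite divr_ge0 ?ltW.
exists sigma, G, f; split=> //; split=> //.
  by move=> k kN; have [sk _ hk] := sP k kN.
rewrite -psumD -psumM; apply: ler_psum => k kN.
have [sk ymax _] := sP k kN; set n := sigma k.
have n0 : (0 < n)%N by rewrite /n; nlia.
have k0 : (0 < k)%N by case/andP: kN.
have X0 : 0 <= psum x n by exact: nonneg_psum.
have S0 : 0 <= psum (fun m => G m * Phi m) n.
  by apply: nonneg_psum => m m0; rewrite mulr_ge0 ?G0 ?P0.
have nf0 : 0 <= n%:R `^ p * f n by rewrite mulr_ge0 ?powR_ge0 ?f0.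
have -> : a k * unu q u n * psum (fun m => G m * Phi m) n `^ (q / p) +
    a k * uOm q u n * f n `^ (q / p) = a k * (u n `^ q * (psum (fun m => G m * Phi m) n `^ (q / p) +
    (n%:R `^ p * f n) `^ (q / p))).
  rewrite (powRM _ (powR_ge0 _ _) (f0 _ n0)) -powRrM (_ : p * (q / p) = q).
    by rewrite /unu /uOm; ring.
  by rewrite mulrCA divff ?mulr1// gt_eqF.
rewrite mulrCA ler_wpM2l ?a0//.
apply: (@le_trans _ _ ((u n * psum x n) `^ q)).
  apply: le_powR; [exact: ltW|exact: rmax_ge0|].
  by apply: rmax_le; [exact: y0|exact: ymax].
rewrite powRM ?u0// [leRHS]mulrCA ler_wpM2l ?powR_ge0//.
have -> : psum x n `^ q = (psum x n `^ p) `^ (q / p).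
  by rewrite -powRrM mulrCA divff ?mulr1// gt_eqF.
apply: (@le_trans _ _ ((c * (psum (fun m => G m * Phi m) n + n%:R `^ p * f n)) `^ (q / p))).
  by apply: le_powR; rewrite ?powR_ge0.
rewrite powRM ?addr_ge0 ?(ltW c0)// -mulrA ler_pM2l ?powR_gt0//.
exact: powRD_le.
Qed.

Lemma suff_ge1 p q c : 0 < p -> 0 < q -> p <= q -> 0 < c ->
  exists2 c', 0 < c' & forall a b u Phi N K,
  nonneg_seq a -> nonneg_seq b -> nonneg_seq u -> 0 < b 1%N -> nonneg_seq Phi ->
  sum_split p c b Phi -> 0 <= K ->
  (forall n, (0 < n <= N)%N -> rmax (unu q u) n N * psum a n * Phi n `^ (q / p) <= K) ->
  (forall n, (0 < n <= N)%N -> Zfin q a u N n * Phi n `^ (q / p) <= K) ->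
  (forall n, (0 < n <= N)%N -> Wfin q a u n * psum b n `^ (- (q / p)) <= K) ->
  forall x, nonneg_seq x -> nonincr_seq x ->
  psum (fun k => a k * rmax (fun i => u i * psum x i) k N `^ q) N <=
  c' * K * psum (fun m => x m `^ p * b m) N `^ (q / p).
Proof.
move=> p0 q0 pq c0; have Q1 : 1 <= q / p by rewrite ler_pdivlMr// mul1r.
have Q0 : 0 <= q / p by exact: le_trans Q1.
(* 3 = 2 + 1: two conditions enter the part with Phi, one the part with f. *)
exists (c `^ (q / p) * 2 `^ (q / p) * (3 * c `^ (q / p))).
  by rewrite !mulr_gt0 ?powR_gt0.
move=> a b u Phi N K a0 b0 u0 b1 P0 split K0 h1 h2 h3 x x0 xni.
have [sg [G [f [[G0 f0 fni] [sP hG hf hs]]]]] :=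
  linearized_bound N p0 q0 c0 a0 b0 u0 P0 split x0 xni.
apply: (le_trans hs); rewrite -!mulrA !ler_pM2l ?powR_gt0//.
set Gam := psum (fun m => x m `^ p * b m) N.
have Gam0 : 0 <= Gam by apply: nonneg_psum => m m0; rewrite mulr_ge0 ?powR_ge0 ?b0.
have powG (y : R) : 0 <= y -> y <= c * Gam -> y `^ (q / p) <= c `^ (q / p) * Gam `^ (q / p).
  by move=> y0 yG; rewrite -powRM ?(ltW c0)//; exact: le_powR.
have p1 := partI_ge1 a0 sP Q1 (@unu_ge0 q u) G0 P0 h1 h2.
have p2 := partII_ge1 a0 sP Q1 (@uOm_ge0 q u) f0 fni b0 b1 h3.
have gG := powG _ (nonneg_psum N G0) hG.
have gf : psum (fun m => f m * b m) N `^ (q / p) <= c `^ (q / p) * Gam `^ (q / p).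
  by apply: powG => //; apply: nonneg_psum => m m0; rewrite mulr_ge0 ?f0 ?b0.
apply: le_trans (lerD p1 p2) _.
have e1 := ler_wpM2l K0 gG; have e2 := ler_wpM2l K0 gf.
have -> : 3 * (c `^ (q / p) * (K * Gam `^ (q / p))) = (K + K) * (c `^ (q / p) * Gam `^ (q / p)) +
   K * (c `^ (q / p) * Gam `^ (q / p)) by ring.
by apply: lerD => //; rewrite !mulrDl; exact: lerD.
Qed.

Lemma suff_lt1 p q c th : 0 < p -> 0 < q -> q < p -> 0 < c -> th = q / (p - q) ->
  exists2 c', 0 < c' & forall a b u Phi mu N K,
  nonneg_seq a -> nonneg_seq b -> nonneg_seq u -> 0 < b 1%N ->
  nonneg_seq Phi -> nonneg_seq mu -> Phi 0%N = 0 ->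
  (forall m n, (m <= n)%N -> Phi m <= Phi n) ->
  (forall k n, (0 < k < n)%N -> Phi n `^ th - Phi k `^ th <= rmax mu k.+1 n) ->
  sum_split p c b Phi -> 0 <= K ->
  psum (fun k => Zfin q a u N k `^ th * (rmax (unu q u) k N * a k) * Phi k `^ th) N <= K ->
  psum (fun k => a k * psum a k `^ th *
    rmax (fun i => rmax (unu q u) i N `^ (1 + th) * mu i) k N) N <= K ->
  psum (fun k => a k * psum a k `^ th *
    rmax (fun i => uOm q u i `^ (1 + th) * psum b i `^ (- th)) k N) N <= K ->
  psum (fun k => Wfin q a u k `^ th * a k *
    rmax (fun i => uOm q u i * psum b i `^ (- th)) k N) N <= K ->
  forall x, nonneg_seq x -> nonincr_seq x ->
  psum (fun k => a k * rmax (fun i => u i * psum x i) k N `^ q) N <=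
  c' * K `^ (1 - q / p) * psum (fun m => x m `^ p * b m) N `^ (q / p).
Proof.
move=> p0 q0 qp c0 thE; have Q01 : 0 < q / p < 1.
  by rewrite divr_gt0//= ltr_pdivrMr// mul1r.
have thE' : th = (q / p) / (1 - q / p) by rewrite thE; field; rewrite !gt_eqF// subr_gt0.
have Q0 : 0 <= q / p by rewrite divr_ge0 ?ltW.
have [c1 c10 hardy1] := hardy_lt1 Q01 thE'.
have [c2 c20 hardy2] := hardy_rev_lt1 Q01 thE'.
have th0 : 0 < th by rewrite thE divr_gt0// subr_gt0.
have th1 : 0 < 1 + th by rewrite addr_gt0.
have [d1 [d10 d1E]] : exists d : R, 0 < d /\
    d = c1 * (2 `^ th * (1 + th)) `^ (1 - q / p) * 2 `^ (1 - q / p).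
  by eexists; split; last reflexivity; rewrite !mulr_gt0 ?powR_gt0 ?mulr_gt0 ?powR_gt0.
have [d2 [d20 d2E]] : exists d : R, 0 < d /\
    d = c2 * (2 `^ (1 + th) * (1 + th)) `^ (1 - q / p) * 2 `^ (1 - q / p).
  by eexists; split; last reflexivity; rewrite !mulr_gt0 ?powR_gt0 ?mulr_gt0 ?powR_gt0.
exists (c `^ (q / p) * 2 `^ (q / p) * ((d2 + d1) * c `^ (q / p))).
  by rewrite !mulr_gt0 ?powR_gt0// addr_gt0.
move=> a b u Phi mu N K a0 b0 u0 b1 P0 mu0 P00 Pnd Pmu split K0 h4 h5 h6 h7 x x0 xni.
have [sg [G [f [[G0 f0 fni] [sP hG hf hs]]]]] :=
  linearized_bound N p0 q0 c0 a0 b0 u0 P0 split x0 xni.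
apply: (le_trans hs); rewrite -!mulrA !ler_pM2l ?powR_gt0//.
set Gam := psum (fun m => x m `^ p * b m) N.
have Gam0 : 0 <= Gam by apply: nonneg_psum => m m0; rewrite mulr_ge0 ?powR_ge0 ?b0.
have powG (y : R) : 0 <= y -> y <= c * Gam -> y `^ (q / p) <= c `^ (q / p) * Gam `^ (q / p).
  by move=> y0 yG; rewrite -powRM ?(ltW c0)//; exact: le_powR.
have p1 := partI_lt1 a0 sP Q01 thE' c20 hardy2 (@unu_ge0 q u) G0 P0 mu0 P00 Pnd Pmu h4 h5.
have p2 := partII_lt1 a0 sP Q01 thE' c10 hardy1 (@uOm_ge0 q u) f0 fni b0 b1 h6 h7.
have gG := powG _ (nonneg_psum N G0) hG.
have gf : psum (fun m => f m * b m) N `^ (q / p) <= c `^ (q / p) * Gam `^ (q / p).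
  by apply: powG => //; apply: nonneg_psum => m m0; rewrite mulr_ge0 ?f0 ?b0.
apply: le_trans (lerD p1 p2) _.
have KK : (K + K) `^ (1 - q / p) = 2 `^ (1 - q / p) * K `^ (1 - q / p).
  by rewrite -powRM// mulr_natl.
rewrite KK.
rewrite [leRHS](_ : _ = d2 * (K `^ (1 - q / p) * (c `^ (q / p) * Gam `^ (q / p))) +
   d1 * (K `^ (1 - q / p) * (c `^ (q / p) * Gam `^ (q / p)))); last by ring.
have step (e d y : R) : e * 2 `^ (1 - q / p) = d -> 0 < d -> y <= c `^ (q / p) * Gam `^ (q / p) ->
    e * (2 `^ (1 - q / p) * K `^ (1 - q / p) * y) <=
      d * (K `^ (1 - q / p) * (c `^ (q / p) * Gam `^ (q / p))).
  move=> <- d0 yG; rewrite -!mulrA mulrA [leRHS]mulrA ler_pM2l//.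
  by rewrite ler_wpM2l ?powR_ge0.
by apply: lerD; [exact: (step _ _ _ (esym d2E) d20 gG)|exact: (step _ _ _ (esym d1E) d10 gf)].
Qed.

(** X is frozen at its value in n, which X does not fall below for i >= m >= n. *)
Lemma sup_lower q u (X : nat -> R) j n m N : 0 < q -> nonneg_seq u -> nonneg_seq X ->
  (forall i k, (i <= k)%N -> X i <= X k) -> (0 < j <= m)%N -> (0 < n <= m)%N ->
  rmax (unu q u) m N * X n `^ q <= rmax (fun i => u i * X i) j N `^ q.
Proof.
move=> q0 u0 X0 Xnd jm nm; rewrite mulrC -rmaxM ?powR_ge0//.
apply: rmax_le; first exact: powR_ge0.
move=> i im; have i0 : (0 < i)%N by nlia.
have n0 : (0 < n)%N by case/andP: nm.
rewrite /unu -powRM ?u0 ?X0//; apply: le_powR; first exact: ltW.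
  by rewrite mulr_ge0 ?u0 ?X0.
apply: (@le_trans _ _ (u i * X i)).
  by rewrite mulrC ler_wpM2l ?u0// Xnd//; nlia.
by apply: (@le_rmax _ (fun i => u i * X i)); nlia.
Qed.

Lemma powR_QE p q (y : R) : 0 < p -> y `^ q = (y `^ p) `^ (q / p).
Proof. by move=> p0; rewrite -powRrM mulrCA divff ?mulr1// gt_eqF. Qed.

Lemma test_family_delta p q C a b u N lam k : 0 < p -> 0 < q -> nonneg_seq b ->
  trunc_ineq p q C a b u N -> test_family p b N lam -> (0 < k <= N)%N ->
  exists X : nat -> R,
  [/\ nonneg_seq X, (forall i j, (i <= j)%N -> X i <= X j),
      (forall i, (0 < i)%N -> lam k i <= X i `^ p) &
      psum (fun n => a n * rmax (fun i => u i * X i) n N `^ q) N <= C `^ q].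
Proof.
move=> p0 q0 b0 H tf kN.
have d0 : nonneg_seq (fun j => if k == j then 1 else 0 : R) by move=> j _; case: ifP.
have [X [X0 Xnd Xl Xs]] := test_family_sup p0 q0 b0 H tf d0.
exists X; split=> //.
  by move=> i i0; have := Xl k i kN i0; rewrite eqxx mul1r.
by move: Xs; rewrite psum_delta// powR1 mulr1.
Qed.

(** One member of the test family is enough: X^p stays above lamk k from k on. The indices j <= n
    give the first bound, the indices j >= n the second. *)
Lemma nec_ge1 p q C a b u N lam (lamk : nat -> R) k n : 0 < p -> 0 < q ->
  nonneg_seq a -> nonneg_seq b -> nonneg_seq u ->
  trunc_ineq p q C a b u N -> test_family p b N lam -> nonneg_seq lamk ->
  (forall k i, (0 < k <= i)%N -> lamk k <= lam k i) -> (0 < k <= n)%N -> (n <= N)%N ->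
  rmax (unu q u) n N * psum a n * lamk k `^ (q / p) <= C `^ q /\
  Zfin q a u N n * lamk k `^ (q / p) <= C `^ q.
Proof.
move=> p0 q0 a0 b0 u0 H tf l0 ll kn nN.
have kN : (0 < k <= N)%N by nlia.
have [n0 k0] : (0 < n)%N /\ (0 < k)%N by nlia.
have [X [X0 Xnd Xl Xs]] := test_family_delta p0 q0 b0 H tf kN.
have lX : lamk k `^ (q / p) <= X n `^ q.
  rewrite (powR_QE q _ p0); apply: le_powR; [by rewrite divr_ge0 ?ltW|exact: l0|].
  by apply: le_trans (Xl n n0); exact: ll.
have aT0 j : (0 < j)%N -> 0 <= a j * rmax (fun i => u i * X i) j N `^ q.
  by move=> j0; rewrite mulr_ge0 ?a0 ?powR_ge0.
split.
  apply: le_trans Xs; apply: le_trans (psum_nondecr aT0 nN).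
  rewrite mulrAC mulrC -[leLHS]mulrC -psumM; apply: ler_psum => j jn.
  rewrite mulrC ler_wpM2l ?a0//; first by case/andP: jn.
  apply: le_trans (@sup_lower q u X j n n N q0 u0 X0 Xnd _ _); [|nlia|nlia].
  by rewrite ler_wpM2l ?rmax_ge0.
apply: le_trans Xs; rewrite /Zfin mulr_suml sum_tail//; apply: ler_psum => j /andP[j0 jN].
case: ifP => nj; last exact: aT0.
rewrite mulrAC mulrC ler_wpM2l ?a0//.
apply: le_trans (@sup_lower q u X j n j N q0 u0 X0 Xnd _ _); [|nlia|nlia].
by rewrite ler_wpM2l ?rmax_ge0.
Qed.

Lemma nec_ge1_W p q C a b u N n : 0 < p -> 0 < q ->
  nonneg_seq a -> nonneg_seq b -> nonneg_seq u -> 0 < b 1%N ->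
  trunc_ineq p q C a b u N -> (0 < n <= N)%N ->
  Wfin q a u n * psum b n `^ (- (q / p)) <= C `^ q.
Proof.
move=> p0 q0 a0 b0 u0 b1 H nN; have /andP[n0 nN'] := nN.
have [X [X0 Xnd Xl Xs]] := test_family_delta p0 q0 b0 H (test_family_ind N p0 b0 b1) nN.
have aT0 j : (0 < j)%N -> 0 <= a j * rmax (fun i => u i * X i) j N `^ q.
  by move=> j0; rewrite mulr_ge0 ?a0 ?powR_ge0.
apply: le_trans Xs; apply: le_trans (psum_nondecr aT0 nN').
rewrite /Wfin mulrC -psumM; apply: ler_psum => j /andP[j0 jn].
rewrite mulrCA ler_wpM2l ?a0// -rmaxM ?powR_ge0//; apply: rmax_le; first exact: powR_ge0.
move=> i /andP[ji iN]; have i0 : (0 < i)%N by nlia.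
apply: (@le_trans _ _ ((u i * X i) `^ q)); last first.
  apply: le_powR; [exact: ltW|by rewrite mulr_ge0 ?u0 ?X0|].
  by apply: (@le_rmax _ (fun i => u i * X i)); nlia.
have Bn : 0 <= psum b n by exact: nonneg_psum.
rewrite powRM ?u0 ?X0// /uOm mulrCA ler_wpM2l ?powR_ge0//.
rewrite (powR_QE q (X i) p0); apply: le_trans (_ : (i%:R `^ p / psum b n) `^ (q / p) <= _).
  rewrite powRM ?powR_ge0 ?invr_ge0// -powR_QE// mulrC ler_wpM2l ?powR_ge0//.
  by rewrite -(powR_inv1 Bn) -powRrM mulN1r.
apply: le_powR; [by rewrite divr_ge0 ?ltW|by rewrite divr_ge0 ?powR_ge0|].
by have := Xl i i0; rewrite (minn_idPl _).
Qed.

(** The first condition is the reflected sup test for the weight z^q a, with z the truncated tail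
    maximum of u. In the second, z is absorbed into kappa = z^p lamk. *)
Lemma nec_lt1 p q th : 0 < p -> 0 < q -> q < p -> th = q / (p - q) ->
  exists2 c', 0 < c' & forall C a b u N lam (lamk : nat -> R), 0 <= C ->
  nonneg_seq a -> nonneg_seq b -> nonneg_seq u ->
  trunc_ineq p q C a b u N -> test_family p b N lam -> nonneg_seq lamk ->
  (forall k i, (0 < k <= i)%N -> lamk k <= lam k i) ->
  psum (fun k => Zfin q a u N k `^ th * (rmax (unu q u) k N * a k) *
     rmax (fun j => lamk j `^ th) 1 k) N <= c' * (C `^ q) `^ (1 + th) /\
  psum (fun k => a k * psum a k `^ th *
    rmax (fun i => rmax (unu q u) i N `^ (1 + th) * lamk i `^ th) k N) N <=
    c' * (C `^ q) `^ (1 + th).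
Proof.
move=> p0 q0 qp thE; have Q01 : 0 < q / p < 1.
  by rewrite divr_gt0//= ltr_pdivrMr// mul1r.
have pq0 : 0 < p - q by rewrite subr_gt0.
have thE' : th = (q / p) / (1 - q / p) by rewrite thE; field; rewrite !gt_eqF.
have Q0 : 0 <= q / p by rewrite divr_ge0 ?ltW.
exists (2 * 2 `^ th * 2 `^ (1 + th)); first by rewrite !mulr_gt0 ?powR_gt0.
move=> C a b u N lam lamk C0 a0 b0 u0 H tf l0 ll.
have -> : 2 * 2 `^ th * 2 `^ (1 + th) * (C `^ q) `^ (1 + th) =
  2 * 2 `^ th * (2 * C `^ q) `^ (1 + th).
  by rewrite (powRM _ _ (powR_ge0 C q))// mulrA.
have Cq0 : 0 <= C `^ q by exact: powR_ge0.
have key (X : nat -> R) d : nonneg_seq d ->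
    (forall k i, (0 < k <= N)%N -> (0 < i)%N -> d k * lam k i <= X i `^ p) ->
    forall k n, (0 < k <= n)%N -> (n <= N)%N -> (d k * lamk k) `^ (q / p) <= X n `^ q.
  move=> d0 Xl k n kn nN; have [n0 k0] : (0 < n)%N /\ (0 < k)%N by nlia.
  rewrite (powR_QE q (X n) p0); apply: le_powR => //; first by rewrite mulr_ge0 ?d0 ?l0.
  apply: le_trans (Xl k n _ n0); last by nlia.
  by rewrite ler_wpM2l ?d0// ll.
split.
  have w0 : nonneg_seq (fun k => rmax (unu q u) k N * a k).
    by move=> k k0; rewrite mulr_ge0 ?rmax_ge0 ?a0.
  have := @sup_test_rev R (q / p) th (C `^ q) _ lamk N Q01 thE' Cq0 w0 l0.
  rewrite (@eq_psum _ _ (fun k => Zfin q a u N k `^ th * (rmax (unu q u) k N * a k) *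
     rmax (fun j => lamk j `^ th) 1 k)); last first.
    by move=> k _; rewrite /Zfin; congr (_ * _); rewrite mulrC.
  apply => d d0.
  have [X [X0 Xnd Xl Xs]] := test_family_sup p0 q0 b0 H tf d0.
  apply: le_trans Xs; apply: ler_psum => n /andP[n0 nN].
  rewrite mulrAC mulrC ler_wpM2l ?a0//.
  apply: le_trans (@sup_lower q u X n n n N q0 u0 X0 Xnd _ _); [|nlia|nlia].
  rewrite ler_wpM2l ?rmax_ge0//; apply: rmax_le; first exact: powR_ge0.
  by move=> k kn; apply: (key X d).
pose kappa k := rmax u k N `^ p * lamk k.
have kap0 : nonneg_seq kappa by move=> k k0; rewrite mulr_ge0 ?powR_ge0 ?l0.
have := @sup_test R (q / p) th (C `^ q) a kappa N Q01 thE' Cq0 a0 kap0.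
have nuE k (r : R) : (0 < k)%N -> rmax u k N `^ (q * r) = rmax (unu q u) k N `^ r.
  by move=> k0; rewrite powRrM (rmax_powR q0)// => i ki; apply: u0; nlia.
rewrite (@eq_psum _ _ (fun k => a k * psum a k `^ th *
    rmax (fun i => rmax (unu q u) i N `^ (1 + th) * lamk i `^ th) k N)); last first.
  move=> k /andP[k0 _]; congr (_ * _); apply: eq_big_nat => i ki.
  have i0 : (0 < i)%N by nlia.
  rewrite /kappa powRM ?powR_ge0 ?l0// -powRrM -nuE//; congr (_ `^ _ * _).
  by rewrite thE; field; rewrite gt_eqF.
apply => d d0.
have [X [X0 Xnd Xl Xs]] := test_family_sup p0 q0 b0 H tf d0.
apply: le_trans Xs; apply: ler_psum => n /andP[n0 nN].
rewrite ler_wpM2l ?a0//; apply: rmax_le; first exact: powR_ge0.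
move=> k kn; have k0 : (0 < k)%N by nlia.
apply: le_trans (@sup_lower q u X n k k N q0 u0 X0 Xnd _ _); [|nlia|nlia].
rewrite /kappa mulrCA powRM ?powR_ge0 ?mulr_ge0 ?d0 ?l0// -powR_QE//.
have := nuE k 1 k0; rewrite mulr1 powRr1 ?rmax_ge0// => ->.
rewrite ler_wpM2l ?rmax_ge0//.
by apply: (key X d) => //; nlia.
Qed.

(** For indicators, u(i) X(i) is bounded below through every k >= i; this is the nested maximum
    required by [sup_test_block]. *)
Lemma nec_lt1_W p q th : 0 < p -> 0 < q -> q < p -> th = q / (p - q) ->
  exists2 c', 0 < c' & forall C a b u N, 0 <= C ->
  nonneg_seq a -> nonneg_seq b -> nonneg_seq u -> 0 < b 1%N ->
  trunc_ineq p q C a b u N ->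
  psum (fun k => Wfin q a u k `^ th * a k *
    rmax (fun i => uOm q u i * psum b i `^ (- th)) k N) N <= c' * (C `^ q) `^ (1 + th).
Proof.
move=> p0 q0 qp thE; have Q01 : 0 < q / p < 1.
  by rewrite divr_gt0//= ltr_pdivrMr// mul1r.
have pq0 : 0 < p - q by rewrite subr_gt0.
have thE' : th = (q / p) / (1 - q / p) by rewrite thE; field; rewrite !gt_eqF.
have Q0 : 0 <= q / p by rewrite divr_ge0 ?ltW.
exists (2 `^ th * 2 `^ th * 2 * (2 * (2 * 2 `^ th * 8 `^ (1 + th)) + 2 `^ (1 + th))).
  by rewrite !mulr_gt0 ?addr_gt0 ?mulr_gt0 ?powR_gt0.
move=> C a b u N C0 a0 b0 u0 b1 H.
have Cq0 : 0 <= C `^ q by exact: powR_ge0.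
have Bp m : (0 < m)%N -> 0 < psum b m := psum_gt0 b0 b1.
have Bnd m n : (0 < m <= n)%N -> psum b m <= psum b n.
  by move=> /andP[_ mn]; exact: psum_nondecr.
have := @sup_test_block R (q / p) th (C `^ q) a (uOm q u) (psum b) N Q01 thE' Cq0 a0
  (@uOm_ge0 q u) Bp Bnd.
rewrite -!mulrA (_ : 2 * (4 * C `^ q) = 8 * C `^ q); last by ring.
rewrite !powRM// -/(Wfin q a u) => h.
apply: le_trans (h _) _; last by rewrite le_eqVlt; apply/orP; left; apply/eqP; ring.
move=> d d0.
have [X [X0 Xnd Xl Xs]] := test_family_sup p0 q0 b0 H (test_family_ind N p0 b0 b1) d0.
apply: le_trans Xs; apply: ler_psum => n /andP[n0 nN].
rewrite ler_wpM2l ?a0//; apply: rmax_le; first exact: powR_ge0.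
move=> i iN; have i0 : (0 < i)%N by nlia.
apply: (@le_trans _ _ ((u i * X i) `^ q)); last first.
  apply: le_powR; [exact: ltW|by rewrite mulr_ge0 ?u0 ?X0|].
  by apply: (@le_rmax _ (fun i => u i * X i)); nlia.
rewrite powRM ?u0 ?X0// /uOm -mulrA ler_wpM2l ?powR_ge0// -rmaxM ?powR_ge0//.
apply: rmax_le; first exact: powR_ge0.
move=> k ki; have kN : (0 < k <= N)%N by nlia.
have k0 : (0 < k)%N by case/andP: kN.
rewrite (powR_QE q (X i) p0) (powR_QE q i%:R p0) -powRM ?powR_ge0 ?divr_ge0 ?d0 ?(ltW (Bp k k0))//.
apply: le_powR => //; first by rewrite mulr_ge0 ?powR_ge0 ?divr_ge0 ?d0 ?(ltW (Bp k k0)).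
by have := Xl k i kN i0; rewrite (minn_idPl _)// 1?mulrCA//; nlia.
Qed.

End Finite.

(** * Passage to infinite sums and suprema *)

Section Approximation.
Local Open Scope ereal_scope.
Context {R : realType}.
Implicit Types (F G : nat -> R) (L M y : \bar R).

(** L is the supremum of a non-decreasing real sequence, expressed by order alone so that L = +oo is
    allowed. The closure properties below carry finite estimates with uniform constants over to
    infinite sums and suprema. *)
Definition approximates F L := [/\ forall N, (0 <= F N)%R,
  forall m n, (m <= n)%N -> (F m <= F n)%R,
  forall N, (F N)%:E <= L & forall y, (forall N, (F N)%:E <= y) -> L <= y].

Lemma approximates_ge0 F L : approximates F L -> 0 <= L.
Proof. by move=> [F0 _ FL _]; apply: le_trans (FL 0%N); rewrite lee_fin. Qed.

Lemma approximates_le F L (r : R) : approximates F L ->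
  L <= r%:E <-> forall N, (F N <= r)%R.
Proof.
move=> [_ _ FL Fy]; split=> [Lr N|h]; first by rewrite -lee_fin (le_trans (FL N)).
by apply: Fy => N; rewrite lee_fin.
Qed.

Lemma approximates_unique F L M : approximates F L -> approximates F M -> L = M.
Proof.
move=> [_ _ FL Ly] [_ _ FM My]; apply/eqP; rewrite eq_le.
by rewrite (Ly _ FM) (My _ FL).
Qed.

Lemma eq_approximates F G L : F =1 G -> approximates F L -> approximates G L.
Proof.
move=> FG [F0 Fnd FL Fy]; split=> [N|m n|N|y h]; rewrite -?FG//.
  exact: Fnd.
by apply: Fy => N; rewrite FG.
Qed.

Lemma approximates_real F L : (forall N, (0 <= F N)%R) ->
  (forall m n, (m <= n)%N -> (F m <= F n)%R) -> (forall N, (F N)%:E <= L) ->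
  (forall r : R, (0 <= r)%R -> (forall N, (F N <= r)%R) -> L <= r%:E) ->
  approximates F L.
Proof.
move=> F0 Fnd FL Fr; split=> // -[r| |] h; rewrite ?leey//; last first.
  by have := h 0%N; rewrite leeNy_eq.
have h' N : (F N <= r)%R by rewrite -lee_fin.
by apply: Fr => //; apply: le_trans (h' 0%N).
Qed.

Lemma approximates_cst (r : R) : (0 <= r)%R -> approximates (fun=> r) r%:E.
Proof. by move=> r0; split=> // y /(_ 0%N). Qed.

Lemma approximates_powR F L (e : R) : (0 < e)%R -> approximates F L ->
  approximates (fun N => F N `^ e)%R (L `^ e).
Proof.
move=> e0 FL; have [F0 Fnd FleL _] := FL; have L0 := approximates_ge0 FL.
have e0' := ltW e0; have en0 : e != 0%R by rewrite gt_eqF.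
have leP (s : R) x y : (0 <= s)%R -> 0 <= x -> x <= y -> x `^ s <= y `^ s.
  move=> s0 x0 xy; apply: gt0_ler_poweR => //; rewrite in_itv/= ?x0 ?leey//.
  by rewrite (le_trans x0 xy).
apply: approximates_real => [N|m n mn|N|r r0 h].
- exact: powR_ge0.
- exact: le_powR (Fnd _ _ mn).
- by rewrite -poweR_EFin; apply: leP => //; rewrite lee_fin.
- have Lr : L <= (r `^ e^-1)%:E.
    apply/(approximates_le _ FL) => N; rewrite -[leLHS](powRK en0 (F0 N)).
    by apply: le_powR; rewrite ?invr_ge0 ?powR_ge0.
  by have := leP e _ _ e0' L0 Lr; rewrite poweR_EFin powRVK.
Qed.

Lemma approximatesD F G L M : approximates F L -> approximates G M ->
  approximates (fun N => F N + G N)%R (L + M).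
Proof.
move=> FL GM; have [F0 Fnd FleL _] := FL; have [G0 Gnd GleM _] := GM.
apply: approximates_real => [N|m n mn|N|r r0 h].
- by rewrite addr_ge0.
- by rewrite lerD ?Fnd ?Gnd.
- by rewrite EFinD leeD.
(* Monotonicity decouples the two indices, both being replaced by their maximum. *)
have h' m n : (F m + G n <= r)%R.
  apply: le_trans (h (maxn m n)); rewrite lerD//.
    by rewrite Fnd// leq_maxl.
  by rewrite Gnd// leq_maxr.
have LG n : L <= (r - G n)%:E by apply/(approximates_le _ FL) => m; rewrite lerBrDr.
have Lfin : L \is a fin_num.
  by rewrite ge0_fin_numE ?(approximates_ge0 FL)// (le_lt_trans (LG 0%N)) ?ltry.
have Mle : M <= (r - fine L)%:E.
  apply/(approximates_le _ GM) => n; rewrite lerBrDl -lerBrDr.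
  by have := LG n; rewrite -[in X in X -> _](fineK Lfin) lee_fin.
by rewrite -(fineK Lfin); apply: le_trans (leeD2l _ Mle) _; rewrite -EFinD subrKC.
Qed.

Lemma approximatesM F G L M : approximates F L -> approximates G M ->
  approximates (fun N => F N * G N)%R (L * M).
Proof.
move=> FL GM; have [F0 Fnd FleL _] := FL; have [G0 Gnd GleM _] := GM.
apply: approximates_real => [N|m n mn|N|r r0 h].
- by rewrite mulr_ge0.
- by rewrite ler_pM ?Fnd ?Gnd.
- by rewrite EFinM; apply: lee_pmul; rewrite ?lee_fin.
have h' m n : (F m * G n <= r)%R.
  apply: le_trans (h (maxn m n)); rewrite ler_pM//.
    by rewrite Fnd// leq_maxl.
  by rewrite Gnd// leq_maxr.
(* If all G n vanish then M = 0, and the convention 0 * oo = 0 agrees with the products. *)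
have [|] := pselect (forall n, (G n <= 0)%R).
  move=> /(approximates_le _ GM) M0.
  suff -> : M = 0 by rewrite mule0 lee_fin.
  by apply/eqP; rewrite eq_le M0 (approximates_ge0 GM).
move=> /existsNP[n0 /negP]; rewrite -ltNge => Gn0.
have LG : L <= (r / G n0)%:E.
  by apply/(approximates_le _ FL) => m; rewrite ler_pdivlMr.
have Lfin : L \is a fin_num.
  by rewrite ge0_fin_numE ?(approximates_ge0 FL)// (le_lt_trans LG) ?ltry.
have L0 : (0 <= fine L)%R by rewrite fine_ge0 ?(approximates_ge0 FL).
have [Lz|Lnz] := eqVneq (fine L) 0%R; first by rewrite -(fineK Lfin) Lz mul0e lee_fin.
have Lp : (0 < fine L)%R by rewrite lt_neqAle eq_sym Lnz.
have Mle : M <= (r / fine L)%:E.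
  apply/(approximates_le _ GM) => n; rewrite ler_pdivlMr// mulrC.
  have [->|Gn] := eqVneq (G n) 0%R; first by rewrite mulr0.
  have Gp : (0 < G n)%R by rewrite lt_neqAle eq_sym Gn G0.
  rewrite -ler_pdivlMr// -lee_fin (fineK Lfin).
  by apply/(approximates_le _ FL) => m; rewrite ler_pdivlMr.
rewrite -(fineK Lfin); apply: le_trans (lee_wpmul2l _ Mle) _ => //.
by rewrite -EFinM mulrCA divff ?mulr1.
Qed.

Lemma approximates_sum (F : nat -> nat -> R) (L : nat -> \bar R) m K :
  (forall n, (m <= n)%N -> approximates (F n) (L n)) ->
  approximates (fun N => \sum_(m <= n < K) F n N)%R (\sum_(m <= n < K) L n).
Proof.
move=> h; elim: K => [|K IH].
  by rewrite big_geq//; apply: eq_approximates (approximates_cst (lexx 0%R)) => N; rewrite big_geq.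
have [Km|mK] := ltnP K m.
  by rewrite big_geq//; apply: eq_approximates (approximates_cst (lexx 0%R)) => N; rewrite big_geq.
rewrite big_nat_recr//=; apply: eq_approximates (approximatesD IH (h _ mK)) => N.
by rewrite big_nat_recr.
Qed.

(** N truncates the number of terms and each term at once; by monotonicity in both, this diagonal
    has the same supremum as the iterated limit. *)
Lemma approximates_series (F : nat -> nat -> R) (L : nat -> \bar R) m :
  (forall n, (m <= n)%N -> approximates (F n) (L n)) ->
  approximates (fun N => \sum_(m <= n < N.+1) F n N)%R (\sum_(m <= n <oo) L n).
Proof.
move=> h; have L0 n : (m <= n)%N -> 0 <= L n by move=> /h/approximates_ge0.
have F0 n N : (m <= n)%N -> (0 <= F n N)%R by move=> /h[].
have ssub K N : (K <= N)%N -> (\sum_(m <= n < K) F n N <= \sum_(m <= n < N.+1) F n N)%R.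
  move=> KN; have [Km|mK] := leqP K m.
    by rewrite big_geq// big_nat sumr_ge0// => i /andP[mi _]; exact: F0.
  rewrite [leRHS](big_cat_nat (n := K)) ?(ltnW mK)//=; last by rewrite ltnW.
  rewrite lerDl big_nat sumr_ge0// => i /andP[Ki _].
  by rewrite F0// (leq_trans (ltnW mK)).
apply: approximates_real => [N|k N kN|N|r r0 hr].
- by rewrite big_nat sumr_ge0// => i /andP[mi _]; exact: F0.
- apply: le_trans (_ : \sum_(m <= n < k.+1) F n N <= _)%R.
    by rewrite !big_nat; apply: ler_sum => i /andP[mi _]; have [_ + _ _] := h i mi; exact.
  have [Nk|kN'] := leqP N k; last exact: ssub.
  by have -> : k = N by apply/eqP; rewrite eqn_leq kN.
- rewrite -sumEFin; apply: le_trans (_ : \sum_(m <= n < N.+1) L n <= _).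
    by rewrite !big_nat; apply: lee_sum => i /andP[mi _]; have [_ _ + _] := h i mi; exact.
  by apply: (@nneseries_lim_ge R L xpredT m) => n mn _; exact: L0.
apply: lime_le; first by apply: is_cvg_nneseries => n mn _; exact: L0.
apply: nearW => K.
apply/(approximates_le _ (approximates_sum K h)) => N.
have [_ mono _ _] := approximates_sum K h.
apply: le_trans (mono _ _ (leq_maxr K N)) _; apply: le_trans (hr (maxn K N)).
exact/ssub/leq_maxl.
Qed.

Lemma approximates_esups (F : nat -> nat -> R) (L : nat -> \bar R) m :
  (forall n, (m <= n)%N -> approximates (F n) (L n)) ->
  approximates (fun N => rmax (F ^~ N) m N) (esups L m).
Proof.
move=> h; have L0 n : (m <= n)%N -> 0 <= L n by move=> /h/approximates_ge0.
have Lsup n : (m <= n)%N -> L n <= esups L m.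
  by move=> mn; apply: ereal_sup_ubound; exists n.
have S0 : 0 <= esups L m by apply: le_trans (Lsup m _); rewrite ?L0.
have F0 n N : (m <= n)%N -> (0 <= F n N)%R by move=> /h[].
apply: approximates_real => [N|k N kN|N|r r0 hr].
- exact: rmax_ge0.
- apply: rmax_le; first exact: rmax_ge0.
  move=> i /andP[mi ik]; have [_ mono _ _] := h i mi.
  apply: le_trans (mono _ _ kN) _; apply: (@le_rmax _ (F ^~ N)).
  by rewrite mi (leq_trans ik).
- have [mN|Nm] := leqP m N; last by rewrite /rmax big_geq.
  have [i /andP[mi _] ->] := @rmax_attained _ (F ^~ N) m N mN
    (fun k kN => F0 k N (proj1 (andP kN))).
  by apply: le_trans (Lsup i mi); have [_ _ + _] := h i mi; exact.
apply: ge_ereal_sup => _ [n /= mn <-]; apply/(approximates_le _ (h n mn)) => N.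
have [_ mono _ _] := h n mn.
apply: le_trans (mono _ _ (leq_maxr n N)) _; apply: le_trans (hr (maxn n N)).
by apply: (@le_rmax _ (F ^~ (maxn n N))); rewrite mn leq_maxl.
Qed.

Lemma range_sup_rmax F m n : (m <= n)%N ->
  (forall k, (m <= k <= n)%N -> (0 <= F k)%R) ->
  range_sup (fun k => (F k)%:E) m n = (rmax F m n)%:E.
Proof.
move=> mn F0; apply/eqP; rewrite eq_le; apply/andP; split.
  by apply: ge_ereal_sup => _ [k /= kn <-]; rewrite lee_fin; exact: le_rmax.
have [k kn ->] := rmax_attained mn F0.
by apply: ereal_sup_ubound; exists k.
Qed.

End Approximation.

Section Truncations.
Local Open Scope ereal_scope.
Context {R : realType}.
Variables (q th r e : R) (a b u : nat -> R).
Hypotheses (q0 : (0 < q)%R) (th0 : (0 < th)%R) (r0 : (0 < r)%R) (e0 : (0 < e)%R).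
Hypotheses (a0 : nonneg_seq a) (b0 : nonneg_seq b) (u0 : nonneg_seq u).

Let approximates_seq (y : nat -> R) n : nonneg_seq y -> (0 < n)%N ->
  approximates (fun=> y n) (y n)%:E.
Proof. by move=> y0 n0; apply: approximates_cst; exact: y0. Qed.

Lemma approximates_sup (y : nat -> R) n : nonneg_seq y -> (0 < n)%N ->
  approximates (rmax y n) (esups (fun k => (y k)%:E) n).
Proof.
move=> y0 n0; apply: (approximates_esups (F := fun k _ => y k)) => k nk.
by apply: approximates_seq => //; apply: leq_trans nk.
Qed.

Lemma approximates_psum (y : nat -> R) : nonneg_seq y ->
  approximates (psum y) (\sum_(1 <= m <oo) (y m)%:E).
Proof.
move=> y0; apply: (approximates_series (F := fun k _ => y k)) => k k0.
exact: approximates_seq.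
Qed.

Lemma approximates_psum_oo : approximates (psum b) (psum_oo b).
Proof.
have nd m n : (m <= n)%N -> (psum b m <= psum b n)%R by exact: psum_nondecr.
have ndE : nondecreasing_seq (fun m => (psum b m)%:E).
  by move=> m n mn; rewrite lee_fin nd.
rewrite /psum_oo (cvg_lim _ (ereal_nondecreasing_cvgn ndE))//.
split=> [N|//|N|y h]; first exact: nonneg_psum.
  by apply: ereal_sup_ubound; exists N.
by apply: ge_ereal_sup => _ [N _ <-].
Qed.

Lemma approximates_weighted_sup (y : nat -> R) : nonneg_seq y ->
  approximates (fun N => psum (fun k => a k * rmax y k N `^ q)%R N `^ q^-1)%R
    ((\sum_(1 <= m <oo) (esups (fun i => (y i)%:E) m) `^ q * (a m)%:E) `^ q^-1).
Proof.
move=> y0; apply: approximates_powR; first by rewrite invr_gt0.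
apply: (approximates_series (F := fun k N => a k * rmax y k N `^ q)%R) => k k0.
rewrite muleC; apply: approximatesM; first exact: approximates_seq.
by apply: approximates_powR => //; exact: approximates_sup.
Qed.

Lemma approximates_rhs p (x : nat -> R) : (0 < p)%R -> nonneg_seq x ->
  approximates (fun N => psum (fun m => x m `^ p * b m)%R N `^ p^-1)%R
    (ineq_rhs p b x).
Proof.
move=> p0 x0; apply: approximates_powR; first by rewrite invr_gt0.
by apply: approximates_psum => m m0; rewrite mulr_ge0 ?powR_ge0 ?b0.
Qed.

Lemma approximates_tail n : (0 < n)%N ->
  approximates (rmax u n) (tail_sup u n).
Proof. exact: approximates_sup. Qed.

Lemma approximates_Ztail n : (0 < n)%N ->
  approximates (fun N => Zfin q a u N n) (Ztail q a u n).
Proof.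
move=> n0.
apply: (approximates_series (F := fun k N => rmax (unu q u) k N * a k)%R) => k nk.
have k0 : (0 < k)%N by exact: leq_trans nk.
apply: approximatesM; last exact: approximates_seq.
apply: eq_approximates (approximates_powR q0 (approximates_tail k0)) => N.
by rewrite (rmax_powR q0)// => i /andP[ki _]; apply: u0; exact: leq_trans ki.
Qed.

Lemma WsumE n : (0 < n)%N -> Wsum q a u n = (Wfin q a u n)%:E.
Proof.
move=> n0; rewrite /Wsum /Wfin /psum -sumEFin; apply: eq_big_nat => i /andP[i0 iin].
by rewrite range_sup_rmax// => k _; rewrite mulr_ge0 ?powR_ge0.
Qed.

(** L covers both forms of the last factor, a power of [Vsum] or a [range_sup], each of which is
    finite. *)
Lemma approximates_C1 (V : nat -> R) (L : nat -> \bar R) : (forall n, (0 < n)%N ->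
  (0 <= V n)%R /\ L n = (V n)%:E) ->
  approximates (fun N => rmax (fun n => rmax u n N * psum a n `^ q^-1 * V n)%R 1 N)
    (esups (fun n => tail_sup u n * (psum a n `^ q^-1)%:E * L n) 1%N).
Proof.
move=> VL.
apply: (approximates_esups (F := fun n N => rmax u n N * psum a n `^ q^-1 * V n)%R) => n n0.
have [V0 ->] := VL n n0; apply: approximatesM; last exact: approximates_cst.
apply: approximatesM; first exact: approximates_tail.
exact/approximates_cst/powR_ge0.
Qed.

Lemma approximates_C2 (V : nat -> R) (L : nat -> \bar R) : (forall n, (0 < n)%N ->
  (0 <= V n)%R /\ L n = (V n)%:E) ->
  approximates (fun N => rmax (fun n => Zfin q a u N n `^ q^-1 * V n)%R 1 N)
    (esups (fun n => (Ztail q a u n) `^ q^-1 * L n) 1%N).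
Proof.
move=> VL.
apply: (approximates_esups (F := fun n N => Zfin q a u N n `^ q^-1 * V n)%R) => n n0.
have [V0 ->] := VL n n0; apply: approximatesM; last exact: approximates_cst.
by apply: approximates_powR; [rewrite invr_gt0|exact: approximates_Ztail].
Qed.

Lemma approximates_C3 (V : nat -> R) : nonneg_seq V ->
  approximates (rmax (fun n => Wfin q a u n `^ q^-1 * V n)%R 1)
    (esups (fun n => (Wsum q a u n) `^ q^-1 * (V n)%:E) 1%N).
Proof.
move=> V0.
apply: (approximates_esups (F := fun n N => Wfin q a u n `^ q^-1 * V n)%R) => n n0.
rewrite WsumE// poweR_EFin; apply: approximatesM; last exact: approximates_seq.
exact/approximates_cst/powR_ge0.
Qed.

Lemma approximates_C4 (V : nat -> R) (L : nat -> \bar R) : (forall n, (0 < n)%N ->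
  (0 <= V n)%R /\ L n = (V n)%:E) ->
  approximates (fun N => psum (fun n =>
      Zfin q a u N n `^ th * rmax u n N `^ q * a n * V n)%R N `^ e)%R
    ((\sum_(1 <= n <oo)
      (Ztail q a u n) `^ th * (tail_sup u n) `^ q * (a n)%:E * L n) `^ e).
Proof.
move=> VL; apply: approximates_powR => //.
apply: (approximates_series
  (F := fun n N => Zfin q a u N n `^ th * rmax u n N `^ q * a n * V n)%R) => n n0.
have [V0 ->] := VL n n0; apply: approximatesM; last exact: approximates_cst.
apply: approximatesM; last exact: approximates_seq.
apply: approximatesM; first by apply: approximates_powR => //; exact: approximates_Ztail.
by apply: approximates_powR => //; exact: approximates_tail.
Qed.

Lemma approximates_C5 (V : nat -> R) : nonneg_seq V ->
  approximates (fun N => psum (fun n => psum a n `^ th * a n *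
      rmax (fun k => rmax u k N `^ r * V k) n N)%R N `^ e)%R
    ((\sum_(1 <= n <oo) (psum a n `^ th * a n)%:E *
      esups (fun k => (tail_sup u k) `^ r * (V k)%:E) n) `^ e).
Proof.
move=> V0; apply: approximates_powR => //.
apply: (approximates_series (F := fun n N => psum a n `^ th * a n *
      rmax (fun k => rmax u k N `^ r * V k) n N)%R) => n n0.
apply: approximatesM; first by apply: approximates_cst; rewrite mulr_ge0 ?powR_ge0 ?a0.
apply: (approximates_esups (F := fun k N => rmax u k N `^ r * V k)%R) => k nk.
have k0 : (0 < k)%N by exact: leq_trans nk.
apply: approximatesM; last exact: approximates_seq.
by apply: approximates_powR => //; exact: approximates_tail.
Qed.

Lemma approximates_C6 (V : nat -> R) : nonneg_seq V ->
  approximates (fun N => psum (fun n => psum a n `^ th * a n * rmax V n N)%R N `^ e)%R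
    ((\sum_(1 <= n <oo) (psum a n `^ th * a n)%:E *
      esups (fun k => (V k)%:E) n) `^ e).
Proof.
move=> V0; apply: approximates_powR => //.
apply: (approximates_series (F := fun n N => psum a n `^ th * a n * rmax V n N)%R) => n n0.
apply: approximatesM; first by apply: approximates_cst; rewrite mulr_ge0 ?powR_ge0 ?a0.
exact: approximates_sup.
Qed.

Lemma approximates_C7 (V : nat -> R) : nonneg_seq V ->
  approximates (fun N => psum (fun n => Wfin q a u n `^ th * a n * rmax V n N)%R N `^ e)%R
    ((\sum_(1 <= n <oo) (Wsum q a u n) `^ th * (a n)%:E *
      esups (fun k => (V k)%:E) n) `^ e).
Proof.
move=> V0; apply: approximates_powR => //.
apply: (approximates_series (F := fun n N => Wfin q a u n `^ th * a n * rmax V n N)%R) => n n0.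
rewrite WsumE// poweR_EFin -EFinM; apply: approximatesM; last exact: approximates_sup.
by apply: approximates_cst; rewrite mulr_ge0 ?powR_ge0 ?a0.
Qed.

End Truncations.

Section Admissible.
Context {R : realType}.
Implicit Types (a b u x Phi mu : nat -> R) (p q c C K : R).

Lemma le_powR_of_root e (s K : R) : 0 < e -> 0 <= s -> s `^ e^-1 <= K -> s <= K `^ e.
Proof.
move=> e0 s0 h; rewrite -[leLHS](@powRVK _ e)// ?gt_eqF//.
by apply: le_powR; rewrite ?powR_ge0 ?(ltW e0).
Qed.

Lemma root_le_of_powR e (s K : R) : 0 < e -> 0 <= s -> 0 <= K -> s <= K `^ e -> s `^ e^-1 <= K.
Proof.
move=> e0 s0 K0 h; rewrite -[leRHS](@powRK _ e)// ?gt_eqF//.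
by apply: le_powR; rewrite ?invr_ge0 ?(ltW e0).
Qed.

Lemma approximates_lhs q a u x : 0 < q -> nonneg_seq a -> nonneg_seq u -> nonneg_seq x ->
  approximates (fun N => psum (fun k => a k * rmax (fun i => u i * psum x i) k N `^ q) N `^ q^-1)
    (ineq_lhs q a u x).
Proof.
move=> q0 a0 u0 x0; apply: approximates_weighted_sup => // i i0.
by rewrite mulr_ge0 ?u0 ?nonneg_psum.
Qed.

Lemma psum_eventually0 (F : nat -> R) N M : (forall m, (N < m)%N -> F m = 0) -> (N <= M)%N ->
  psum F M = psum F N.
Proof.
move=> F0 NM; rewrite -(psum_upto F NM); apply: eq_psum => k _.
by have [//|/F0] := leqP k N.
Qed.

(** For x supported in [1, N] the right side coincides with its truncation, and truncating the left
    side only lowers it. *)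
Lemma admissible_trunc p q C a b u N : 0 < p -> 0 < q ->
  nonneg_seq a -> nonneg_seq b -> nonneg_seq u ->
  admissible_constants p q a b u C -> trunc_ineq p q C a b u N.
Proof.
move=> p0 q0 a0 b0 u0 [C0 H] x x0 xni xN.
have [_ _ lhsN _] := approximates_lhs q0 a0 u0 x0.
set S := psum (fun k => _) N; have S0 : 0 <= S.
  by apply: nonneg_psum => k k0; rewrite mulr_ge0 ?a0 ?powR_ge0.
set P := psum (fun m => _) N; have P0 : 0 <= P.
  by apply: nonneg_psum => k k0; rewrite mulr_ge0 ?powR_ge0 ?b0.
suff h : S `^ q^-1 <= C * P `^ p^-1.
  apply: le_trans (le_powR_of_root q0 S0 h) _.
  by rewrite powRM ?powR_ge0// -powRrM [p^-1 * q]mulrC.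
rewrite -lee_fin EFinM; apply: le_trans (lhsN N) _.
apply: le_trans (H x x0 xni) _; apply: lee_wpmul2l; first by rewrite lee_fin.
have rhsP := approximates_rhs b0 p0 x0.
apply/(approximates_le _ rhsP) => M; have [_ mono _ _] := rhsP.
apply: le_trans (mono _ _ (leq_maxr N M)) _.
rewrite (@psum_eventually0 _ N)// ?leq_maxl// => m Nm.
by rewrite xN// powR0 ?mul0r// gt_eqF.
Qed.

Lemma trunc_admissible p q K a b u : 0 < p -> 0 < q ->
  nonneg_seq a -> nonneg_seq b -> nonneg_seq u -> 0 <= K ->
  (forall N x, nonneg_seq x -> nonincr_seq x ->
    psum (fun k => a k * rmax (fun i => u i * psum x i) k N `^ q) N <=
    K `^ q * psum (fun m => x m `^ p * b m) N `^ (q / p)) ->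
  admissible_constants p q a b u K.
Proof.
move=> p0 q0 a0 b0 u0 K0 H; split=> // x x0 xni.
have [_ _ _ lhsN] := approximates_lhs q0 a0 u0 x0; apply: lhsN => N.
have [_ _ rhsN _] := approximates_rhs b0 p0 x0.
apply: (@le_trans _ _ (K%:E * (psum (fun m => x m `^ p * b m) N `^ p^-1)%:E)%E); last first.
  by apply: lee_wpmul2l; rewrite ?lee_fin.
rewrite -EFinM lee_fin; apply: root_le_of_powR => //.
- by apply: nonneg_psum => k k0; rewrite mulr_ge0 ?a0 ?powR_ge0.
- by rewrite mulr_ge0 ?powR_ge0.
by rewrite powRM ?powR_ge0// -powRrM [p^-1 * q]mulrC; exact: H.
Qed.

(** Tested on x = 1, whose partial sums are i and whose right side is B(oo)^(1/p), finite and
    positive unless B(oo) = +oo. *)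
Lemma admissible_C_0 p q C a b u : 0 < p -> 0 < q ->
  nonneg_seq a -> nonneg_seq b -> nonneg_seq u -> 0 < b 1%N ->
  admissible_constants p q a b u C -> (C_0 p q a b u <= C%:E)%E.
Proof.
move=> p0 q0 a0 b0 u0 b1 [C0 H]; rewrite /C_0; case: ifPn => [_|Boo]; first by rewrite lee_fin.
have one0 : nonneg_seq (fun=> 1 : R) by move=> m _.
have := H _ one0 (fun m n _ _ => lexx 1).
have psum1 i : psum (fun=> 1 : R) i = i%:R by rewrite /psum sumr_const_nat subn1.
have -> : ineq_rhs p b (fun=> 1 : R) = (psum_oo b `^ p^-1)%E.
  apply: approximates_unique (approximates_rhs b0 p0 one0) _.
  have p0' : 0 < p^-1 by rewrite invr_gt0.
  apply: eq_approximates (approximates_powR p0' (approximates_psum_oo b0)) => N.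
  by congr (_ `^ _); apply: eq_psum => k _; rewrite powR1 mul1r.
rewrite /ineq_lhs; under [X in esups X]boolp.funext do rewrite psum1.
set L := (X in (X `^ _)%E) => h.
have [_ _ bN _] := approximates_psum_oo b0.
have [B BE] : exists B, psum_oo b = B%:E.
  exists (fine (psum_oo b)); rewrite fineK// ge0_fin_numE ?ltey//.
  exact: approximates_ge0 (approximates_psum_oo b0).
have B0 : 0 < B.
  rewrite -lte_fin -BE; apply: lt_le_trans (bN 1%N); rewrite lte_fin.
  by rewrite psumS psum0 add0r.
rewrite BE !poweR_EFin in h *.
apply: le_trans (lee_wpmul2r _ h) _; first by rewrite lee_fin powR_ge0.
have BB : B `^ p^-1 * B `^ (- p^-1) = 1 by rewrite -powRDpos// subrr powRr0.
by rewrite -muleA -EFinM BB mulr1.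
Qed.

End Admissible.

(** * The four cases *)

Section Characterizations.
Context {R : realType}.
Implicit Types (a b u x Phi mu lamk : nat -> R) (p q c C K : R) (L : nat -> \bar R).

(* Phi is recovered, up to c, from lower bounds for the p-th powers of the
   partial sums of normalized test sequences. *)
Definition tested p c b Phi lamk := exists lam,
  [/\ forall N, test_family p b N lam, nonneg_seq lamk,
      forall k i, (0 < k <= i)%N -> lamk k <= lam k i &
      forall n, (0 < n)%N -> exists2 k, (0 < k <= n)%N & Phi n <= c * lamk k].

Lemma root_product_powR p q (s A B : R) : 0 < q -> 0 <= s -> 0 <= A -> 0 <= B ->
  (s * A `^ q^-1 * B `^ p^-1) `^ q = s `^ q * A * B `^ (q / p).
Proof.
move=> q0 s0 A0 B0; rewrite !powRM ?mulr_ge0 ?powR_ge0// powRVK ?gt_eqF//.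
by rewrite -powRrM [p^-1 * q]mulrC.
Qed.

Lemma characterization_ge1 p q c : 0 < p -> 0 < q -> p <= q -> 0 < c ->
  exists2 c', 0 < c' & forall a b u Phi lamk L,
  nonneg_seq a -> nonneg_seq b -> nonneg_seq u -> 0 < b 1%N -> nonneg_seq Phi ->
  (forall n, (0 < n)%N -> L n = (Phi n `^ p^-1)%:E) ->
  sum_split p c b Phi -> tested p c b Phi lamk ->
  let D1 := esups (fun n => tail_sup u n * (psum a n `^ q^-1)%:E * L n)%E 1%N in
  let D2 := esups (fun n => (Ztail q a u n) `^ q^-1 * L n)%E 1%N in
  [/\ (0 <= D1)%E, (0 <= D2)%E & (0 <= C_3 p q a b u)%E] /\
  (forall K, 0 <= K -> (D1 <= K%:E)%E -> (D2 <= K%:E)%E -> (C_3 p q a b u <= K%:E)%E ->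
    admissible_constants p q a b u (c' * K)) /\
  (forall C, admissible_constants p q a b u C ->
    [/\ (D1 <= (c' * C)%:E)%E, (D2 <= (c' * C)%:E)%E & (C_3 p q a b u <= (c' * C)%:E)%E]).
Proof.
move=> p0 q0 pq c0; have [c1 c10 suff] := suff_ge1 p0 q0 pq c0.
(* The three terms serve sufficiency, the necessity of the two conditions with Phi, and that of
   [C_3]. *)
exists (c1 `^ q^-1 + c `^ p^-1 + 1).
  by rewrite !addr_gt0 ?powR_gt0.
set c' := _ + 1 => a b u Phi lamk L a0 b0 u0 b1 P0 LE split tst D1 D2.
have c'0 : 0 <= c' by rewrite !addr_ge0 ?powR_ge0.
have LP n : (0 < n)%N -> 0 <= Phi n `^ p^-1 /\ L n = (Phi n `^ p^-1)%:E.
  by move=> n0; rewrite LE// powR_ge0.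
have t1 := approximates_C1 q a u0 LP; have t2 := approximates_C2 q0 a0 u0 LP.
have t3 := approximates_C3 q a u (V := fun n => psum b n `^ (- p^-1))
  (fun n _ => powR_ge0 _ _).
rewrite -/D1 in t1; rewrite -/D2 in t2; rewrite -/(C_3 p q a b u) in t3.
have E1 N n : (0 < n <= N)%N -> (rmax u n N * psum a n `^ q^-1 * Phi n `^ p^-1) `^ q =
    rmax (unu q u) n N * psum a n * Phi n `^ (q / p).
  move=> /andP[n0 nN]; rewrite root_product_powR ?rmax_ge0 ?nonneg_psum ?P0//.
  by rewrite (rmax_powR q0)// => i /andP[ni _]; apply: u0; exact: leq_trans ni.
have E2 N n : (0 < n <= N)%N -> (Zfin q a u N n `^ q^-1 * Phi n `^ p^-1) `^ q =
    Zfin q a u N n * Phi n `^ (q / p).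
  move=> /andP[n0 nN]; have := @root_product_powR p q 1 (Zfin q a u N n) (Phi n) q0 ler01.
  by rewrite powR1 !mul1r => -> //; rewrite ?Zfin_ge0 ?P0.
have E3 n : (0 < n)%N -> (Wfin q a u n `^ q^-1 * psum b n `^ (- p^-1)) `^ q =
    Wfin q a u n * psum b n `^ (- (q / p)).
  move=> n0; rewrite powRM ?powR_ge0// powRVK ?gt_eqF ?Wfin_ge0// -powRrM.
  by rewrite mulNr [p^-1 * q]mulrC.
split; first by split; [exact: approximates_ge0 t1|exact: approximates_ge0 t2|exact:
  approximates_ge0 t3].
split=> [K K0 /(approximates_le _ t1) h1 /(approximates_le _ t2) h2 /(approximates_le _ t3) h3|C
  adm].
  apply: trunc_admissible => //; first by rewrite mulr_ge0.
  move=> N x x0 xni.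
  have := suff a b u Phi N (K `^ q) a0 b0 u0 b1 P0 split (powR_ge0 _ _) _ _ _ x x0 xni.
  set S := psum _ N; set P := psum _ N `^ (q / p) => h.
  apply: le_trans (h _ _ _) _ => [n nN|n nN|n nN|].
  - rewrite -E1//; apply: le_powR; [exact: ltW|by rewrite !mulr_ge0 ?powR_ge0 ?rmax_ge0|].
    apply: le_trans (h1 N).
    exact: (@le_rmax _ (fun n => rmax u n N * psum a n `^ q^-1 * Phi n `^ p^-1)).
  - rewrite -E2//; apply: le_powR; [exact: ltW|by rewrite !mulr_ge0 ?powR_ge0|].
    apply: le_trans (h2 N).
    exact: (@le_rmax _ (fun n => Zfin q a u N n `^ q^-1 * Phi n `^ p^-1)).
  - rewrite -E3; last by case/andP: nN.
    apply: le_powR; [exact: ltW|by rewrite !mulr_ge0 ?powR_ge0|].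
    apply: le_trans (h3 N).
    exact: (@le_rmax _ (fun n => Wfin q a u n `^ q^-1 * psum b n `^ (- p^-1))).
  rewrite ler_wpM2r ?powR_ge0// powRM// ler_wpM2r ?powR_ge0//.
  apply: le_powR_of_root => //; first exact: ltW.
  by rewrite /c' -addrA lerDl addr_ge0 ?powR_ge0.
have [C0 _] := adm.
have trunc N : trunc_ineq p q C a b u N by exact: admissible_trunc adm.
have cC : (c `^ p^-1 * C) `^ q = c `^ (q / p) * C `^ q.
  by rewrite powRM ?powR_ge0// -powRrM [p^-1 * q]mulrC.
have Q0 : 0 <= q / p by rewrite divr_ge0 ?ltW.
have bound y s : 0 <= y -> s = y `^ q -> s <= c `^ (q / p) * C `^ q -> y <= c' * C.
  move=> y0 -> h; apply: (@le_trans _ _ (c `^ p^-1 * C)); last first.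
    rewrite ler_wpM2r// /c' addrAC lerDr addr_ge0 ?powR_ge0//.
  by apply: (@powR_leK _ q) => //; [rewrite mulr_ge0 ?powR_ge0|rewrite cC].
have [lam [tf l0 ll Pl]] := tst.
have Phi_le s (n k : nat) : 0 <= s -> (0 < k)%N -> (0 < n)%N -> Phi n <= c * lamk k ->
    s * lamk k `^ (q / p) <= C `^ q -> s * Phi n `^ (q / p) <= c `^ (q / p) * C `^ q.
  move=> s0 k0 n0 Pk h; apply: (@le_trans _ _ (s * (c * lamk k) `^ (q / p))).
    by rewrite ler_wpM2l//; apply: le_powR => //; exact: P0.
  by rewrite powRM ?l0 ?(ltW c0)// mulrCA ler_wpM2l ?powR_ge0.
split.
- apply/(approximates_le _ t1) => N; apply: rmax_le; first by rewrite mulr_ge0.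
  move=> n nN; have /andP[n0 nN'] := nN; have [k kn Pk] := Pl n n0.
  have [h _] := nec_ge1 p0 q0 a0 b0 u0 (trunc N) (tf N) l0 ll kn nN'.
  apply: (bound _ _ _ (esym (E1 _ _ nN))); first by rewrite !mulr_ge0 ?powR_ge0 ?rmax_ge0.
  apply: (Phi_le _ n k) => //; last by case/andP: kn.
  by rewrite mulr_ge0 ?rmax_ge0 ?nonneg_psum.
- apply/(approximates_le _ t2) => N; apply: rmax_le; first by rewrite mulr_ge0.
  move=> n nN; have /andP[n0 nN'] := nN; have [k kn Pk] := Pl n n0.
  have [_ h] := nec_ge1 p0 q0 a0 b0 u0 (trunc N) (tf N) l0 ll kn nN'.
  apply: (bound _ _ _ (esym (E2 _ _ nN))); first by rewrite !mulr_ge0 ?powR_ge0.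
  apply: (Phi_le _ n k) => //; last by case/andP: kn.
  exact: Zfin_ge0.
- apply/(approximates_le _ t3) => N; apply: rmax_le; first by rewrite mulr_ge0.
  move=> n nN; have /andP[n0 nN'] := nN.
  have h := nec_ge1_W p0 q0 a0 b0 u0 b1 (trunc N) nN.
  apply: (@le_trans _ _ C).
    apply: (@powR_leK _ q) => //; first by rewrite mulr_ge0 ?powR_ge0.
    by rewrite E3.
  by rewrite ler_peMl// /c' lerDr addr_ge0 ?powR_ge0.
Qed.

Lemma characterization_lt1 p q c : 0 < p -> 0 < q -> q < p -> 0 < c ->
  exists2 c', 0 < c' & forall a b u Phi mu lamk L,
  nonneg_seq a -> nonneg_seq b -> nonneg_seq u -> 0 < b 1%N ->
  nonneg_seq Phi -> nonneg_seq mu -> Phi 0%N = 0 ->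
  (forall m n, (m <= n)%N -> Phi m <= Phi n) ->
  (forall k n, (0 < k < n)%N ->
     Phi n `^ (q / (p - q)) - Phi k `^ (q / (p - q)) <= rmax mu k.+1 n) ->
  (forall n, (0 < n)%N -> L n = (Phi n `^ (q / (p - q)))%:E) ->
  sum_split p c b Phi -> tested p c b Phi lamk ->
  (forall n, (0 < n)%N -> mu n <= (c * lamk n) `^ (q / (p - q))) ->
  let D4 := ((\sum_(1 <= n <oo)
     (Ztail q a u n) `^ (q / (p - q)) * (tail_sup u n) `^ q * (a n)%:E * L n)
       `^ ((p - q) / (p * q)))%E in
  let D5 := ((\sum_(1 <= n <oo) (psum a n `^ (q / (p - q)) * a n)%:E *
     esups (fun k => (tail_sup u k) `^ (p * q / (p - q)) * (mu k)%:E) n)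
       `^ ((p - q) / (p * q)))%E in
  (forall K, 0 <= K -> (D4 <= K%:E)%E -> (D5 <= K%:E)%E -> (C_6 p q a b u <= K%:E)%E ->
    (C_7 p q a b u <= K%:E)%E -> admissible_constants p q a b u (c' * K)) /\
  (forall C, admissible_constants p q a b u C ->
    [/\ (D4 <= (c' * C)%:E)%E, (D5 <= (c' * C)%:E)%E, (C_6 p q a b u <= (c' * C)%:E)%E &
        (C_7 p q a b u <= (c' * C)%:E)%E]).
Proof.
move=> p0 q0 qp c0; have pq0 : 0 < p - q by rewrite subr_gt0.
have [th thE] : exists th, th = q / (p - q) by eexists.
have [r rE] : exists r, r = p * q / (p - q) by eexists.
have [e eE] : exists e, e = (p - q) / (p * q) by eexists.
rewrite -thE -rE -eE.
have th0 : 0 < th by rewrite thE divr_gt0.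
have r0 : 0 < r by rewrite rE !(divr_gt0, mulr_gt0).
have er : e = r^-1 by rewrite eE rE invf_div.
have e0 : 0 < e by rewrite er invr_gt0.
have rth : r = q * (1 + th) by rewrite rE thE; field; rewrite gt_eqF.
have rp : r = p * th by rewrite rE thE mulrA.
have [c1 c10 suff] := suff_lt1 p0 q0 qp c0 thE.
have [c2 c20 nec] := nec_lt1 p0 q0 qp thE.
have [c3 c30 necW] := nec_lt1_W p0 q0 qp thE.
(* The terms of d serve the necessary conditions: c^th c2 for D4 and D5, c2 for [C_6], c3 for
   [C_7]. *)
have [d [d0 dE]] : exists d, 0 < d /\ d = c `^ th * c2 + c2 + c3.
  by eexists; split; last reflexivity; rewrite !addr_gt0 ?mulr_gt0 ?powR_gt0.
have dr : (d `^ r^-1) `^ r = d by rewrite powRVK ?gt_eqF// ltW.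
exists (c1 `^ q^-1 + d `^ e); first by rewrite addr_gt0 ?powR_gt0.
set c' := _ + _ `^ e => a b u Phi mu lamk L a0 b0 u0 b1 P0 mu0 P00 Pnd Pmu LE split tst ml D4 D5.
have c'0 : 0 <= c' by rewrite addr_ge0 ?powR_ge0.
have LP n : (0 < n)%N -> 0 <= Phi n `^ th /\ L n = (Phi n `^ th)%:E.
  by move=> n0; rewrite LE// powR_ge0.
have t4 := approximates_C4 q0 th0 e0 a0 u0 LP; rewrite -/D4 in t4.
have t5 := approximates_C5 th r0 e0 a0 u0 mu0; rewrite -/D5 in t5.
have om6 : nonneg_seq (fun k => u k `^ r * k%:R `^ r * psum b k `^ (- th)).
  by move=> k _; rewrite !mulr_ge0 ?powR_ge0.
have om7 : nonneg_seq (fun k => u k `^ q * k%:R `^ q * psum b k `^ (- th)).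
  by move=> k _; rewrite !mulr_ge0 ?powR_ge0.
have t6 : approximates (fun N => psum (fun n => psum a n `^ th * a n *
    rmax (fun k => u k `^ r * k%:R `^ r * psum b k `^ (- th)) n N) N `^ e) (C_6 p q a b u).
  by rewrite /C_6 -thE -rE -eE; exact: approximates_C6.
have t7 : approximates (fun N => psum (fun n => Wfin q a u n `^ th * a n *
    rmax (fun k => u k `^ q * k%:R `^ q * psum b k `^ (- th)) n N) N `^ e) (C_7 p q a b u).
  by rewrite /C_7 -thE -eE; exact: approximates_C7.
have nuq N k : (0 < k)%N -> rmax u k N `^ q = rmax (unu q u) k N.
  by move=> k0; rewrite (rmax_powR q0)// => i /andP[ki _]; apply: u0; exact: leq_trans ki.
have E4 N : psum (fun n => Zfin q a u N n `^ th * rmax u n N `^ q * a n * Phi n `^ th) N =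
    psum (fun k => Zfin q a u N k `^ th * (rmax (unu q u) k N * a k) * Phi k `^ th) N.
  by apply: eq_psum => k /andP[k0 _]; rewrite nuq// mulrA.
have E5 N : psum (fun n => psum a n `^ th * a n *
      rmax (fun k => rmax u k N `^ r * mu k) n N) N =
    psum (fun k => a k * psum a k `^ th *
      rmax (fun i => rmax (unu q u) i N `^ (1 + th) * mu i) k N) N.
  apply: eq_psum => k /andP[k0 _]; rewrite [a k * _]mulrC; congr (_ * _).
  apply: eq_big_nat => i /andP[ki _].
  by rewrite -nuq ?(leq_trans k0)// -powRrM -rth.
have E6 N : psum (fun n => psum a n `^ th * a n *
      rmax (fun k => u k `^ r * k%:R `^ r * psum b k `^ (- th)) n N) N =
    psum (fun k => a k * psum a k `^ th *
      rmax (fun i => uOm q u i `^ (1 + th) * psum b i `^ (- th)) k N) N.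
  apply: eq_psum => k _; rewrite [a k * _]mulrC; congr (_ * _).
  by apply: eq_big_nat => i _; rewrite /uOm powRM ?powR_ge0// -!powRrM -rth.
have S4_ge0 N : 0 <= psum (fun n =>
    Zfin q a u N n `^ th * rmax u n N `^ q * a n * Phi n `^ th) N.
  by apply: nonneg_psum => n n0; rewrite !mulr_ge0 ?powR_ge0 ?a0.
have S5_ge0 (F : nat -> nat -> R) N :
    0 <= psum (fun n => psum a n `^ th * a n * rmax (F N) n N) N.
  by apply: nonneg_psum => n n0; rewrite !mulr_ge0 ?powR_ge0 ?a0 ?rmax_ge0.
have S7_ge0 (F : nat -> R) N :
    0 <= psum (fun n => Wfin q a u n `^ th * a n * rmax F n N) N.
  by apply: nonneg_psum => n n0; rewrite !mulr_ge0 ?powR_ge0 ?a0 ?rmax_ge0.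
split=> [K K0 /(approximates_le _ t4) h4 /(approximates_le _ t5) h5
    /(approximates_le _ t6) h6 /(approximates_le _ t7) h7|C adm].
  apply: trunc_admissible => //; first by rewrite mulr_ge0.
  move=> N x x0 xni.
  have bound s : 0 <= s -> s `^ e <= K -> s <= K `^ r.
    by move=> s0; rewrite er; exact: le_powR_of_root.
  have := suff a b u Phi mu N (K `^ r) a0 b0 u0 b1 P0 mu0 P00 Pnd.
  rewrite -E4 -E5 -E6 => /(_ Pmu split (powR_ge0 _ _) (bound _ (S4_ge0 N) (h4 N))
    (bound _ (S5_ge0 (fun N k => rmax u k N `^ r * mu k) N) (h5 N))
    (bound _ (S5_ge0 (fun N k => _) N) (h6 N)) (bound _ (S7_ge0 _ N) (h7 N)) x x0 xni) h.
  apply: le_trans h _; rewrite -powRrM (_ : r * (1 - q / p) = q); last first.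
    by rewrite rE; field; rewrite !gt_eqF.
  rewrite ler_wpM2r ?powR_ge0// powRM// ler_wpM2r ?powR_ge0//.
  apply: le_powR_of_root => //; first exact: ltW.
  by rewrite /c' lerDl powR_ge0.
have [C0 _] := adm.
have trunc N : trunc_ineq p q C a b u N by exact: admissible_trunc adm.
have bound s : 0 <= s -> s <= d * (C `^ q) `^ (1 + th) -> s `^ e <= c' * C.
  move=> s0; rewrite -powRrM -rth => h; apply: (@le_trans _ _ (d `^ e * C)); last first.
    by rewrite ler_wpM2r// /c' lerDr powR_ge0.
  rewrite er; apply: root_le_of_powR => //; first by rewrite mulr_ge0 ?powR_ge0.
  by rewrite powRM ?powR_ge0// dr.
have [lam [tf l0 ll Pl]] := tst.
have dle s M : 0 <= M -> s <= (c `^ th * c2) * M \/ s <= c2 * M \/ s <= c3 * M -> s <= d * M.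
  have [A0 B0] : 0 <= c `^ th * c2 /\ 0 <= c2 by rewrite mulr_ge0 ?powR_ge0 ?(ltW c20).
  move=> M0 h; rewrite dE; case: h => [h|[h|h]]; apply: (le_trans h); rewrite ler_wpM2r//.
  - by rewrite -addrA lerDl addr_ge0// ltW.
  - by rewrite addrAC lerDr addr_ge0// ltW.
  - by rewrite lerDr addr_ge0.
have CC0 : 0 <= (C `^ q) `^ (1 + th) by exact: powR_ge0.
split.
- apply/(approximates_le _ t4) => N; apply: bound => //; rewrite E4.
  apply: dle => //; left.
  have [h _] := nec C a b u N lam lamk C0 a0 b0 u0 (trunc N) (tf N) l0 ll.
  rewrite -mulrA; apply: le_trans (ler_wpM2l (powR_ge0 c th) h).
  rewrite -psumM; apply: ler_psum => n /andP[n0 nN].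
  rewrite [leRHS]mulrCA ler_wpM2l//.
    by rewrite !mulr_ge0 ?powR_ge0 ?rmax_ge0 ?a0.
  have [k kn Pk] := Pl n n0; have k0 : (0 < k)%N by case/andP: kn.
  apply: (@le_trans _ _ (c `^ th * lamk k `^ th)).
    by rewrite -powRM ?l0 ?(ltW c0)//; apply: le_powR; rewrite ?P0 ?(ltW th0).
  by rewrite ler_wpM2l ?powR_ge0//; exact: (@le_rmax _ (fun j => lamk j `^ th)).
- apply/(approximates_le _ t5) => N; apply: bound; first exact: (S5_ge0 (fun N k => _)).
  rewrite E5; apply: dle => //; left.
  have [_ h] := nec C a b u N lam lamk C0 a0 b0 u0 (trunc N) (tf N) l0 ll.
  rewrite -mulrA; apply: le_trans (ler_wpM2l (powR_ge0 c th) h).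
  rewrite -psumM; apply: ler_psum => n /andP[n0 nN].
  rewrite [leRHS]mulrCA ler_wpM2l//; first by rewrite mulr_ge0 ?powR_ge0 ?a0.
  rewrite -rmaxM ?powR_ge0//; apply: le_rmax2 => k /andP[nk _].
  have k0 : (0 < k)%N by exact: leq_trans nk.
  rewrite mulrCA ler_wpM2l ?powR_ge0// -powRM ?l0 ?(ltW c0)//; exact: ml.
(* [C_6] follows from the second bound of [nec_lt1] for the normalized indicators, as u(k) is at
   most the tail maximum at k. *)
- apply/(approximates_le _ t6) => N; apply: bound; first exact: (S5_ge0 (fun N k => _)).
  rewrite E6; apply: dle => //; right; left.
  have B0 k : 0 <= psum b k by exact: nonneg_psum.
  have indle (k i : nat) : (0 < k <= i)%N -> k%:R `^ p / psum b k <= (minn i k)%:R `^ p / psum b k.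
    by move=> /andP[_ ki]; rewrite (minn_idPr ki).
  have [_ h] := nec C a b u N _ (fun k => k%:R `^ p / psum b k) C0 a0 b0 u0 (trunc N)
    (test_family_ind N p0 b0 b1) (fun k _ => divr_ge0 (powR_ge0 _ _) (B0 k))
    indle.
  apply: le_trans h; apply: ler_psum => n /andP[n0 nN].
  rewrite ler_wpM2l ?mulr_ge0 ?powR_ge0 ?a0//; apply: le_rmax2 => k /andP[nk kN].
  have k0 : (0 < k)%N by exact: leq_trans nk.
  rewrite [X in _ <= _ * X]powRM ?powR_ge0 ?invr_ge0//.
  rewrite -(powR_inv1 (B0 k)) -!powRrM mulN1r mulrA ler_wpM2r ?powR_ge0//.
  rewrite /uOm powRM ?powR_ge0// -[in X in _ * X <= _]powRrM -rth rp.
  rewrite ler_wpM2r ?powR_ge0//; apply: le_powR; rewrite ?powR_ge0 ?addr_ge0 ?(ltW th0)//.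
  by apply: (@le_rmax _ (unu q u)); rewrite leqnn.
- apply/(approximates_le _ t7) => N; apply: bound; first exact: S7_ge0.
  apply: dle => //; right; right; exact: necW.
Qed.

End Characterizations.

(** * From two-sided bounds to the equivalence with the best constant *)

Section Assembly.
Context {R : realType}.
Implicit Types (a b u x Phi mu lamk : nat -> R) (p q c C K : R) (X Y Z T U S M : \bar R).

Lemma sum_split_mono p c d b Phi : 0 < p -> c <= d -> nonneg_seq b -> nonneg_seq Phi ->
  sum_split p c b Phi -> sum_split p d b Phi.
Proof.
move=> p0 cd b0 P0 split x x0 xni.
have [G [f [[G0 f0 fni] [h1 h2 h3]]]] := split x x0 xni.
have N0 n : 0 <= psum (fun m => x m `^ p * b m) n.
  by apply: nonneg_psum => m m0; rewrite mulr_ge0 ?powR_ge0 ?b0.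
exists G, f; split=> //; split=> [[|n]|N|N].
- by rewrite !psum0 !powR0 ?gt_eqF// mul0r addr0 mulr0.
- apply: le_trans (h1 _) _; rewrite ler_wpM2r// addr_ge0 ?mulr_ge0 ?powR_ge0 ?f0//.
  by apply: nonneg_psum => m m0; rewrite mulr_ge0 ?G0 ?P0.
- by apply: le_trans (h2 _) _; rewrite ler_wpM2r.
- by apply: le_trans (h3 _) _; rewrite ler_wpM2r.
Qed.

Lemma tested_mono p c d b Phi lamk : c <= d -> tested p c b Phi lamk -> tested p d b Phi lamk.
Proof.
move=> cd [lam [tf l0 ll Pl]]; exists lam; split=> // n n0; have [k kn Pk] := Pl n n0.
exists k => //; apply: le_trans Pk _; rewrite ler_wpM2r// l0//; by case/andP: kn.
Qed.

Lemma split_tested_gt1 p : 1 < p -> exists2 c, 0 < c & forall b, nonneg_seq b -> 0 < b 1%N ->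
  exists lamk, [/\ sum_split p c b (fun n => Vsum p b n `^ (p - 1)),
    tested p c b (fun n => Vsum p b n `^ (p - 1)) lamk &
    forall n, Vsum p b n `^ (p - 1) <= c * lamk n].
Proof.
move=> p1; have p0 : 0 < p by exact: lt_trans p1.
have [c1 c10 split] := sum_split_gt1 p1; have [c2 c20 tf] := test_family_V p1.
have c12 : c1 <= c1 + c2 by rewrite lerDl ltW.
have c21 : c2 <= c1 + c2 by rewrite lerDr ltW.
exists (c1 + c2) => [|b b0 b1]; first exact: addr_gt0.
have l0 n : 0 <= c2^-1 * Vsum p b n `^ (p - 1) by rewrite mulr_ge0 ?powR_ge0// invr_ge0 ltW.
have lE n : Vsum p b n `^ (p - 1) = c2 * (c2^-1 * Vsum p b n `^ (p - 1)).
  by rewrite mulrA divff ?mul1r// gt_eqF.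
exists (fun n => c2^-1 * Vsum p b n `^ (p - 1)); split.
- apply: (sum_split_mono p0 c12 b0) (split b b0 b1) => n _; exact: powR_ge0.
- apply: (tested_mono c21); exists (fun k i => if (k <=
  i)%N then c2^-1 * Vsum p b k `^ (p - 1) else 0).
  split=> [N|//|k i /andP[_ ->]//|n n0]; first exact: tf.
  by exists n; [rewrite n0 leqnn|rewrite -lE].
- by move=> n; rewrite {1}lE ler_wpM2r.
Qed.

Lemma split_tested_le1 p : 0 < p <= 1 -> exists2 c, 0 < c & forall b, nonneg_seq b -> 0 < b 1%N ->
  [/\ sum_split p c b (fun n => rmax (fun j => j%:R `^ p / psum b j) 1 n),
    tested p c b (fun n => rmax (fun j => j%:R `^ p / psum b j) 1 n) (fun j => j%:R `^ p / psum b
      j) &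
    forall n, n%:R `^ p / psum b n <= c * (n%:R `^ p / psum b n)].
Proof.
move=> p01; have /andP[p0 p1] := p01.
have c1 : 1 <= p^-1 + 1 by rewrite lerDr invr_ge0 ltW.
exists (p^-1 + 1) => [|b b0 b1]; first by rewrite addr_gt0 ?invr_gt0.
have l0 n : 0 <= n%:R `^ p / psum b n by rewrite divr_ge0 ?powR_ge0 ?nonneg_psum.
split.
- apply: (sum_split_mono p0 _ b0) (sum_split_le1 p01 b0 b1) => [|n _]; last exact: rmax_ge0.
  by rewrite lerDl.
- apply: (tested_mono c1); exists (fun k i => (minn i k)%:R `^ p / psum b k).
  split=> [N|//|k i /andP[_ ki]|n n0]; first exact: test_family_ind.
    by rewrite (minn_idPr ki).
  have [k kn ->] := rmax_attained n0 (fun k _ => l0 k); exists k => //.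
  by rewrite mul1r.
- by move=> n; rewrite ler_peMl.
Qed.

Lemma lteDy X Y : (0 <= X -> 0 <= Y -> (X + Y < +oo) = (X < +oo) && (Y < +oo))%E.
Proof.
move=> X0 Y0; apply/idP/andP => [h|[]]; last exact: lte_add_pinfty.
by split; apply: le_lt_trans h; rewrite ?leeDl ?leeDr.
Qed.

Lemma leeD_lee (K : R) X Y : (0 <= X -> 0 <= Y -> X + Y <= K%:E -> X <= K%:E /\ Y <= K%:E)%E.
Proof. by move=> X0 Y0 h; split; apply: le_trans h; rewrite ?leeDl ?leeDr. Qed.

Lemma lteD3y X Y Z : (0 <= X -> 0 <= Y -> 0 <= Z ->
  (X + Y + Z < +oo) = (maxe X (maxe Y Z) < +oo))%E.
Proof. by move=> *; rewrite !gt_max !lteDy ?adde_ge0// !andbA. Qed.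

Lemma lteD4y X Y Z T : (0 <= X -> 0 <= Y -> 0 <= Z -> 0 <= T ->
  (X + Y + Z + T < +oo) = (maxe X (maxe Y (maxe Z T)) < +oo))%E.
Proof. by move=> *; rewrite !gt_max !lteDy ?adde_ge0// !andbA. Qed.

Lemma lteD5y X Y Z T U : (0 <= X -> 0 <= Y -> 0 <= Z -> 0 <= T -> 0 <= U ->
  (X + Y + Z + T + U < +oo) = (maxe X (maxe Y (maxe Z (maxe T U))) < +oo))%E.
Proof. by move=> *; rewrite !gt_max !lteDy ?adde_ge0// !andbA. Qed.

(** The sufficient condition at K = S bounds the infimum from above when S is finite, and the
    necessary one at every admissible C bounds it from below. *)
Lemma equivalence_of_bounds p q a b u S M c1 c2 c : (0 <= S)%E ->
  ((S < +oo) = (M < +oo))%E -> 0 < c -> c1 <= c -> c2 <= c ->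
  (forall K, 0 <= K -> (S <= K%:E)%E -> admissible_constants p q a b u (c1 * K)) ->
  (forall C, admissible_constants p q a b u C -> (S <= (c2 * C)%:E)%E) ->
  (inequality_holds p q a b u <-> (M < +oo)%E) /\
  equiv_upto c (best_constant p q a b u) S.
Proof.
move=> S0 SM c0 c1c c2c suff nec; split.
  rewrite -SM; split=> [[C adm]|Soo]; first by apply: le_lt_trans (nec C adm) _; rewrite ltry.
  have Sf : S \is a fin_num by rewrite ge0_fin_numE.
  by exists (c1 * fine S); apply: suff; rewrite ?fine_ge0 ?fineK.
split.
  apply: le_ereal_inf_tmp => _ [C adm <-]; have [C0 _] := adm.
  have h : (S <= (c * C)%:E)%E.
    by apply: le_trans (nec C adm) _; rewrite lee_fin ler_wpM2r.
  apply: le_trans (lee_wpmul2l _ h) _; first by rewrite lee_fin invr_ge0 ltW.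
  by rewrite -EFinM mulrA mulVf ?mul1r// gt_eqF.
have [Soo|] := ltP S +oo%E; last first.
  by rewrite leye_eq => /eqP ->; rewrite gt0_muley ?lte_fin// leey.
have Sf : S \is a fin_num by rewrite ge0_fin_numE.
apply: (@le_trans _ _ (c1 * fine S)%:E).
  apply: ereal_inf_lbound; exists (c1 * fine S) => //.
  by apply: suff; rewrite ?fine_ge0 ?fineK.
by rewrite -[in leRHS](fineK Sf) -EFinM lee_fin ler_wpM2r ?fine_ge0.
Qed.

End Assembly.

Section Cases.
Context {R : realType}.
Implicit Types (a b u : nat -> R) (p q c : R).

Lemma C_0_ge0 p q a b u : (0 <= C_0 p q a b u)%E.
Proof. by rewrite /C_0; case: ifP => // _; rewrite mule_ge0 ?poweR_ge0. Qed.

Lemma case_gt1_ge p q : 1 < p -> p <= q -> exists2 c0, 0 < c0 & forall c a b u, c0 <= c ->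
  nonneg_seq a -> nonneg_seq b -> nonneg_seq u -> 0 < b 1%N ->
  (inequality_holds p q a b u <->
   maxe (C_0 p q a b u) (maxe (C_1 p q a b u)
     (maxe (C_2 p q a b u) (C_3 p q a b u))) < +oo)%E /\
  equiv_upto c (best_constant p q a b u)
    (C_0 p q a b u + C_1 p q a b u + C_2 p q a b u + C_3 p q a b u)%E.
Proof.
move=> p1 pq; have p0 : 0 < p by exact: lt_trans p1.
have q0 : 0 < q by exact: lt_le_trans pq.
have [d d0 split] := split_tested_gt1 p1.
have [c' c'0 char] := characterization_ge1 p0 q0 pq d0.
(* 1 for [C_0] and c' for each of the three other constants. *)
exists (1 + c' *+ 3) => [|c a b u cc a0 b0 u0 b1]; first by rewrite addr_gt0// mulrn_wgt0.
have [lamk [sp ts _]] := split b b0 b1.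
have P0 : nonneg_seq (fun n => Vsum p b n `^ (p - 1)) by move=> n _; exact: powR_ge0.
have LE n : (0 < n)%N ->
    (Vsum p b n `^ ((p - 1) / p))%:E = ((Vsum p b n `^ (p - 1)) `^ p^-1)%:E.
  by move=> _; rewrite -powRrM.
have := char a b u _ lamk _ a0 b0 u0 b1 P0 LE sp ts.
rewrite -/(C_1 p q a b u) -/(C_2 p q a b u) => -[[C10 C20 C30] [suff nec]].
have C00 := C_0_ge0 p q a b u.
have c0 : 0 < c by apply: (lt_le_trans _ cc); rewrite addr_gt0// mulrn_wgt0.
have c'c : c' <= c.
  apply: (le_trans _ cc); rewrite mulrS addrCA lerDl addr_ge0// mulrn_wge0//; exact: ltW.
apply: (equivalence_of_bounds _ _ c0 c'c cc).
- exact: adde_ge0 (adde_ge0 (adde_ge0 C00 C10) C20) C30.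
- exact: (lteD4y C00 C10 C20 C30).
- move=> K K0 h; have [h' h3] := leeD_lee (adde_ge0 (adde_ge0 C00 C10) C20) C30 h.
  have [h'' h2] := leeD_lee (adde_ge0 C00 C10) C20 h'.
  by have [_ h1] := leeD_lee C00 C10 h''; exact: suff K0 h1 h2 h3.
- move=> C adm; have [h1 h2 h3] := nec C adm.
  have h0 := admissible_C_0 p0 q0 a0 b0 u0 b1 adm.
  apply: le_trans (leeD (leeD (leeD h0 h1) h2) h3) _.
  by rewrite -!EFinD lee_fin mulrDl mul1r mulrnAl !mulrS mulr0n addr0 !addrA.
Qed.

Lemma case_gt1_lt p q : 1 < p -> 0 < q -> q < p -> exists2 c0, 0 < c0 & forall c a b u, c0 <= c ->
  nonneg_seq a -> nonneg_seq b -> nonneg_seq u -> 0 < b 1%N ->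
  (inequality_holds p q a b u <->
   maxe (C_0 p q a b u) (maxe (C_4 p q a b u) (maxe (C_5 p q a b u)
     (maxe (C_6 p q a b u) (C_7 p q a b u)))) < +oo)%E /\
  equiv_upto c (best_constant p q a b u)
    (C_0 p q a b u + C_4 p q a b u + C_5 p q a b u + C_6 p q a b u + C_7 p q a b u)%E.
Proof.
move=> p1 q0 qp; have p0 : 0 < p by exact: lt_trans p1.
have pq0 : 0 < p - q by rewrite subr_gt0.
have th0 : 0 <= q / (p - q) by rewrite divr_ge0 ?ltW.
have p10 : 0 < p - 1 by rewrite subr_gt0.
have [d d0 split] := split_tested_gt1 p1.
have [c' c'0 char] := characterization_lt1 p0 q0 qp d0.
exists (1 + c' *+ 4) => [|c a b u cc a0 b0 u0 b1]; first by rewrite addr_gt0// mulrn_wgt0.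
have [lamk [sp ts lE]] := split b b0 b1.
pose Phi n := Vsum p b n `^ (p - 1).
pose mu n := Vsum p b n `^ ((p - 1) * q / (p - q)).
have P0 : nonneg_seq Phi by move=> n _; exact: powR_ge0.
have mu0 : nonneg_seq mu by move=> n _; exact: powR_ge0.
have muE n : mu n = Phi n `^ (q / (p - q)) by rewrite /mu /Phi -powRrM mulrA.
have P00 : Phi 0%N = 0 by rewrite /Phi Vsum0 powR0// gt_eqF.
have Pnd m n : (m <= n)%N -> Phi m <= Phi n.
  by move=> mn; apply: le_powR; [exact: ltW|exact: Vsum_ge0|exact: Vsum_nondecr].
have Pmu k n : (0 < k < n)%N ->
    Phi n `^ (q / (p - q)) - Phi k `^ (q / (p - q)) <= rmax mu k.+1 n.
  (* Here mu = Phi^th, so it suffices to discard the subtracted term. *)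
  move=> /andP[_ kn]; apply: (@le_trans _ _ (mu n)); last by apply: le_rmax; rewrite kn leqnn.
  by rewrite muE lerBlDr lerDl powR_ge0.
have LE n : (0 < n)%N -> (mu n)%:E = (Phi n `^ (q / (p - q)))%:E by rewrite muE.
have ml n : (0 < n)%N -> mu n <= (d * lamk n) `^ (q / (p - q)).
  by move=> n0; rewrite muE; apply: le_powR => //; [exact: P0|exact: lE].
have := char a b u Phi mu lamk _ a0 b0 u0 b1 P0 mu0 P00 Pnd Pmu LE sp ts ml.
rewrite -/(C_4 p q a b u) -/(C_5 p q a b u) => -[suff nec].
have C00 := C_0_ge0 p q a b u.
have C40 : (0 <= C_4 p q a b u)%E by exact: poweR_ge0.
have C50 : (0 <= C_5 p q a b u)%E by exact: poweR_ge0.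
have C60 : (0 <= C_6 p q a b u)%E by exact: poweR_ge0.
have C70 : (0 <= C_7 p q a b u)%E by exact: poweR_ge0.
have c0 : 0 < c by apply: (lt_le_trans _ cc); rewrite addr_gt0// mulrn_wgt0.
have c'c : c' <= c.
  apply: (le_trans _ cc); rewrite mulrS addrCA lerDl addr_ge0// mulrn_wge0//; exact: ltW.
apply: (equivalence_of_bounds _ _ c0 c'c cc).
- exact: adde_ge0 (adde_ge0 (adde_ge0 (adde_ge0 C00 C40) C50) C60) C70.
- exact: (lteD5y C00 C40 C50 C60 C70).
- move=> K K0 h.
  have [h' h4] := leeD_lee (adde_ge0 (adde_ge0 (adde_ge0 C00 C40) C50) C60) C70 h.
  have [h'' h3] := leeD_lee (adde_ge0 (adde_ge0 C00 C40) C50) C60 h'.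
  have [h0 h2] := leeD_lee (adde_ge0 C00 C40) C50 h''.
  by have [_ h1] := leeD_lee C00 C40 h0; exact: suff K0 h1 h2 h3 h4.
- move=> C adm; have [h1 h2 h3 h4] := nec C adm.
  have h0 := admissible_C_0 p0 q0 a0 b0 u0 b1 adm.
  apply: le_trans (leeD (leeD (leeD (leeD h0 h1) h2) h3) h4) _.
  by rewrite -!EFinD lee_fin mulrDl mul1r mulrnAl !mulrS mulr0n addr0 !addrA.
Qed.

Lemma case_le1_ge p q : 0 < p -> p <= 1 -> p <= q -> exists2 c0, 0 < c0 & forall c a b u, c0 <= c ->
  nonneg_seq a -> nonneg_seq b -> nonneg_seq u -> 0 < b 1%N ->
  (inequality_holds p q a b u <->
   maxe (C_8 p q a b u) (maxe (C_9 p q a b u) (C_10 p q a b u)) < +oo)%E /\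
  equiv_upto c (best_constant p q a b u)
    (C_8 p q a b u + C_9 p q a b u + C_10 p q a b u)%E.
Proof.
move=> p0 p1 pq; have q0 : 0 < q by exact: lt_le_trans pq.
have p01 : 0 < p <= 1 by rewrite p0.
have [d d0 split] := split_tested_le1 p01.
have [c' c'0 char] := characterization_ge1 p0 q0 pq d0.
exists (c' *+ 3) => [|c a b u cc a0 b0 u0 b1]; first by rewrite mulrn_wgt0.
have [sp ts _] := split b b0 b1.
pose Phi n := rmax (fun j => j%:R `^ p / psum b j) 1 n.
have P0 : nonneg_seq Phi by move=> n _; exact: rmax_ge0.
have B0 n : 0 <= psum b n by exact: nonneg_psum.
have LE n : (0 < n)%N ->
    range_sup (fun m => (m%:R * psum b m `^ (- p^-1))%:E) 1%N n = (Phi n `^ p^-1)%:E.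
  move=> n0; rewrite range_sup_rmax//; last by move=> k _; rewrite mulr_ge0 ?powR_ge0.
  rewrite rmax_powR ?invr_gt0//; last by move=> k _; rewrite divr_ge0 ?powR_ge0.
  congr EFin; apply: eq_big_nat => k _; rewrite powRM ?powR_ge0 ?invr_ge0//.
  by rewrite powRK ?gt_eqF// -(powR_inv1 (B0 k)) -powRrM mulN1r.
have := char a b u _ _ _ a0 b0 u0 b1 P0 LE sp ts.
rewrite -/(C_8 p q a b u) -/(C_9 p q a b u) -[C_3 p q a b u]/(C_10 p q a b u) => -[[C10 C20 C30]
  [suff nec]].
have c0 : 0 < c by apply: (lt_le_trans _ cc); rewrite mulrn_wgt0.
have c'c : c' <= c by apply: (le_trans _ cc); rewrite mulrS lerDl mulrn_wge0//; exact: ltW.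
apply: (equivalence_of_bounds _ _ c0 c'c cc).
- exact: adde_ge0 (adde_ge0 C10 C20) C30.
- exact: (lteD3y C10 C20 C30).
- move=> K K0 h; have [h' h3] := leeD_lee (adde_ge0 C10 C20) C30 h.
  by have [h1 h2] := leeD_lee C10 C20 h'; exact: suff K0 h1 h2 h3.
- move=> C adm; have [h1 h2 h3] := nec C adm.
  apply: le_trans (leeD (leeD h1 h2) h3) _.
  by rewrite -!EFinD lee_fin mulrnAl !mulrS mulr0n addr0 !addrA.
Qed.

(** u is at most its tail supremum. Thus for p <= 1 the condition [C_6] in the general
    characterization is contained in [C_12]. *)
Lemma C_6_le_C_12 p q a b u : 0 < p -> 0 < q -> q < p ->
  nonneg_seq a -> nonneg_seq b -> nonneg_seq u -> (C_6 p q a b u <= C_12 p q a b u)%E.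
Proof.
move=> p0 q0 qp a0 b0 u0; have pq0 : 0 < p - q by rewrite subr_gt0.
have e0 : 0 < (p - q) / (p * q) by rewrite divr_gt0// mulr_gt0.
have r0 : 0 < p * q / (p - q) by rewrite divr_gt0// mulr_gt0.
have V6 : nonneg_seq (fun k => u k `^ (p * q / (p - q)) * k%:R `^ (p * q / (p - q)) *
    psum b k `^ (- (q / (p - q)))).
  by move=> k _; rewrite !mulr_ge0 ?powR_ge0.
have V12 : nonneg_seq (fun k => k%:R `^ (p * q / (p - q)) * psum b k `^ (- (q / (p - q)))).
  by move=> k _; rewrite mulr_ge0 ?powR_ge0.
have [_ _ _ h6] := approximates_C6 (q / (p - q)) e0 a0 V6.
have [_ _ h12 _] := approximates_C5 (q / (p - q)) r0 e0 a0 u0 V12.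
apply: h6 => N; apply: le_trans (h12 N); rewrite lee_fin.
apply: le_powR; first exact: ltW.
  by apply: nonneg_psum => n n0; rewrite !mulr_ge0 ?powR_ge0 ?a0 ?rmax_ge0.
apply: ler_psum => n /andP[n0 nN]; rewrite ler_wpM2l ?mulr_ge0 ?powR_ge0 ?a0//.
apply: le_rmax2 => k /andP[nk kN]; rewrite mulrA ler_wpM2r ?powR_ge0//.
rewrite ler_wpM2r ?powR_ge0//; apply: le_powR; first exact: ltW.
  by apply: u0; exact: leq_trans nk.
by apply: le_rmax; rewrite leqnn.
Qed.

Lemma case_le1_lt p q : 0 < q -> q < p -> p <= 1 -> exists2 c0, 0 < c0 & forall c a b u, c0 <= c ->
  nonneg_seq a -> nonneg_seq b -> nonneg_seq u -> 0 < b 1%N ->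
  (inequality_holds p q a b u <->
   maxe (C_11 p q a b u) (maxe (C_12 p q a b u) (C_13 p q a b u)) < +oo)%E /\
  equiv_upto c (best_constant p q a b u)
    (C_11 p q a b u + C_12 p q a b u + C_13 p q a b u)%E.
Proof.
move=> q0 qp p1; have p0 : 0 < p by exact: lt_trans qp.
have pq0 : 0 < p - q by rewrite subr_gt0.
have th0 : 0 < q / (p - q) by rewrite divr_gt0.
have p01 : 0 < p <= 1 by rewrite p0.
have [d d0 split] := split_tested_le1 p01.
have [c' c'0 char] := characterization_lt1 p0 q0 qp d0.
exists (c' *+ 3) => [|c a b u cc a0 b0 u0 b1]; first by rewrite mulrn_wgt0.
have [sp ts lE] := split b b0 b1.
pose lamk j := j%:R `^ p / psum b j.
pose Phi n := rmax lamk 1 n.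
pose mu k := k%:R `^ (p * q / (p - q)) * psum b k `^ (- (q / (p - q))).
have B0 n : 0 <= psum b n by exact: nonneg_psum.
have l0 n : 0 <= lamk n by rewrite divr_ge0 ?powR_ge0.
have P0 : nonneg_seq Phi by move=> n _; exact: rmax_ge0.
have mu0 : nonneg_seq mu by move=> n _; rewrite mulr_ge0 ?powR_ge0.
have muE n : mu n = lamk n `^ (q / (p - q)).
  rewrite /lamk powRM ?powR_ge0 ?invr_ge0// -(powR_inv1 (B0 n)) -!powRrM mulN1r.
  by rewrite mulrA.
have P00 : Phi 0%N = 0 by rewrite /Phi /rmax big_geq.
have Pnd m n : (m <= n)%N -> Phi m <= Phi n.
  move=> mn; apply: rmax_le; first exact: rmax_ge0.
  by move=> k /andP[k0 km]; apply: le_rmax; rewrite k0 (leq_trans km).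
have Pmu k n : (0 < k < n)%N ->
    Phi n `^ (q / (p - q)) - Phi k `^ (q / (p - q)) <= rmax mu k.+1 n.
  move=> /andP[k0 kn]; have n0 : (0 < n)%N by exact: ltn_trans kn.
  have [j /andP[j0 jn]] := rmax_attained n0 (fun k _ => l0 k); rewrite -/(Phi n) => ->.
  have [jk|kj] := leqP j k.
    apply: le_trans (rmax_ge0 _ _ _); rewrite subr_le0; apply: le_powR => //; first exact: ltW.
    by apply: le_rmax; rewrite j0.
  apply: (@le_trans _ _ (mu j)); last by apply: le_rmax; rewrite kj.
  by rewrite muE lerBlDr lerDl powR_ge0.
have LE n : (0 < n)%N -> range_sup (fun k => (mu k)%:E) 1%N n = (Phi n `^ (q / (p - q)))%:E.
  move=> n0; rewrite range_sup_rmax// => [|k /andP[k0 _]]; last exact: mu0.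
  rewrite rmax_powR//.
  by congr EFin; apply: eq_big_nat => k _.
have ml n : (0 < n)%N -> mu n <= (d * lamk n) `^ (q / (p - q)).
  by move=> n0; rewrite muE; apply: le_powR; [exact: ltW|exact: l0|exact: lE].
have := char a b u Phi mu lamk _ a0 b0 u0 b1 P0 mu0 P00 Pnd Pmu LE sp ts ml.
rewrite -/(C_11 p q a b u) -/(C_12 p q a b u) -[C_7 p q a b u]/(C_13 p q a b u) => -[suff nec].
have C10 : (0 <= C_11 p q a b u)%E by exact: poweR_ge0.
have C20 : (0 <= C_12 p q a b u)%E by exact: poweR_ge0.
have C30 : (0 <= C_13 p q a b u)%E by exact: poweR_ge0.
have c0 : 0 < c by apply: (lt_le_trans _ cc); rewrite mulrn_wgt0.
have c'c : c' <= c by apply: (le_trans _ cc); rewrite mulrS lerDl mulrn_wge0//; exact: ltW.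
apply: (equivalence_of_bounds _ _ c0 c'c cc).
- exact: adde_ge0 (adde_ge0 C10 C20) C30.
- exact: (lteD3y C10 C20 C30).
- move=> K K0 h; have [h' h3] := leeD_lee (adde_ge0 C10 C20) C30 h.
  have [h1 h2] := leeD_lee C10 C20 h'.
  have h6 : (C_6 p q a b u <= K%:E)%E := le_trans (C_6_le_C_12 p0 q0 qp a0 b0 u0) h2.
  exact: suff K0 h1 h2 h6 h3.
- move=> C adm; have [h1 h2 _ h3] := nec C adm.
  apply: le_trans (leeD (leeD h1 h2) h3) _.
  by rewrite -!EFinD lee_fin mulrnAl !mulrS mulr0n addr0 !addrA.
Qed.

End Cases.

Local Open Scope ereal_scope.

Theorem theorem2p3 (R : realType) (p q : R) (hp : (0 < p)%R) (hq : (0 < q)%R) :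
  exists2 c : R, (0 < c)%R &
  forall a b u : nat -> R,
    nonneg_seq a -> nonneg_seq b -> nonneg_seq u -> (0 < b 1%N)%R ->
  [/\ (1 < p)%R -> (p <= q)%R ->
        (inequality_holds p q a b u <->
         maxe (C_0 p q a b u) (maxe (C_1 p q a b u)
           (maxe (C_2 p q a b u) (C_3 p q a b u))) < +oo) /\
        equiv_upto c (best_constant p q a b u)
          (C_0 p q a b u + C_1 p q a b u + C_2 p q a b u + C_3 p q a b u),
      (1 < p)%R -> (q < p)%R ->
        (inequality_holds p q a b u <->
         maxe (C_0 p q a b u) (maxe (C_4 p q a b u) (maxe (C_5 p q a b u)
           (maxe (C_6 p q a b u) (C_7 p q a b u)))) < +oo) /\
        equiv_upto c (best_constant p q a b u)
          (C_0 p q a b u + C_4 p q a b u + C_5 p q a b u + C_6 p q a b u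
           + C_7 p q a b u),
      (p <= 1)%R -> (p <= q)%R ->
        (inequality_holds p q a b u <->
         maxe (C_8 p q a b u) (maxe (C_9 p q a b u) (C_10 p q a b u)) < +oo) /\
        equiv_upto c (best_constant p q a b u)
          (C_8 p q a b u + C_9 p q a b u + C_10 p q a b u)
    & (q < p)%R -> (p <= 1)%R ->
        (inequality_holds p q a b u <->
         maxe (C_11 p q a b u) (maxe (C_12 p q a b u) (C_13 p q a b u)) < +oo) /\
        equiv_upto c (best_constant p q a b u)
          (C_11 p q a b u + C_12 p q a b u + C_13 p q a b u)].
Proof.
(* A case excluded by p and q receives the constant 1, so that the four constants can be added. *)
have vacuous (h : Prop) (P : R -> Prop) :
    (h -> exists2 c, (0 < c)%R & P c) -> exists2 c, (0 < c)%R & h -> P c.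
  have [hh /(_ hh)[c c0 Pc]|nh _] := pselect h; first by exists c.
  by exists 1%R.
have [c1 c10 H1] := vacuous (1 < p /\ p <= q)%R _ (fun h => case_gt1_ge h.1 h.2).
have [c2 c20 H2] := vacuous (1 < p /\ q < p)%R _ (fun h => case_gt1_lt h.1 hq h.2).
have [c3 c30 H3] := vacuous (p <= 1 /\ p <= q)%R _ (fun h => case_le1_ge hp h.1 h.2).
have [c4 c40 H4] := vacuous (q < p /\ p <= 1)%R _ (fun h => case_le1_lt hq h.1 h.2).
exists (c1 + c2 + (c3 + c4))%R => [|a b u a0 b0 u0 b1]; first by rewrite !addr_gt0.
have c120 : (0 <= c1 + c2)%R by rewrite addr_ge0// ltW.
have c340 : (0 <= c3 + c4)%R by rewrite addr_ge0// ltW.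
split=> h1 h2; [apply: H1|apply: H2|apply: H3|apply: H4] => //.
- by rewrite -addrA lerDl addr_ge0// ltW.
- by rewrite addrAC lerDr addr_ge0// ltW.
- by rewrite addrCA lerDl addr_ge0// ltW.
- by rewrite addrA lerDr addr_ge0// ltW.
Qed.
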